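(* Let $k$ be a $\Delta=\{\partial_0,\partial_1,\ldots,\partial_m\}$-field and assume that $C_k^0=\{c\in k:\partial_0c=0\}$ is a differentially closed $\Pi=\{\partial_1,\ldots,\partial_m\}$-field. Let $K$ be a PPV-extension of $k$ (for some equation $\partial_0Y=AY$, $A\in\mathrm{gl}_n(k)$) with PPV-group $G$. The following are equivalent: 1. $G$ contains a solvable subgroup $H$ of finite index; 2. $K$ is a parameterized liouvillian extension of $k$; 3. $K$ is contained in a parameterized liouvillian extension of $k$.
   Context: All fields have characteristic zero; a $\Delta$-field is a field with commuting derivations $\Delta$. $C_L^0$ denotes the $\partial_0$-constants of $L$, and $L\langle t\rangle_\Delta$ is the field generated over $L$ by $t$ and all its derivatives. A $\Pi$-field $k_0$ is differentially closed if every finite system $P_1=\cdots=P_r=0,\ Q\ne0$ of differential polynomials over $k_0$ that has a solution in some $\Pi$-extension field of $k_0$ has a solution in $k_0$. A PPV-extension of $k$ for $\partial_0Y=AY$ is a $\Delta$-field $K=k\langle z_{1,1},\dots,z_{n,n}\rangle_\Delta$ where $Z=(z_{i,j})\in\mathrm{GL}_n(K)$ satisfies $\partial_0Z=AZ$ and $C_K^0=C_k^0$; its PPV-group is the group of $k$-automorphisms of $K$ commuting with all $\partial\in\Delta$, identified with a subgroup of $\mathrm{GL}_n(C_k^0)$ via $\sigma(Z)=ZM_\sigma$. A $\Delta$-field $L\supset k$ is a parameterized liouvillian extension of $k$ if $C_L^0=C_k^0$ and there is a tower of $\Delta$-fields $k=L_0\subset L_1\subset\cdots\subset L_r=L$ with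 $L_i=L_{i-1}\langle t_i\rangle_\Delta$, where for each $i$ either $\partial_0t_i\in L_{i-1}$, or $t_i\neq0$ and $\partial_0t_i/t_i\in L_{i-1}$, or $t_i$ is algebraic over $L_{i-1}$. *)

(* Defs.v *)
From HB Require Import structures.
From mathcomp Require Import all_boot all_order all_algebra.
Set Implicit Arguments. Unset Strict Implicit. Unset Printing Implicit Defensive.
Import Order.TTheory GRing.Theory Num.Theory.
Local Open Scope ring_scope.

Definition is_derivation (F : fieldType) (d : F -> F) : Prop :=
  (forall x y, d (x + y) = d x + d y) /\ (forall x y, d (x * y) = d x * y + x * d y).

Record DField (n : nat) : Type := {
  df_car :> fieldType;
  der : 'I_n -> df_car -> df_car;
  der_is_derivation : forall i, is_derivation (der i);
  der_comm : forall i j x, der i (der j x) = der j (der i x) }.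
Arguments der {n} d i x : rename.

Definition dmorph (n : nat) (F L : DField n) (f : F -> L) : Prop :=
  forall i x, f (der F i x) = der L i (f x).

(* Differential polynomials in s differential indeterminates y_0..y_{s-1}
   over coefficients in R, for n derivations: the variable (dpY i w) is
   the derivative theta_w y_i, where w is a word of derivations (they
   commute, so only the multiset of w matters). *)
Inductive dpoly (R : Type) (s n : nat) : Type :=
  | dpC of R
  | dpY of 'I_s & seq 'I_n
  | dpAdd of dpoly R s n & dpoly R s n
  | dpMul of dpoly R s n & dpoly R s n
  | dpOpp of dpoly R s n.

Fixpoint deval (R : Type) (s n : nat) (L : nzRingType) (f : R -> L)
    (D : 'I_n -> L -> L) (y : 'I_s -> L) (p : dpoly R s n) : L :=
  match p with
  | dpC c => f c
  | dpY i w => foldr (fun j x => D j x) (y i) w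
  | dpAdd p q => deval f D y p + deval f D y q
  | dpMul p q => deval f D y p * deval f D y q
  | dpOpp p => - deval f D y p
  end.

Definition dsystem_sol (R : Type) (s n : nat) (L : nzRingType) (f : R -> L)
    (D : 'I_n -> L -> L) (Ps : seq (dpoly R s n)) (Q : dpoly R s n)
    (y : 'I_s -> L) : Prop :=
  (forall P, P \in map (deval f D y) Ps -> P = 0) /\ deval f D y Q != 0.

Definition diff_closed (n : nat) (k0 : DField n) : Prop :=
  forall (s : nat) (Ps : seq (dpoly k0 s n)) (Q : dpoly k0 s n),
    (exists (L : DField n) (iota : {rmorphism k0 -> L}),
        dmorph iota /\ exists y : 'I_s -> L, dsystem_sol iota (der L) Ps Q y) ->
    exists z : 'I_s -> k0, dsystem_sol id (der k0) Ps Q z.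

(* For a Delta = {d_0, d_1, ..., d_m}-field k: the field C_k^0 of
   d_0-constants, with the Pi = {d_1,...,d_m}-structure induced by k, is a
   differentially closed Pi-field.  Stated as: some differentially closed
   Pi-field C0 is isomorphic (as a Pi-field) to C_k^0 via j. *)
Definition constants_diff_closed (m : nat) (k : DField m.+1) : Prop :=
  exists (C0 : DField m) (j : {rmorphism C0 -> k}),
    [/\ (forall x, der k ord0 (j x) = 0),
        (forall c, der k ord0 c = 0 -> exists x, j x = c),
        (forall i x, j (der C0 i x) = der k (lift ord0 i) (j x))
      & diff_closed C0].

Definition dsubfield (n : nat) (L : DField n) (P : L -> Prop) : Prop :=
  [/\ P 0 /\ P 1, (forall x y, P x -> P y -> P (x - y)),
      (forall x y, P x -> P y -> P (x * y)),
      (forall x, P x -> x != 0 -> P x^-1)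
    & forall i x, P x -> P (der L i x)].

Definition dgen (n : nat) (k L : DField n) (phi : k -> L) (S : L -> Prop)
    (x : L) : Prop :=
  forall P : L -> Prop, dsubfield P -> (forall a, P (phi a)) ->
    (forall y, S y -> P y) -> P x.

Definition no_new_constants (m : nat) (k L : DField m.+1) (phi : k -> L) : Prop :=
  forall c : L, der L ord0 c = 0 -> exists a : k, phi a = c.

Definition PPV_ext (m n : nat) (k K : DField m.+1) (A : 'M[k]_n)
    (phi : {rmorphism k -> K}) : Prop :=
  dmorph phi /\
  exists Z : 'M[K]_n,
    [/\ Z \in unitmx,
        map_mx (der K ord0) Z = map_mx phi A *m Z,
        (forall x : K, dgen phi (fun y => exists i j, y = Z i j) x)
      & no_new_constants phi].

Definition PPV_group (m : nat) (k K : DField m.+1) (phi : k -> K)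
    (sigma : K -> K) : Prop :=
  [/\ (forall x y, sigma (x + y) = sigma x + sigma y),
      (forall x y, sigma (x * y) = sigma x * sigma y),
      bijective sigma,
      (forall a, sigma (phi a) = phi a)
    & forall i x, sigma (der K i x) = der K i (sigma x)].

Definition subgroup_of (T : Type) (G H : (T -> T) -> Prop) : Prop :=
  [/\ (forall s, H s -> G s),
      H id,
      (forall s t, H s -> H t -> H (s \o t))
    & forall s, H s -> exists2 t, H t & s \o t = id /\ t \o s = id].

Definition solvable_grp (T : Type) (H : (T -> T) -> Prop) : Prop :=
  exists (r : nat) (Hs : nat -> (T -> T) -> Prop),
    [/\ (forall s, Hs 0%N s <-> H s),
        (forall s, Hs r s <-> s = id)
      & forall i, (i < r)%N ->
          [/\ subgroup_of (Hs i) (Hs i.+1),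
              (forall s t, Hs i s -> Hs i.+1 t ->
                 exists2 t', Hs i.+1 t' & s \o t = t' \o s)
            &
              forall s t, Hs i s -> Hs i t ->
                 exists2 u, Hs i.+1 u & s \o t = t \o s \o u]].

Definition finite_index (T : Type) (G H : (T -> T) -> Prop) : Prop :=
  exists (r : nat) (c : nat -> T -> T),
    forall g, G g -> exists i h, [/\ (i < r)%N, H h & g = c i \o h].

(* Parameterized liouvillian extension psi : k -> L: C_L^0 = C_k^0 and a
   tower k = L_0 < L_1 < ... < L_r = L, L_i = L_{i-1}<t_i>_Delta. *)
Definition param_liouvillian (m : nat) (k L : DField m.+1)
    (psi : {rmorphism k -> L}) : Prop :=
  [/\ dmorph psi,
      no_new_constants psi
    & exists ts : seq L,
        (forall x, dgen psi (fun y => y \in ts) x) /\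
        forall i, (i < size ts)%N ->
          let t := nth 0 ts i in
          let Li := dgen psi (fun y => y \in take i ts) in
          [\/ Li (der L ord0 t),
              (t != 0 /\ Li (der L ord0 t / t))
            | exists p : {poly L}, [/\ p != 0, (forall j, Li p`_j) & root p t]]].

(* Main.v *)
Require Import Defs.
From HB Require Import structures.
From mathcomp Require Import all_boot all_order all_algebra all_field.
From mathcomp Require Import boolp classical_sets zify ring.
Set Implicit Arguments. Unset Strict Implicit. Unset Printing Implicit Defensive.
Import GRing.Theory.
Local Open Scope ring_scope.

(* For (3) => (1), first forget the derivations other than d_0: the union of all towers
   of plain field extensions by primitives, exponentials and algebraic elements is stable
   under every derivation, so a parameterized liouvillian extension L of k is such a
   union.  For an intermediate field E let G_E be the group of those sigma in G that are
   realized by an automorphism of E(Z) over E.  Passing from E to E(t) replaces G_E by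
   itself if t is transcendental over E(Z), by a subgroup of finite index if t is
   algebraic over E, and by a subgroup containing all commutators if t is a primitive or
   an exponential algebraic over E(Z); each of these steps reflects virtual solvability.

   For (1) => (2), Lie-Kolchin gives a semi-invariant f in the span over the constants of
   the entries of Z; then d_0 f / f is fixed by a subgroup of finite index, and dividing by
   f and differentiating lowers the dimension of the span.  What makes this work is
   normality: an element x outside k is moved by some sigma in G.  A differential field
   quotient of K (x)_k K in which x (x) 1 <> 1 (x) x gives two embeddings f_1, f_2 of K that
   differ at x; the matrix f_1(Z)^-1 f_2(Z) has constant entries and solves a system of
   differential equations over the constants of k, and since these are differentially
   closed, it specializes to a matrix over k that defines an automorphism moving x. *)

(** * Virtually solvable groups *)

(** Connected components are replaced by subgroups of finite index, so everything rests on facts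
    about abstract groups: virtual solvability passes up an abelian quotient because the centralizer
    of a finite quotient has finite index, and a solvable matrix group that is irreducible on all
    subgroups of finite index consists of scalars. Elements of the group need not extend to the
    liouvillian field, which is why only realizations on E(Z) are followed along the tower.
    Differential closedness enters twice. It makes the constants algebraically closed, which
    supplies eigenvalues. It also provides the constant matrix; but the relations on its entries
    form an infinite system, whereas closedness speaks of finite ones. A ranking of derivatives and
    Dickson's lemma bridge this gap: finitely many minimal relations imply all others by
    pseudo-division, as long as initials and separants stay nonzero. Characteristic zero gives
    nonzero separants, and keeps x (x) 1 - 1 (x) x from being nilpotent when x is algebraic over
    k. *)

Lemma least_nat (P : nat -> Prop) :
  (exists n, P n) -> exists2 n, P n & forall m, P m -> (n <= m)%N.
Proof.
move=> [n0 Pn0]; have ex : exists n, `[< P n >] by exists n0; apply/asboolP.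
case: (ex_minnP ex) => n /asboolP Pn min; exists n => // m Pm.
by apply: min; apply/asboolP.
Qed.

Section VirtuallySolvable.
Local Open Scope group_scope.

Lemma gconjE (gT : groupType) (x y : gT) : x ^ y = y^-1 * (x * y).
Proof. by []. Qed.

Lemma gcommE (gT : groupType) (x y : gT) : [~ x, y] = x^-1 * (y^-1 * (x * y)).
Proof. by []. Qed.

Lemma ginvM (gT : groupType) (x y : gT) : (x * y)^-1 = y^-1 * x^-1.
Proof. exact: invgM. Qed.

Lemma ginvK (gT : groupType) (x : gT) : x^-1^-1 = x.
Proof. exact: invgK. Qed.

Variable gT : groupType.
Implicit Types (G H N A B J : gT -> Prop).

Definition sgrp G := [/\ G 1, (forall x y, G x -> G y -> G (x * y))
  & forall x, G x -> G x^-1].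

(** Cosets are encoded by a colouring: equal colours force equal left cosets, but there may be more
    colours than cosets. *)
Definition findex G H := exists (T : finType) (t : gT -> T),
  forall x y, G x -> G y -> t x = t y -> H (x^-1 * y).

(** Each term of the chain has to contain the commutators of the previous one, not to be generated
    by them; [r] bounds the derived length. *)
Fixpoint solv r H : Prop :=
  if r is r'.+1 then exists H1, [/\ sgrp H1, (forall x, H1 x -> H x),
      (forall x y, H x -> H y -> H1 [~ x, y]) & solv r' H1]
  else forall x, H x -> x = 1.

Definition vsolv G := exists H, [/\ sgrp H, (forall x, H x -> G x), findex G H
  & exists r, solv r H].

Lemma sgrpI A B : sgrp A -> sgrp B -> sgrp (fun x => A x /\ B x).
Proof.
move=> [a1 aM aV] [b1 bM bV]; split=> // [x y [? ?] [? ?]|x [? ?]].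
  by split; [exact: aM|exact: bM].
by split; [exact: aV|exact: bV].
Qed.

Lemma sgrpJ A x y : sgrp A -> A x -> A y -> A (x ^ y).
Proof. by move=> [_ aM aV] ax ay; apply: (aM) => //; [exact: aV|exact: aM]. Qed.

Lemma sgrpR A x y : sgrp A -> A x -> A y -> A [~ x, y].
Proof. by move=> sA ax ay; case: (sA) => _ aM aV; apply: aM (aV _ ax) (sgrpJ sA ax ay). Qed.

Lemma solv_sub r H J : sgrp J -> (forall x, J x -> H x) -> solv r H -> solv r J.
Proof.
elim: r H J => [|r IH] H J sJ JH /=; first by move=> tH x /JH; apply: tH.
move=> [H1 [s1 H1H cH solvH1]]; exists (fun x => H1 x /\ J x); split.
- exact: sgrpI.
- by move=> x [].
- by move=> x y Jx Jy; split; [apply: cH; exact: JH|exact: sgrpR].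
- by apply: IH solvH1 => [|x []//]; exact: sgrpI.
Qed.

Definition setmul A B (x : gT) := exists u v, [/\ A u, B v & x = u * v].

Lemma setmul_mul A B x y : sgrp A -> sgrp B ->
    (forall b a, B b -> A a -> B (b ^ a)) ->
  forall u v u' v', A u -> B v -> A u' -> B v' -> x = u * v -> y = u' * v' ->
  exists2 b, B b & x * y = u * u' * b.
Proof.
move=> sA [_ bM _] nB u v u' v' Au Bv Au' Bv' -> ->.
exists (v ^ u' * v'); first by apply: bM => //; exact: nB.
by rewrite gconjE !mulgA mulgK.
Qed.

Lemma sgrp_setmul A B : sgrp A -> sgrp B ->
  (forall b a, B b -> A a -> B (b ^ a)) -> sgrp (setmul A B).
Proof.
move=> sA sB nB; case: (sA) (sB) => a1 aM aV [b1 bM bV]; split.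
- by exists 1, 1; rewrite mulg1.
- move=> x y [u [v [Au Bv ex]]] [u' [v' [Au' Bv' ey]]].
  have [b Bb ->] := setmul_mul sA sB nB Au Bv Au' Bv' ex ey.
  by exists (u * u'), b; split=> //; exact: aM.
- move=> x [u [v [Au Bv ->]]]; exists u^-1, (v^-1 ^ u^-1); split.
  + exact: aV.
  + by apply: nB; [exact: bV|exact: aV].
  + by rewrite ginvM gconjE !mulgA ginvK mulVg mul1g.
Qed.

(** The series of [A] is used up first, then that of [B]. Modulo [B], the products [x * y] and
    [y * x] are [u * u'] and [u' * u], so a commutator of the product set is a commutator of [A]
    times an element of [B]. *)
Lemma solv_setmul a b A B : sgrp A -> sgrp B ->
  (forall b a, B b -> A a -> B (b ^ a)) -> solv a A -> solv b B ->
  solv (a + b)%N (setmul A B).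
Proof.
elim: a A => [|a IH] A sA sB nB /=.
  move=> tA; apply: solv_sub; first exact: sgrp_setmul.
  by move=> x [u [v [/tA -> Bv ->]]]; rewrite mul1g.
move=> [A1 [s1 A1A cA sol1]] solB.
have nB1 b' a' : B b' -> A1 a' -> B (b' ^ a') by move=> ? /A1A; apply: nB.
exists (setmul A1 B); split; first exact: sgrp_setmul.
- by move=> x [u [v [/A1A Au Bv ->]]]; exists u, v.
- move=> x y [u [v [Au Bv ex]]] [u' [v' [Au' Bv' ey]]].
  have [b1 Bb1 e1] := setmul_mul sA sB nB Au Bv Au' Bv' ex ey.
  have [b2 Bb2 e2] := setmul_mul sA sB nB Au' Bv' Au Bv ey ex.
  have -> : [~ x, y] = (y * x)^-1 * (x * y) by rewrite gcommE ginvM !mulgA.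
  exists [~ u, u'], ((b2^-1) ^ [~ u, u'] * b1).
  case: (sB) => _ bM bV; split; first exact: cA.
    by apply: bM => //; apply: nB1; [exact: bV|exact: cA].
  rewrite e1 e2 [u * u']commgC [_ ^ _]gconjE; move: [~ u, u'] => c.
  by rewrite !ginvM -!mulgA !mulKg mulVKg.
- exact: IH.
Qed.

Lemma reps (T : finType) (t : gT -> T) G H : sgrp G ->
    (forall x y, G x -> G y -> t x = t y -> H (x^-1 * y)) ->
  exists r : T -> gT, (forall c, G (r c)) /\ forall x, G x -> H ((r (t x))^-1 * x).
Proof.
move=> [G1 _ _] tH.
have /choice[r rP] : forall c : T, exists g, G g /\ forall x, G x -> t x = c -> t g = c.
  move=> c; have [[g [Gg tg]]|n] := pselect (exists g, G g /\ t g = c).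
    by exists g; split.
  (* A colour that does not occur in [G] gets the default representative 1, so that all
     representatives lie in [G]. *)
  by exists 1; split=> // x Gx tx; case: n; exists x.
exists r; split=> [c|x Gx]; first by case: (rP c).
by have [Gr tr] := rP (t x); apply: tH => //; exact: (tr x).
Qed.

Lemma findex_trans G H J : sgrp G -> findex G H -> findex H J -> findex G J.
Proof.
move=> sG [T1 [t1 t1P]] [T2 [t2 t2P]].
have [r [Gr rP]] := reps sG t1P.
exists (T1 * T2)%type, (fun x => (t1 x, t2 ((r (t1 x))^-1 * x))) => x y Gx Gy [e1 e2].
have := t2P _ _ (rP x Gx) (rP y Gy) e2.
by rewrite e1 ginvM ginvK !mulgA mulgK.
Qed.

Lemma vsolv_findex G G' : sgrp G -> (forall x, G' x -> G x) -> findex G G' ->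
  vsolv G' -> vsolv G.
Proof.
move=> sG GG' fi [H [sH HG' fH solvH]]; exists H; split=> //.
  by move=> x /HG'/GG'.
exact: findex_trans fi fH.
Qed.

Lemma vsolvS G G' : (forall x, G x <-> G' x) -> vsolv G -> vsolv G'.
Proof.
move=> e [H [sH HG' [T [t tP]] solvH]]; exists H; split=> //.
  by move=> x /HG'/e.
by exists T, t => x y /e Gx /e Gy; apply: tP.
Qed.

(** The number [d] counts colours instead of cosets; its least value plays the part of the index. *)
Let goodindex G' (d : nat) := exists N, [/\ sgrp N, (forall x, N x -> G' x),
  (forall x g, N x -> G' g -> N (x ^ g)), (exists r, solv r N)
  & exists (T : finType) (t : gT -> T), #|T| = d /\
    forall x y, G' x -> G' y -> t x = t y -> N (x^-1 * y)].

(** Colour [x] by the permutation-like function it induces on cosets. If [x] and [y] agree there,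
    all conjugates of [x^-1 * y] by representatives lie in [H], and every [g] is a representative
    times an element of [H]. *)
Lemma findex_core G H : sgrp G -> sgrp H -> findex G H ->
  findex G (fun x => G x /\ forall g, G g -> H (x ^ g)).
Proof.
move=> sG sH [T [t tP]]; have [G1 GM GV] := sG; have [H1 HM HV] := sH.
have [r [Gr rP]] := reps sG tP.
exists {ffun T -> T}, (fun x => [ffun c => t (x * r c)]) => x y Gx Gy e.
split=> [|g Gg]; first by apply: GM => //; apply: GV.
have := tP (x * r (t g)) (y * r (t g)) (GM _ _ Gx (Gr _)) (GM _ _ Gy (Gr _)).
move/ffunP/(_ (t g)): e; rewrite !ffunE => -> /(_ erefl) h.
have -> : (x^-1 * y) ^ g = ((x^-1 * y) ^ r (t g)) ^ ((r (t g))^-1 * g).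
  by rewrite -conjgM mulVKg.
by apply: sgrpJ => //; [move: h; rewrite /conjg ginvM !mulgA|exact: rP].
Qed.

Lemma sgrp_core G H : sgrp G -> sgrp H ->
  sgrp (fun x => G x /\ forall g, G g -> H (x ^ g)).
Proof.
move=> sG sH; have [G1 GM GV] := sG; have [H1 HM HV] := sH.
split=> [|x y [Gx Nx] [Gy Ny]|x [Gx Nx]]; split=> //.
- by move=> g Gg; rewrite conj1g.
- exact: GM.
- by move=> g Gg; rewrite conjMg; apply: HM; [exact: Nx|exact: Ny].
- exact: GV.
- by move=> g Gg; rewrite conjVg; apply: HV; exact: Nx.
Qed.

Lemma goodindex_ex G' : sgrp G' -> vsolv G' -> exists d, goodindex G' d.
Proof.
move=> sG [H [sH HG' fi [r solvH]]].
have [T [t tP]] := findex_core sG sH fi.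
exists #|T|, (fun x => G' x /\ forall g, G' g -> H (x ^ g)); split.
- exact: sgrp_core.
- by move=> x [].
- move=> x g [Gx Nx] Gg; split=> [|h Gh]; first exact: sgrpJ.
  by rewrite -conjgM; apply: Nx; case: sG => _ GM _; apply: GM.
- exists r; apply: solv_sub solvH; first exact: sgrp_core.
  by move=> x [Gx Nx]; rewrite -[x]conjg1; apply: Nx; case: sG.
- by exists T, t.
Qed.

(* A normal solvable subgroup of minimal index is invariant under conjugation:
   otherwise its product with a conjugate would have smaller index. *)
Lemma vsolv_invariant G G' : sgrp G -> sgrp G' -> (forall x, G' x -> G x) ->
    (forall x g, G' x -> G g -> G' (x ^ g)) -> vsolv G' ->
  exists N, [/\ sgrp N, (forall x, N x -> G' x),
    (forall x g, N x -> G g -> N (x ^ g)), findex G' N & exists r, solv r N].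
Proof.
move=> sG sG' G'G nG' /(goodindex_ex sG')/least_nat[d gd min].
have [N [sN NG' nN [r solvN] [T [t [cT tP]]]]] := gd.
exists N; split=> //; [|by exists T, t|by exists r].
move=> x g Nx Gg; apply: contrapT => nNx.
have [N1 NM NV] := sN; have [_ GM GV] := sG; have [G'1 G'M G'V] := sG'.
pose Ng y := N (y ^ g^-1).
have sNg : sgrp Ng.
  split=> [|u v Nu Nv|u Nu]; rewrite /Ng ?conj1g ?conjMg ?conjVg //.
    exact: NM.
  exact: NV.
have nNg b a : Ng b -> G' a -> Ng (b ^ a).
  move=> Nb Ga; rewrite /Ng -conjgM.
  have -> : a * g^-1 = g^-1 * (a ^ g^-1) by rewrite -conjgC.
  by rewrite conjgM; apply: nN => //; apply: nG' => //; exact: GV.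
have NgG' b : Ng b -> G' b.
  by move=> /NG' h; rewrite -(conjgKV g b); apply: nG'.
have nNg' b a : Ng b -> N a -> Ng (b ^ a) by move=> ? /NG'; apply: nNg.
pose N' := setmul N Ng.
have sN' : sgrp N' by exact: sgrp_setmul.
have NN' y : N y -> N' y by move=> Ny; exists y, 1; rewrite mulg1; split=> //; case: sNg.
have xN' : N' (x ^ g) by exists 1, (x ^ g); rewrite mul1g; split=> //; rewrite /Ng conjgK.
have xG' : G' (x ^ g) by apply: nG' => //; exact: NG'.
have t1 : t 1 != t (x ^ g).
  by apply/eqP => /(tP _ _ G'1 xG'); rewrite invg1 mul1g.
pose T' := {c : T | c != t (x ^ g)}.
have : goodindex G' #|{: T'}|.
  exists N'; split=> //.
  - move=> y [u [v [Nu Nv ->]]]; apply: G'M; [exact: NG'|exact: NgG'].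
  - move=> y h [u [v [Nu Nv ->]]] Gh; rewrite conjMg.
    by exists (u ^ h), (v ^ h); split=> //; [exact: nN|exact: nNg].
  - exists (r + r)%N; apply: solv_setmul => //.
    pose f (A : gT -> Prop) y := A (y ^ g^-1).
    suff conj A k : solv k A -> solv k (f A) by exact: conj.
    elim: k A => [|k IH] A /=.
      by move=> tA y /tA e; rewrite -(conjgKV g y) e conj1g.
    move=> [A1 [s1 A1A cA solA]]; exists (f A1); split.
    + case: s1 => a1 aM aV; split=> [|u v ? ?|u ?]; rewrite /f.
      * by rewrite conj1g.
      * by rewrite conjMg; exact: aM.
      * by rewrite conjVg; exact: aV.
    + by move=> y /A1A.
    + by move=> u v Au Av; rewrite /f conjRg; exact: cA.
    + exact: IH.
  - exists T', (fun y => insubd (Sub (t 1) t1 : T') (t y)); split=> //.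
    have [_ N'M N'V] := sN'.
    move=> y z Gy Gz /(congr1 val); rewrite !val_insubd /=.
    case: (eqVneq (t y) (t (x ^ g))) => ey; case: (eqVneq (t z) (t (x ^ g))) => ez /= e.
    + by apply/NN'/tP => //; rewrite ey ez.
    + have a := tP _ _ Gy xG' ey; have b := tP _ _ G'1 Gz e.
      have -> : y^-1 * z = (y^-1 * x ^ g) * (x ^ g)^-1 * (1^-1 * z).
        by rewrite mulgK invg1 mul1g.
      by apply: (N'M); [apply: (N'M); [exact: (NN')|exact: N'V]|exact: NN'].
    + have a := tP _ _ Gz xG' ez; have b := tP _ _ Gy G'1 e.
      have -> : y^-1 * z = (y^-1 * 1) * (x ^ g * (z^-1 * x ^ g)^-1).
        by rewrite mulg1 ginvM ginvK mulVKg.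
      apply: (N'M); [exact: (NN')|apply: (N'M) => //; apply: (N'V); exact: NN'].
    + by apply/NN'/tP.
move/min; rewrite -cT leqNgt => /negP; apply.
by rewrite card_sig cardC1 ltn_predL; apply/card_gt0P; exists (t 1).
Qed.

(** Take [N] invariant under [G], solvable and of finite index in [G'], and let [C] be the
    centralizer of G'/N in [G]. It has finite index, because [G] acts on the finite set G'/N. It is
    solvable: its commutators lie in [C] and [G'], and the commutators of these lie in [C] and [N];
    hence the length [r.+2]. *)
Lemma vsolv_abelian G G' : sgrp G -> sgrp G' -> (forall x, G' x -> G x) ->
  (forall x y, G x -> G y -> G' [~ x, y]) -> vsolv G' -> vsolv G.
Proof.
move=> sG sG' G'G cG vG'; have [G1 GM GV] := sG; have [G'1 G'M G'V] := sG'.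
have nG' x g : G' x -> G g -> G' (x ^ g).
  by move=> Gx Gg; rewrite -[x ^ g](mulVKg x); apply: (G'M _ _ Gx); apply/cG/Gg/G'G.
have [N [sN NG' nN [T [t tP]] [r solvN]]] := vsolv_invariant sG sG' G'G nG' vG'.
have [N1 NM NV] := sN.
pose C g := G g /\ forall x, G' x -> N [~ x, g].
have sC : sgrp C.
  split=> [|g h [Gg Cg] [Gh Ch]|g [Gg Cg]].
  - by split=> // x Gx; rewrite commg1.
  - split=> [|x Gx]; first exact: GM.
    have -> : [~ x, g * h] = [~ x, h] * [~ x, g] ^ h.
      by rewrite !gcommE -!gconjE conjMg conjVg conjgM -mulgA mulVKg.
    by apply: (NM); [exact: Ch|apply: nN => //; exact: Cg].
  - split=> [|x Gx]; first exact: GV.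
    have -> : [~ x, g^-1] = ([~ x, g]^-1) ^ g^-1.
      by rewrite /commg ginvM ginvK conjMg conjVg conjgK.
    by apply: nN; [apply/NV/Cg|exact: GV].
exists C; split=> //; first by move=> x [].
  have [rr [Gr rP]] := reps sG' tP.
  exists {ffun T -> T}, (fun g => [ffun c => t (rr c ^ g^-1)]) => g h Gg Gh e.
  suff : C (h^-1 * g) by case: sC => _ _ CV /CV; rewrite ginvM ginvK.
  split=> [|x Gx]; first by apply: GM => //; exact: GV.
  move: (rP x Gx); set c := t x; set n := _ * x => Nn.
  have -> : x = rr c * n by rewrite mulVKg.
  clearbody n.
  have Nc : N [~ rr c, h^-1 * g].
    move/ffunP/(_ c): e; rewrite !ffunE => e.
    have {e} := tP _ _ (nG' _ _ (Gr c) (GV _ Gg)) (nG' _ _ (Gr c) (GV _ Gh)) e.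
    move=> /nN/(_ Gg); rewrite conjMg conjVg conjgKV -conjgM.
    by [].
  have Gk : G (h^-1 * g) by apply: GM => //; exact: GV.
  have -> : [~ rr c * n, h^-1 * g] = [~ rr c, h^-1 * g] ^ n * [~ n, h^-1 * g].
    rewrite !gcommE -!gconjE; move: (h^-1 * g) => k.
    by rewrite conjMg [_ ^ n]gconjE ginvM -!mulgA (mulgA n) mulgV mul1g.
  apply: (NM); first by apply: nN => //; exact/G'G/NG'.
  by apply: (NM); [exact: NV|exact: nN].
exists r.+2 => /=; exists (fun x => C x /\ G' x); split.
- exact: sgrpI.
- by move=> x [].
- by move=> x y Cx Cy; split; [exact: sgrpR|apply: cG; [case: Cx|case: Cy]].
- exists (fun x => C x /\ N x); split.
  + exact: sgrpI.
  + by move=> x [? /NG'].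
  + move=> x y [Cx Gx] [Cy Gy]; split; first exact: sgrpR.
    by case: Cy => _; exact.
  + by apply: solv_sub solvN => [|x []//]; exact: sgrpI.
Qed.

End VirtuallySolvable.

(** * Finite sets of values and finite index *)

Definition fin_set (T : eqType) (A : T -> Prop) :=
  exists s : seq T, forall x, A x -> x \in s.

Lemma fin_set_roots (F : fieldType) (p : {poly F}) :
  p != 0 -> fin_set (fun x => root p x).
Proof.
elim: {p}(size p) {-2}p (erefl (size p)) => [|n IH] p.
  by move/eqP; rewrite size_poly_eq0 => ->.
move=> sp p0; have [[x /factor_theorem[q pq]]|nr] := pselect (exists x, root p x); last first.
  by exists [::] => x rx; case: nr; exists x.
have q0 : q != 0 by apply: contraNneq p0 => q0; rewrite pq q0 mul0r.
have [|s sP] := IH q _ q0; last first.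
  by exists (x :: s) => y; rewrite pq rootM root_XsubC inE => /orP[/sP->|->]; rewrite ?orbT.
by move: sp; rewrite pq size_Mmonic ?monicXsubC // size_XsubC addn2 => -[].
Qed.

Lemma fin_set_fibre (T U : eqType) (A : T -> Prop) (g : T -> U) :
  fin_set (fun u => exists2 x, A x & g x = u) ->
  (forall x0, A x0 -> fin_set (fun x => A x /\ g x = g x0)) -> fin_set A.
Proof.
move=> [s sP] fib.
have /choice[l lP] : forall u, exists l : seq T, forall x, A x -> g x = u -> x \in l.
  move=> u; have [[x0 [Ax0 <-]]|n] := pselect (exists x0, A x0 /\ g x0 = u).
    by have [l lP] := fib _ Ax0; exists l => x Ax gx; apply: lP.
  by exists [::] => x Ax gx; case: n; exists x.
exists (flatten (map l s)) => x Ax; apply/flatten_mapP.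
by exists (g x); [apply: sP; exists x|exact: lP].
Qed.

Lemma fin_set_ffun (U : eqType) (u0 : U) d (A : 'I_d -> U -> Prop) :
  (forall j, fin_set (A j)) -> fin_set (fun f : {ffun 'I_d -> U} => forall j, A j (f j)).
Proof.
move=> /choice[s sP]; pose S := flatten [seq s j | j <- enum 'I_d].
pose E := {ffun 'I_d -> 'I_(size S).+1}.
exists [seq [ffun j => nth u0 S (e j)] | e : E <- enum E].
move=> f fA; have fS j : f j \in S.
  by apply/flatten_mapP; exists j; [rewrite mem_enum|exact: sP].
apply/mapP; exists [ffun j => inord (index (f j) S)]; first by rewrite mem_enum.
apply/ffunP => j; rewrite !ffunE inordK ?nth_index //.
by rewrite ltnS ltnW // index_mem.
Qed.

Lemma findex_fin_set (gT : groupType) (U : eqType) (f : gT -> U) (H J : gT -> Prop) :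
  fin_set (fun u => exists2 h, H h & f h = u) ->
  (forall x y, H x -> H y -> f x = f y -> J (x^-1 * y)%g) -> findex H J.
Proof.
move=> [s sP] fJ; exists 'I_(size s).+1, (fun x => inord (index (f x) s)) => x y Hx Hy.
have fx : f x \in s by apply: sP; exists x.
have fy : f y \in s by apply: sP; exists y.
move=> /(congr1 val); rewrite /= !inordK ?ltnS ?index_size // => e; apply: fJ => //.
by rewrite -(nth_index (f x) fx) e nth_index.
Qed.

(** Rows of maximal rank are picked inside [Y], because later the spanning vectors have to be images
    of group elements. *)
Lemma finite_spanning (F : fieldType) q (Y : 'rV[F]_q -> Prop) :
  exists d (A : 'M[F]_(d, q)), (forall i, Y (row i A)) /\ forall y, Y y -> (y <= A)%MS.
Proof.
pose P m := exists d (A : 'M[F]_(d, q)), (forall i, Y (row i A)) /\ (q - \rank A = m)%N.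
have [|m [d [A [AY rA]]] min] := @least_nat P.
  by exists q, 0, 0; split=> [[]//|]; rewrite mxrank0 subn0.
exists d, A; split=> // y Yy.
have : P (q - \rank (col_mx A y))%N.
  exists _, (col_mx A y); split=> // i; rewrite -(splitK i).
  by case: (split i) => j; rewrite /= ?rowKu ?rowKd ?row_id.
move=> /min; rewrite -rA => le.
have AS : (A <= col_mx A y)%MS by rewrite -addsmxE addsmxSl.
have [le1 /esym] := mxrank_leqif_sup AS.
have -> : \rank A == \rank (col_mx A y).
  rewrite eqn_leq le1 /=; have := rank_leq_col (col_mx A y); have := rank_leq_col A.
  by move: le le1; move: (\rank _) (\rank _) => a b; lia.
by move=> h; apply: submx_trans h; rewrite -addsmxE addsmxSr.
Qed.

(** * Lie-Kolchin up to finite index *)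

(** Multiplicativity is asked on [H] only, so [rho] may be filled in arbitrarily elsewhere. *)
Definition mxrep (gT : groupType) (C : fieldType) n (H : gT -> Prop) (rho : gT -> 'M[C]_n) :=
  rho 1%g = 1%:M /\ forall x y, H x -> H y -> rho (x * y)%g = rho x *m rho y.

Definition root_closed (C : fieldType) :=
  forall p : {poly C}, (1 < size p)%N -> exists x, root p x.

Section Representations.
Variables (gT : groupType) (C : fieldType).
Implicit Types (H J : gT -> Prop).

Section Rep.
Variables (n : nat) (H : gT -> Prop) (rho : gT -> 'M[C]_n).
Hypotheses (sH : sgrp H) (rH : mxrep H rho).

Lemma rep1 : rho 1%g = 1%:M. Proof. by case: rH. Qed.

Lemma repM x y : H x -> H y -> rho (x * y)%g = rho x *m rho y.
Proof. by case: rH => _; apply. Qed.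

Lemma repVm x : H x -> rho x^-1%g *m rho x = 1%:M.
Proof.
by move=> Hx; have [_ _ HV] := sH; rewrite -repM ?mulVg ?rep1 //; apply: HV.
Qed.

Lemma rep_unit x : H x -> rho x \in unitmx.
Proof. by move=> Hx; case: (mulmx1_unit (repVm Hx)). Qed.

Lemma repV x : H x -> rho x^-1%g = invmx (rho x).
Proof.
move=> Hx; rewrite -[LHS]mulmx1 -(mulmxV (rep_unit Hx)) mulmxA repVm //.
by rewrite mul1mx.
Qed.

Lemma repJ x y : H x -> H y -> rho (x ^ y)%g = invmx (rho y) *m rho x *m rho y.
Proof.
move=> Hx Hy; have [_ HM HV] := sH.
by rewrite gconjE repM ?repM ?repV ?mulmxA //; [exact: HV|exact: HM].
Qed.

Lemma repJC x y : H x -> H y -> rho y *m rho (x ^ y)%g = rho x *m rho y.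
Proof. by move=> Hx Hy; rewrite repJ // -mulmxA mulKVmx ?rep_unit. Qed.
End Rep.

Lemma commV n (A B : 'M[C]_n) : A \in unitmx -> A *m B = B *m A ->
  invmx A *m B = B *m invmx A.
Proof. by move=> uA e; rewrite -{1}(mulmxK uA B) -e !mulmxA mulVmx // mul1mx. Qed.

Variable acl : root_closed C.

Lemma eigenvalue_ex n (g : 'M[C]_n) : (0 < n)%N -> exists a, eigenvalue g a.
Proof.
move=> n0; have [|a ra] := acl (p := char_poly g); first by rewrite size_char_poly.
by exists a; rewrite eigenvalue_root_char.
Qed.

Lemma span_ind n d (A : 'M[C]_(d, n * n)) (P : 'M[C]_n -> Prop) :
  P 0 -> (forall a g h, P g -> P h -> P (a *: g + h)) ->
  (forall i, P (vec_mx (row i A))) -> forall g, (mxvec g <= A)%MS -> P g.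
Proof.
move=> P0 PD PA g /submxP[u eu]; rewrite -[g]mxvecK eu mulmx_sum_row linear_sum.
by elim/big_ind: _ => [//|x y Px Py|i _]; [rewrite -[x]scale1r; exact: PD|
  rewrite linearZ /= -[_ *: _]addr0; exact: PD].
Qed.

Section StronglyIrreducible.
Variables (n : nat) (H : gT -> Prop) (rho : gT -> 'M[C]_n).
Hypotheses (sH : sgrp H) (rH : mxrep H rho) (n0 : (0 < n)%N).
Hypothesis irr : forall J, sgrp J -> (forall x, J x -> H x) -> findex H J ->
  forall U : 'M[C]_n, U != 0 -> (forall h, J h -> (U *m rho h <= U)%MS) ->
  (1%:M <= U)%MS.

Lemma one_neq0 : (1%:M : 'M[C]_n) != 0.
Proof. by case: n n0 => // n' _; exact: oner_neq0. Qed.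

(** Schur's argument: an eigenspace of [g] is stable under [J], hence everything by [irr]. *)
Lemma scalar_of_commuting J g : sgrp J -> (forall x, J x -> H x) -> findex H J ->
  (forall h, J h -> rho h *m g = g *m rho h) -> exists a, g = a%:M.
Proof.
move=> sJ JH fJ cg; have [a ea] := eigenvalue_ex g n0; exists a.
have : (1%:M <= eigenspace g a)%MS.
  apply: irr fJ _ _ _ => // h Jh; apply/eigenspaceP.
  by rewrite -mulmxA cg // mulmxA (eigenspaceP (submx_refl _)) scalemxAl.
by move/eigenspaceP; rewrite mul1mx scalemx1.
Qed.

(** A Clifford-type argument. The commuting family has a common eigenvector, with character [chi].
    The conjugates of [chi] under [H] are finitely many, since they are determined by eigenvalues on
    a finite spanning family. The stabilizer [J] of [chi] therefore has finite index, and it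
    preserves the full eigenspace of [chi], which must be the whole space. *)
Lemma scalar_commuting (Y : gT -> Prop) : (forall y, Y y -> H y) ->
  (forall y h, Y y -> H h -> Y (y ^ h)%g) ->
  (forall y z, Y y -> Y z -> rho y *m rho z = rho z *m rho y) ->
  forall y, Y y -> exists a, rho y = a%:M.
Proof.
move=> YH nY cY; have [H1 HM HV] := sH.
have [W W0 chiP] : exists2 W : 'M[C]_n, W != 0 &
    forall y, exists a, Y y -> (W <= eigenspace (rho y) a)%MS.
  (* On a nonzero [Y]-stable subspace of least rank each [rho y] is scalar: its eigenspace inside
     [W] is again [Y]-stable, by commutativity. *)
  pose P r := exists W : 'M[C]_n, [/\ W != 0, \rank W = r &
    forall y, Y y -> (W *m rho y <= W)%MS].
  have [|r [W [W0 rW sW]] min] := @least_nat P.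
    by exists n, 1%:M; split=> [||y _]; rewrite ?one_neq0 ?mxrank1 ?submx1.
  exists W => // y; have [Yy|] := pselect (Y y); last by exists 0.
  have r0 : (0 < \rank W)%N by rewrite lt0n mxrank_eq0.
  have [a /eigenvalueP[v ev v0]] := eigenvalue_ex (row_base W *m rho y *m pinvmx (row_base W)) r0.
  exists a => _; pose W' := (W :&: eigenspace (rho y) a)%MS.
  have W'0 : W' != 0.
    have : v *m row_base W != 0.
      apply: contraNneq v0 => e; apply/eqP.
      by apply: (row_free_inj (row_base_free W)); rewrite e mul0mx.
    apply: contraNneq => e; rewrite -submx0 -e sub_capmx.
    rewrite (submx_trans (submxMl _ _)) ?eq_row_base //=; apply/eigenspaceP.
    have gB : row_base W *m rho y *m pinvmx (row_base W) *m row_base W = row_base W *m rho y.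
      by rewrite mulmxKpV // (eqmxMr _ (eq_row_base W)) (submx_trans (sW _ Yy)) // eq_row_base.
    by rewrite -[LHS]mulmxA -gB [LHS]mulmxA ev -scalemxAl.
  have W'W : (W' <= W)%MS by exact: capmxSl.
  suff : (W <= W')%MS by move/submx_trans; apply; exact: capmxSr.
  have [le] := mxrank_leqif_sup W'W; move=> <-; rewrite eqn_leq le /= rW.
  apply: min; exists W'; split=> // z Yz; rewrite sub_capmx.
  rewrite (submx_trans (submxMr _ (capmxSl _ _))) ?sW //=.
  apply/eigenspaceP; rewrite -mulmxA cY // mulmxA.
  by rewrite (eigenspaceP (capmxSr W (eigenspace (rho y) a))) scalemxAl.
have /choice[chi {}chiP] := chiP.
have Winj a b : a *: W = b *: W -> a = b.
  move/eqP; rewrite -subr_eq0 -scalerBl scaler_eq0 (negPf W0) orbF subr_eq0.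
  by move/eqP.
have WP y : Y y -> W *m rho y = chi y *: W by move=> Yy; exact/eigenspaceP/chiP.
have [d [A [AY sA]]] := finite_spanning (fun u => exists2 y, Y y & u = mxvec (rho y)).
have /choice[y_ yP] : forall i, exists y, Y y /\ row i A = mxvec (rho y).
  by move=> i; have [y Yy e] := AY i; exists y.
pose J h := H h /\ forall y, Y y -> chi (y ^ h)%g = chi y.
have sJ : sgrp J.
  split=> [|g h [Hg Jg] [Hh Jh]|g [Hg Jg]].
  - by split=> // y Yy; rewrite conjg1.
  - split=> [|y Yy]; first exact: HM.
    by rewrite conjgM Jh ?Jg //; exact: nY.
  - split=> [|y Yy]; first exact: HV.
    by rewrite -[LHS]Jg ?conjgKV //; apply: nY => //; exact: HV.
have fJ : findex H J.
  apply: (@findex_fin_set _ _ (fun h => [ffun i => chi (y_ i ^ h)%g])).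
    have [i|s sP] := @fin_set_ffun C 0 d (fun i a => root (char_poly (rho (y_ i))) a).
    - by apply: fin_set_roots; rewrite -size_poly_gt0 size_char_poly.
    exists s => _ [h Hh <-]; apply: sP => i; rewrite ffunE -eigenvalue_root_char.
    have [Yy _] := yP i.
    have : W *m rho h^-1%g != 0.
      apply: contraNneq W0 => e; rewrite -[W](mulmxK (rep_unit sH rH (HV _ Hh))) e.
      by rewrite mul0mx.
    apply: contraNneq => e; rewrite -submx0 -e; apply/eigenspaceP.
    have := repJC sH rH (x := (y_ i ^ h)%g) (y := h^-1%g).
    rewrite conjgK -mulmxA => -> //; [|exact/YH/nY|exact: HV].
    by rewrite mulmxA WP ?scalemxAl //; exact: nY.
  move=> g h Hg Hh /ffunP e; split=> [|y Yy]; first by apply: HM => //; exact: HV.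
  have {}e z : Y z -> chi (z ^ g)%g = chi (z ^ h)%g.
    move=> Yz; have /submxP[u] := sA _ (ex_intro2 _ _ _ Yz erefl).
    rewrite mulmx_sum_row => /(congr1 vec_mx); rewrite mxvecK linear_sum => eu.
    (* The coefficients [u] do not depend on [k], so the values at the [y_ i] determine the
       conjugated character. *)
    have key k : H k -> chi (z ^ k)%g = \sum_i u 0 i * chi (y_ i ^ k)%g.
      move=> Hk; apply: Winj; rewrite -WP ?(repJ sH rH) //; [|exact: YH|exact: nY].
      rewrite eu mulmx_sumr mulmx_suml mulmx_sumr scaler_suml.
      apply: eq_bigr => i _; have [Yy_ ->] := yP i.
      rewrite /= [vec_mx _]linearZ /= mxvecK -!scalemxAr -!scalemxAl -!scalemxAr -(repJ sH rH) ?WP ?scalerA //.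
        exact: nY.
      exact: YH.
    by rewrite !key //; apply: eq_bigr => i _; have := e i; rewrite !ffunE => ->.
  by rewrite conjgM -e ?conjgKV //; apply: nY => //; exact: HV.
(* The largest subspace on which [Y] acts through [chi], found by least corank since such subspaces
   are closed under sums. *)
pose P r := exists V : 'M[C]_n, (forall y, Y y -> (V <= eigenspace (rho y) (chi y))%MS) /\
  (n - \rank V = r)%N.
have [|r [V [VP rV]] min] := @least_nat P.
  by exists (n - \rank W)%N, W; split.
have Vmax (V' : 'M[C]_n) : (forall y, Y y -> (V' <= eigenspace (rho y) (chi y))%MS) -> (V' <= V)%MS.
  move=> V'P; have : P (n - \rank (V + V')%MS)%N.
    by exists (V + V')%MS; split=> // y Yy; rewrite addsmx_sub VP ?V'P.
  move=> /min; rewrite -rV => le.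
  have [le1 /esym] := mxrank_leqif_sup (addsmxSl V V').
  have -> : \rank V == \rank (V + V')%MS.
    rewrite eqn_leq le1 /=; have := rank_leq_col (V + V')%MS; have := rank_leq_col V.
    by move: le le1; move: (\rank _) (\rank _) => a b; lia.
  by move=> h; apply: submx_trans h; exact: addsmxSr.
have V0 : V != 0.
  by apply: contraNneq W0 => e; rewrite -submx0 -e; exact: Vmax.
have : (1%:M <= V)%MS.
  apply: irr fJ _ V0 _ => // [h []//|h [Hh Jh]]; apply: Vmax => y Yy.
  have Yh : Y (y ^ h^-1)%g by apply: nY => //; exact: HV.
  have := repJC sH rH (YH _ Yh) Hh; rewrite conjgKV => e.
  apply/eigenspaceP; rewrite -mulmxA e mulmxA (eigenspaceP (VP _ Yh)).
  by rewrite -(Jh _ Yh) conjgKV scalemxAl.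
move=> V1 y Yy; exists (chi y).
by have /eigenspaceP := submx_trans V1 (VP _ Yy); rewrite mul1mx scalemx1.
Qed.

(* Conjugation multiplies [rho x] by scalars that are roots of unity, because
   commutators have determinant 1; hence each [rho x] has finitely many
   conjugates and commutes with a subgroup of finite index. *)
Lemma scalar_of_commutators (X : gT -> Prop) : (forall x, X x -> H x) ->
  (forall x h, X x -> H h -> X (x ^ h)%g) ->
  (forall x y, X x -> X y -> exists a, rho [~ x, y]%g = a%:M) ->
  forall x, X x -> exists a, rho x = a%:M.
Proof.
move=> XH nX cX; have [H1 HM HV] := sH.
have [mu muP] : fin_set (fun c : C => c ^+ n = 1).
  have [|s sP] := @fin_set_roots C ('X^n - 1); first by rewrite monic_neq0 ?monicXnsubC.
  by exists s => c c1; apply: sP; rewrite rootE !hornerE c1 subrr.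
have [d [A [AX sA]]] := finite_spanning (fun u => exists2 x, X x & u = mxvec (rho x)).
have /choice[x_ xP] : forall i, exists x, X x /\ row i A = mxvec (rho x).
  by move=> i; have [x Xx e] := AX i; exists x.
have Xx_ i : X (x_ i) by case: (xP i).
have cspan (M : 'M[C]_n) : (forall i, M *m rho (x_ i) = rho (x_ i) *m M) ->
    forall x, X x -> M *m rho x = rho x *m M.
  move=> cM x Xx.
  apply: (span_ind (P := fun g => M *m g = g *m M)) (sA _ (ex_intro2 _ _ _ Xx erefl)).
  - by rewrite mulmx0 mul0mx.
  - by move=> a g h eg eh; rewrite mulmxDr mulmxDl -scalemxAr -scalemxAl eg eh.
  - by move=> i; have [_ ->] := xP i; rewrite mxvecK.
(* These quotients commute with all of [X], hence with each other, so [scalar_commuting] makes them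
   scalar. *)
pose Y y := exists x x', [/\ X x, X x', y = (x' * x^-1)%g &
  forall z, X z -> rho y *m rho z = rho z *m rho y].
have YH y : Y y -> H y.
  by move=> [x [x' [/XH Hx /XH Hx' -> _]]]; apply: HM => //; exact: HV.
have Yscal : forall y, Y y -> exists a, rho y = a%:M.
  apply: scalar_commuting => // [y h Yy Hh|y z Yy [x [x' [Xx Xx' -> _]]]].
    have Hy := YH _ Yy; case: Yy => x [x' [Xx Xx' ey cy]].
    exists (x ^ h)%g, (x' ^ h)%g; split; [exact: nX|exact: nX| |].
      by rewrite ey conjMg conjVg.
    move=> z Xz; have Xz' : X (z ^ h^-1)%g by apply: nX => //; exact: HV.
    have Hz := XH _ Xz; have Hz' := XH _ Xz'; have Hyh := sgrpJ sH Hy Hh.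
    have e : rho ((y * z ^ h^-1) ^ h)%g = rho ((z ^ h^-1 * y) ^ h)%g.
      by rewrite !(repJ sH rH) ?(repM rH Hy) ?(repM rH Hz') ?cy //; exact: HM.
    by move: e; rewrite (conjMg y) (conjMg (z ^ h^-1)) conjgKV (repM rH Hyh Hz) (repM rH Hz Hyh).
  have Hy := YH _ Yy; case: Yy => _ [_ [_ _ _ cy]].
  have Hx := XH _ Xx; have Hx' := XH _ Xx'.
  rewrite (repM rH) ?(repV sH rH) //; last exact: HV.
  by rewrite mulmxA cy // -!mulmxA; congr (_ *m _); rewrite -commV ?rep_unit ?cy //; exact: rep_unit Hx.
have detJ x h : H x -> H h -> \det (rho (x ^ h)%g) = \det (rho x).
  move=> Hx Hh; have := congr1 determinant (repJC sH rH Hx Hh).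
  rewrite !det_mulmx [RHS]mulrC; apply: mulfI.
  by have := rep_unit sH rH Hh; rewrite unitmxE unitfE.
have scal_mu (g : 'M[C]_n) c : \det (c *: g) = \det g -> g \in unitmx -> c \in mu.
  rewrite unitmxE unitfE detZ => e g0; apply: muP; apply: (mulIf g0).
  by rewrite e mul1r.
(* The map [g] records how a conjugate of [x_ j] acts on the spanning family. Its values are
   finitely many, because each [rho (x_ i)] is only multiplied by an element of [mu]. Two conjugates
   with the same action have a quotient in [Y], so they too differ by an element of [mu]. *)
have fin j : fin_set (fun M => exists2 h, H h & rho (x_ j ^ h)%g = M).
  pose g (M : 'M[C]_n) := [ffun i => invmx M *m rho (x_ i) *m M].
  apply: (fin_set_fibre (g := g)).
    have [i|s sP] := @fin_set_ffun 'M[C]_n 0 d (fun i M => exists2 c, c \in mu & M = c *: rho (x_ i)).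
      by exists [seq c *: rho (x_ i) | c <- mu] => _ [c cmu ->]; apply/map_f.
    exists s => _ [_ [h Hh <-] <-]; apply: sP => i; rewrite ffunE.
    have Xh := nX _ _ (Xx_ j) Hh; rewrite -(repJ sH rH); [|exact: XH|exact: XH].
    have [a ea] := cX _ _ (Xx_ i) Xh.
    have e : rho (x_ i ^ (x_ j ^ h))%g = a *: rho (x_ i).
      rewrite -[(x_ i ^ _)%g](mulVKg (x_ i)) -[(_^-1 * _)%g]/([~ x_ i, x_ j ^ h]%g).
      rewrite (repM rH) ?ea ?mul_mx_scalar //; first exact: XH.
      by apply: sgrpR => //; exact: XH.
    exists a => //; apply: (scal_mu (rho (x_ i))); last exact/(rep_unit sH rH)/XH.
    by rewrite -e detJ //; exact: XH.
  move=> M0 [h0 Hh0 <-]; exists [seq c *: rho (x_ j ^ h0)%g | c <- mu].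
  move=> M [[h Hh <-]] /ffunP e.
  have X0 := nX _ _ (Xx_ j) Hh0; have X1 := nX _ _ (Xx_ j) Hh.
  set y0 := (x_ j ^ h0)%g in e X0 *; set y1 := (x_ j ^ h)%g in e X1 *.
  have u0 : rho y0 \in unitmx by apply: rep_unit (XH _ X0).
  have u1 : rho y1 \in unitmx by apply: rep_unit (XH _ X1).
  have Yy : Y (y1 * y0^-1)%g.
    exists y0, y1; split=> //; apply: cspan => i; have := e i; rewrite !ffunE => ei.
    rewrite (repM rH) ?(repV sH rH); [|exact: XH|exact: XH|by apply: HV; exact: XH].
    have {}ei : rho (x_ i) *m rho y1 *m invmx (rho y0) = rho y1 *m (invmx (rho y0) *m rho (x_ i)).
      move/(congr1 (fun g => rho y1 *m g *m invmx (rho y0))): ei.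
      by rewrite -!mulmxA !mulKVmx // mulmxV // mulmx1 !mulmxA.
    by rewrite -[LHS]mulmxA -ei [RHS]mulmxA.
  have [c ec] := Yscal _ Yy.
  have e1 : rho y1 = c *: rho y0.
    have := congr1 (fun g => g *m rho y0) ec; rewrite /= -(repM rH) ?mulgVK ?mul_scalar_mx //.
      exact: YH.
    exact: XH.
  apply/mapP; exists c => //; apply: (scal_mu (rho y0)) => //.
  by rewrite -e1 !detJ //; exact: XH.
pose J h := H h /\ forall i, rho (x_ i) *m rho h = rho h *m rho (x_ i).
have sJ : sgrp J.
  split=> [|g h [Hg cg] [Hh ch]|g [Hg cg]].
  - by split=> // i; rewrite (rep1 rH) mulmx1 mul1mx.
  - split=> [|i]; first exact: HM.
    by rewrite (repM rH) // mulmxA cg -mulmxA ch mulmxA.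
  - split=> [|i]; first exact: HV.
    by rewrite (repV sH rH) // commV // (rep_unit sH rH).
have fJ : findex H J.
  apply: (@findex_fin_set _ _ (fun h => [ffun i => rho (x_ i ^ h^-1)%g])).
    have [s sP] := fin_set_ffun 0 fin; exists s => _ [h Hh <-]; apply: sP => i.
    by rewrite ffunE; exists h^-1%g => //; exact: HV.
  move=> g h Hg Hh /ffunP e; split=> [|i]; first by apply: HM => //; exact: HV.
  have Hx := XH _ (Xx_ i); have := e i; rewrite !ffunE => {}e.
  have Hxg : H (x_ i ^ g^-1)%g by apply: sgrpJ => //; exact: HV.
  have Hxh : H (x_ i ^ h^-1)%g by apply: sgrpJ => //; exact: HV.
  have : rho ((x_ i ^ g^-1) ^ h)%g = rho ((x_ i ^ h^-1) ^ h)%g.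
    by rewrite (repJ sH rH Hxg Hh) (repJ sH rH Hxh Hh) e.
  rewrite conjgKV -conjgM => {}e.
  by rewrite -(repJC sH rH Hx) ?e //; apply: HM => //; exact: HV.
move=> x Xx; apply: (scalar_of_commuting (J := J)) => // [h []//|h [Hh ch]].
by apply: cspan.
Qed.

(** The induction runs over sets [X] stable under conjugation by [H], since the terms of the series
    of [K] are not known to be normalized by [H]. The commutators of [X] form such a set inside the
    next term. *)
Lemma scalar_solvable s (K X : gT -> Prop) : sgrp K -> solv s K ->
  (forall x, X x -> H x) -> (forall x, X x -> K x) ->
  (forall x h, X x -> H h -> X (x ^ h)%g) ->
  forall x, X x -> exists a, rho x = a%:M.
Proof.
elim: s K X => [|s IH] K X sK /=.
  by move=> tK XH XK _ x /XK/tK ->; exists 1; rewrite (rep1 rH).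
move=> [K1 [sK1 K1K cK solK]] XH XK nX; apply: scalar_of_commutators => //.
move=> x y Xx Xy.
apply: (IH K1 (fun z => exists x y, [/\ X x, X y & z = [~ x, y]%g])) => //.
- by move=> _ [u [v [Xu Xv ->]]]; apply: sgrpR => //; exact: XH.
- by move=> _ [u [v [Xu Xv ->]]]; apply: cK; exact: XK.
- move=> _ h [u [v [Xu Xv ->]]] Hh; exists (u ^ h)%g, (v ^ h)%g.
  by split; [exact: nX|exact: nX|rewrite conjRg].
- by exists x, y.
Qed.
End StronglyIrreducible.

Lemma lie_kolchin n s H (rho : gT -> 'M[C]_n) : sgrp H -> solv s H ->
  mxrep H rho -> (0 < n)%N ->
  exists J, [/\ sgrp J, (forall x, J x -> H x), findex H J &
    exists2 v : 'rV[C]_n, v != 0 & forall h, J h -> exists a, v *m rho h = a *: v].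
Proof.
elim/ltn_ind: n => n IH in H rho *; move=> sH solH rH n0.
have [irr|] := pselect (forall J, sgrp J -> (forall x, J x -> H x) -> findex H J ->
  forall U : 'M[C]_n, U != 0 -> (forall h, J h -> (U *m rho h <= U)%MS) -> (1%:M <= U)%MS).
  exists H; split=> //; first by exists unit, (fun _ => tt) => x y Hx Hy _; case: sH => _ HM HV; apply: HM => //; exact: HV.
  (* All of [rho H] is scalar in this case, so any nonzero vector will do. *)
  exists (const_mx 1); first by apply/eqP => /rowP/(_ (Ordinal n0)); rewrite !mxE; exact/eqP/oner_neq0.
  move=> h Hh; have [|||a ->] := scalar_solvable sH rH n0 irr (X := H) sH solH _ _ _ Hh => //.
    by move=> x g; exact: sgrpJ.
  by exists a; rewrite mul_mx_scalar.
move=> /existsNP[J /not_implyP[sJ /not_implyP[JH /not_implyP[fJ /existsNP[U]]]]].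
move=> /not_implyP[U0 /not_implyP[sU nU]].
(* The restriction to the proper subspace [U] in the basis [B]; the dimension has dropped, and an
   eigenvector [v] there gives [v *m B]. *)
pose B := row_base U; pose rho' h := B *m rho h *m pinvmx B.
have Bst h : J h -> rho' h *m B = B *m rho h.
  move=> Jh; rewrite /rho' mulmxKpV // (eqmxMr _ (eq_row_base U)) eq_row_base.
  exact: sU.
have rU : (\rank U < n)%N.
  by rewrite ltnNge; apply/negP => h; apply: nU; rewrite sub1mx /row_full eqn_leq rank_leq_col.
have [||J' [sJ' J'J fJ' [v v0 vP]]] := IH _ rU J rho' sJ (solv_sub sJ JH solH).
- split=> [|x y Jx Jy].
    apply: (row_free_inj (row_base_free U)); rewrite Bst; last by case: sJ.
    by rewrite (rep1 rH) mulmx1 mul1mx.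
  apply: (row_free_inj (row_base_free U)); rewrite Bst; last by case: sJ => _ + _; apply.
  by rewrite (repM rH (JH _ Jx) (JH _ Jy)) -[RHS]mulmxA (Bst _ Jy) [RHS]mulmxA (Bst _ Jx) [LHS]mulmxA.
- by rewrite lt0n mxrank_eq0.
exists J'; split=> //; [by move=> x /J'J/JH|exact: findex_trans fJ fJ'|].
exists (v *m B).
  apply: contraNneq v0 => e; apply/eqP.
  by apply: (row_free_inj (row_base_free U)); rewrite e mul0mx.
move=> h J'h; have [a ea] := vP _ J'h; exists a.
by rewrite -[LHS]mulmxA -(Bst _ (J'J _ J'h)) [LHS]mulmxA ea -scalemxAl.
Qed.

End Representations.

(** * Derivations and subrings *)

Section Der.
Variables (n : nat) (D : DField n).
Lemma derD i (x y : D) : der D i (x + y) = der D i x + der D i y.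
Proof. by case: (der_is_derivation D i). Qed.

Lemma der_zmod i : zmod_morphism (der D i).
Proof.
have dD := derD i.
have d0 : der D i 0 = 0 by apply: (addIr (der D i 0)); rewrite -dD !add0r.
by move=> x y; apply: (addIr (der D i y)); rewrite -dD !subrK.
Qed.
HB.instance Definition _ i := GRing.isZmodMorphism.Build D D (der D i) (@der_zmod i).

Lemma derM i (x y : D) : der D i (x * y) = der D i x * y + x * der D i y.
Proof. by case: (der_is_derivation D i). Qed.

Lemma der1 i : der D i 1 = 0.
Proof.
have := derM i 1 1; rewrite !mulr1 mul1r => /(congr1 (fun z => z - der D i 1)).
by rewrite addrK subrr.
Qed.

Lemma derX i (x : D) k : der D i (x ^+ k) = (k%:R * x ^+ k.-1) * der D i x.
Proof.
elim: k => [|[|k] IH]; rewrite ?expr0 ?der1 ?mul0r ?mul1r ?mul1r //.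
by rewrite exprS derM IH /= exprS -natr1; ring.
Qed.

Lemma derV i (x : D) : x != 0 -> der D i x^-1 = - der D i x / x ^+ 2.
Proof.
move=> x0; have := derM i x x^-1; rewrite divff // der1 => e.
apply: (mulfI x0); have -> : x * der D i x^-1 = - (der D i x / x).
  by apply/eqP; rewrite -addr_eq0 addrC -e.
by field.
Qed.

Lemma der_div i (x y : D) : y != 0 ->
  der D i (x / y) = (der D i x * y - x * der D i y) / y ^+ 2.
Proof. by move=> y0; rewrite derM derV //; field. Qed.

Lemma foldr_der_perm (w w' : seq 'I_n) (x : D) : perm_eq w w' ->
  foldr (der D) x w = foldr (der D) x w'.
Proof.
have com1 i (s : seq 'I_n) z : der D i (foldr (der D) z s) = foldr (der D) (der D i z) s.
  by elim: s => //= j s <-; rewrite der_comm.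
have com (s t : seq 'I_n) z : foldr (der D) (foldr (der D) z t) s = foldr (der D) (foldr (der D) z s) t.
  by elim: s => //= j s ->; rewrite com1.
move/catCA_perm_ind => ind.
apply: esym; apply: (ind (fun s => foldr (der D) x s = foldr (der D) x w)) => // s1 s2 s3.
by rewrite !foldr_cat com.
Qed.
End Der.

Lemma dmorph_foldr n (F L : DField n) (f : F -> L) (w : seq 'I_n) x :
  dmorph f -> f (foldr (der F) x w) = foldr (der L) (f x) w.
Proof. by move=> df; elim: w => //= i w <-; rewrite df. Qed.

Definition subring (R : nzRingType) (S : R -> Prop) :=
  [/\ S 1, (forall x y, S x -> S y -> S (x - y)) & forall x y, S x -> S y -> S (x * y)].

Section Subring.
Variables (R : nzRingType) (S : R -> Prop).
Hypothesis sS : subring S.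

Lemma subring1 : S 1. Proof. by case: sS. Qed.
Lemma subringB x y : S x -> S y -> S (x - y). Proof. by case: sS => _ + _; apply. Qed.
Lemma subringM x y : S x -> S y -> S (x * y). Proof. by case: sS => _ _; apply. Qed.
Lemma subring0 : S 0. Proof. by rewrite -(subrr 1); apply: subringB; exact: subring1. Qed.
Lemma subringN x : S x -> S (- x).
Proof. by move=> Sx; rewrite -sub0r; apply: subringB Sx; exact: subring0. Qed.
Lemma subringD x y : S x -> S y -> S (x + y).
Proof. by move=> Sx Sy; rewrite -(opprK y); apply: subringB Sx _; exact: subringN. Qed.
Lemma subring_sum I (r : seq I) (P : pred I) (F : I -> R) :
  (forall i, P i -> S (F i)) -> S (\sum_(i <- r | P i) F i).
Proof. by move=> SF; elim/big_ind: _ => //; [exact: subring0|exact: subringD]. Qed.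
Lemma subring_nat k : S k%:R.
Proof.
elim: k => [|k IH]; first exact: subring0.
by rewrite -natr1; apply: subringD IH subring1.
Qed.
Lemma subringX x k : S x -> S (x ^+ k).
Proof.
by move=> Sx; elim: k => [|k IH]; [exact: subring1|rewrite exprS; exact: subringM].
Qed.

Definition polyS (p : {poly R}) := forall i, S p`_i.

Lemma polyS_C c : S c -> polyS c%:P.
Proof. by move=> Sc i; rewrite coefC; case: ifP => // _; exact: subring0. Qed.
Lemma polyS_X : polyS 'X.
Proof. by move=> i; rewrite coefX; exact: subring_nat. Qed.
Lemma polyS_B p q : polyS p -> polyS q -> polyS (p - q).
Proof. by move=> Sp Sq i; rewrite coefB; exact: subringB. Qed.
Lemma polyS_D p q : polyS p -> polyS q -> polyS (p + q).
Proof. by move=> Sp Sq i; rewrite coefD; exact: subringD. Qed.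
Lemma polyS_N p : polyS p -> polyS (- p).
Proof. by move=> Sp i; rewrite coefN; exact: subringN. Qed.
Lemma polyS_M p q : polyS p -> polyS q -> polyS (p * q).
Proof.
by move=> Sp Sq i; rewrite coefM; apply: subring_sum => j _; exact: subringM.
Qed.
Lemma polyS_Z c p : S c -> polyS p -> polyS (c *: p).
Proof. by move=> Sc Sp i; rewrite coefZ; exact: subringM. Qed.
Lemma polyS_0 : polyS 0. Proof. by move=> i; rewrite coef0; exact: subring0. Qed.
Lemma polyS_1 : polyS 1. Proof. exact: polyS_C subring1. Qed.
Lemma polyS_X_exp p k : polyS p -> polyS (p ^+ k).
Proof.
by move=> Sp; elim: k => [|k IH]; [exact: polyS_1|rewrite exprS; exact: polyS_M].
Qed.
Lemma polyS_deriv p : polyS p -> polyS p^`().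
Proof.
by move=> Sp i; rewrite coef_deriv -mulr_natr; apply: subringM => //; exact: subring_nat.
Qed.
Lemma polyS_horner p x : polyS p -> S x -> S p.[x].
Proof.
move=> Sp Sx; rewrite horner_coef; apply: subring_sum => i _.
by apply: subringM => //; exact: subringX.
Qed.
End Subring.

(* Pseudo-division of [p] by [B]: a relation over the first component which is
   minimal at [x.1] forces every relation at [x.1] to specialize at [x.2]. *)
Lemma pair_reduction (E1 E2 : fieldType) (S : E1 * E2 -> Prop) (x : E1 * E2)
    (B : {poly E1 * E2}) :
  subring S -> (forall b, S (0, b) -> b = 0) -> polyS S B -> (0 < size B)%N ->
  (lead_coef B).2 != 0 -> B.[x] = 0 ->
  (forall p, polyS S p -> (size p < size B)%N -> p.[x].1 = 0 -> forall i, (p`_i).1 = 0) ->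
  forall p, polyS S p -> p.[x].1 = 0 -> p.[x].2 = 0.
Proof.
move=> sS S0 SB sB lB Bx Bmin p.
elim/ltn_ind: {p}(size p) {-2}p (erefl (size p)) => n IH p sp Sp px.
have [lt|ge] := ltnP (size p) (size B).
  suff -> : p = 0 by rewrite horner0.
  apply/polyP => i; have := Bmin p Sp lt px i; have := Sp i.
  by rewrite coef0; case: (p`_i) => a b /= Sab a0; rewrite a0 in Sab *; rewrite (S0 _ Sab).
(* Multiplying by [lead_coef B] avoids a division inside [S]; its second component is nonzero, so it
   can be cancelled after evaluation. *)
pose q := lead_coef B *: p - lead_coef p *: ('X^(size p - size B) * B).
have Sq : polyS S q.
  apply: polyS_B => //; apply: polyS_Z => //; try exact: SB; try exact: Sp.
  by apply: polyS_M => //; apply: polyS_X_exp => //; exact: polyS_X.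
have sq : (size q < size p)%N.
  have p0 : (0 < size p)%N by apply: leq_trans ge.
  rewrite -(ltn_predK p0) ltnS; apply/leq_sizeP => j hj.
  have hj' : (size p - size B <= j)%N by lia.
  rewrite coefB !coefZ coefXnM ltnNge hj' /=.
  have [->|ne] := eqVneq j (size p).-1.
    have -> : ((size p).-1 - (size p - size B) = (size B).-1)%N by lia.
    by rewrite -!lead_coefE mulrC subrr.
  have {ne} sj : (size p <= j)%N by rewrite -(ltn_predK p0) ltn_neqAle eq_sym ne.
  have sj' : (size B <= j - (size p - size B))%N.
    by rewrite leq_subRL // subnK.
  by rewrite !nth_default ?mulr0 ?subrr.
have qx : q.[x] = lead_coef B * p.[x] by rewrite hornerD hornerN !hornerZ hornerM Bx !mulr0 subr0.
have : q.[x].2 = 0.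
  by apply: (IH (size q)) Sq _ => //; rewrite -?sp // qx /= px mulr0.
by rewrite qx => /eqP; rewrite mulf_eq0 (negPf lB) => /eqP.
Qed.

(** * Specialization of solutions of differential systems *)

Fixpoint ltl (s t : seq nat) : bool :=
  match s, t with
  | a :: s', b :: t' => (a < b)%N || (a == b) && ltl s' t'
  | _, _ => false
  end.

Lemma ltl_trans : transitive ltl.
Proof.
elim=> [|b t IH] [|a s] [|c u] //= /orP[ab|/andP[/eqP-> st]] /orP[bc|/andP[/eqP<- tu]].
- by rewrite (ltn_trans ab bc).
- by rewrite ab.
- by rewrite bc.
- by rewrite eqxx (IH _ _ st tu) orbT.
Qed.

Lemma ltl_total s t : size s = size t -> [\/ ltl s t, s = t | ltl t s].
Proof.
elim: s t => [|a s IH] [|b t] //= => [_|[/IH{}IH]]; first by constructor 2.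
have [ab|ba|->] := ltngtP a b; [by constructor 1|by constructor 3|].
by case: IH => [->|->|->]; [constructor 1|constructor 2|constructor 3]; rewrite ?orbT.
Qed.

Lemma ltl_ind n (P : seq nat -> Prop) :
  (forall s, size s = n -> (forall t, size t = n -> ltl t s -> P t) -> P s) ->
  forall s, size s = n -> P s.
Proof.
elim: n P => [|n IH] P PI.
  by case=> // _; apply: PI => // -[].
case=> // a s [sn]; elim/ltn_ind: a => a IHa in s sn *.
move: s sn; apply: (IH (fun s => P (a :: s))) => s sn IHs.
apply: PI; rewrite /= ?sn // => -[|b t] //= [tn] /orP[ba|/andP[/eqP-> ts]]; first exact: IHa.
exact: IHs.
Qed.

Lemma ltl_add X (f g h : X -> nat) (r : seq X) :
  ltl (map f r) (map g r) -> ltl [seq (h x + f x)%N | x <- r] [seq (h x + g x)%N | x <- r].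
Proof.
elim: r => //= x r IH /orP[lt|/andP[/eqP-> /IH->]]; first by rewrite ltn_add2l lt.
by rewrite eqxx orbT.
Qed.

(** A finite basis [l0] for the first [n] coordinates also covers every vector whose coordinate [n]
    reaches the bound [B] of [l0]. The finitely many smaller values of that coordinate are treated
    one slice at a time. *)
Lemma dickson n (A : (nat -> nat) -> Prop) :
  exists l : seq (nat -> nat), (forall b, List.In b l -> A b) /\
    forall a, A a -> exists2 b, List.In b l & forall i, (i < n)%N -> (b i <= a i)%N.
Proof.
elim: n A => [|n IH] A.
  have [[a Aa]|nA] := pselect (exists a, A a).
    by exists [:: a]; split=> [b [<-|[]]//|b _]; exists a => //; left.
  by exists [::]; split=> // a Aa; case: nA; exists a.
have [l0 [l0A l0P]] := IH A.
have [B BP] : exists B, forall b, List.In b l0 -> (b n <= B)%N.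
  elim: l0 {l0A l0P} => [|b l [B BP]]; first by exists 0%N.
  exists (maxn (b n) B) => c /= [<-|/BP]; first exact: leq_maxl.
  by move=> h; apply: leq_trans h (leq_maxr _ _).
suff [l [lA lP]] : exists l : seq (nat -> nat), (forall b, List.In b l -> A b) /\
    forall a, A a -> (a n < B)%N -> exists2 b, List.In b l & forall i, (i < n.+1)%N -> (b i <= a i)%N.
  exists (l0 ++ l); split=> [b|a Aa]; first by rewrite List.in_app_iff => -[/l0A|/lA].
  have [lt|ge] := ltnP (a n) B.
    by have [b bl h] := lP _ Aa lt; exists b => //; apply: List.in_or_app; right.
  have [b bl h] := l0P _ Aa; exists b; first by apply: List.in_or_app; left.
  move=> i; rewrite ltnS leq_eqVlt => /orP[/eqP->|/h//].
  exact: leq_trans (BP _ bl) ge.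
elim: (B) => [|c [l [lA lP]]]; first by exists [::].
have [l1 [l1A l1P]] := IH (fun a => A a /\ a n = c).
exists (l ++ l1); split=> [b|a Aa]; first by rewrite List.in_app_iff => -[/lA|/l1A[]].
rewrite ltnS leq_eqVlt => /orP[/eqP ac|lt]; last first.
  by have [b bl h] := lP _ Aa lt; exists b => //; apply: List.in_or_app; left.
have [b bl h] := l1P _ (conj Aa ac); exists b; first by apply: List.in_or_app; right.
move=> i; rewrite ltnS leq_eqVlt => /orP[/eqP->|/h//].
by have [_ ->] := l1A _ bl; rewrite ac.
Qed.

Lemma count_mem_extend (T : eqType) (w w' : seq T) :
  (forall x, (count_mem x w <= count_mem x w')%N) -> exists t, perm_eq w' (t ++ w).
Proof.
elim: w w' => [|x w IH] w' cnt; first by exists w'; rewrite cats0.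
have xw : x \in w' by rewrite -has_pred1 has_count (leq_trans _ (cnt x)) //= eqxx.
have [y|t pt] := IH (rem x w').
  have := cnt y; rewrite (permP (perm_to_rem xw)) /=; case: (x == y) => //.
exists t; apply: perm_trans (perm_to_rem xw) _.
by rewrite perm_sym -cat1s perm_catCA cat1s perm_cons perm_sym.
Qed.

Section Ranking.
Variables (s n : nat).
Notation V := ('I_s * seq 'I_n)%type.
Implicit Types (u v : V).

(** An orderly ranking: order first, then the indeterminate, then the exponents. Words that differ
    by a permutation get the same key, as befits commuting derivations. *)
Definition rkey v : seq nat :=
  size v.2 :: (v.1 : nat) :: [seq count_mem l v.2 | l <- enum 'I_n].
Definition vder (w : seq 'I_n) v : V := (v.1, w ++ v.2).

Lemma size_rkey v : size (rkey v) = n.+2.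
Proof. by rewrite /= size_map size_enum_ord. Qed.

Lemma rkey_inj u v : rkey u = rkey v -> u.1 = v.1 /\ perm_eq u.2 v.2.
Proof.
case: u v => i w [j w'] [_ /= /val_inj -> /eq_in_map e]; split=> //.
by apply/allP => l _ /=; rewrite e ?mem_enum.
Qed.

Lemma rkey_perm u v : u.1 = v.1 -> perm_eq u.2 v.2 -> rkey u = rkey v.
Proof.
move=> e /[dup]/perm_size es /permP ep; rewrite /rkey e es; congr [:: _, _ & _].
by apply: eq_map => l; exact: ep.
Qed.

Lemma ltl_size u v : (size u.2 < size v.2)%N -> ltl (rkey u) (rkey v).
Proof. by rewrite /= => ->. Qed.

Lemma ltl_vder l u v : ltl (rkey u) (rkey v) -> ltl (rkey (vder [:: l] u)) (rkey (vder [:: l] v)).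
Proof.
rewrite /= ltnS eqSS => /orP[->//|/andP[-> /orP[->|/andP[-> h]]]]; rewrite ?orbT //=.
by rewrite (ltl_add (fun j => l == j) h) !orbT.
Qed.

Lemma dickson_vars (A : V -> Prop) :
  exists l : seq V, (forall v, v \in l -> A v) /\
    forall u, A u -> exists v w, [/\ v \in l, u.1 = v.1 & perm_eq u.2 (w ++ v.2)].
Proof.
(* The index of the indeterminate is stored together with its complement in [s]: domination in both
   coordinates forces equal indices. *)
pose code v (i : nat) : nat := if i == n then v.1 : nat else if i == n.+1 then (s - v.1)%N
  else if insub i is Some l then count_mem (l : 'I_n) v.2 else 0%N.
have [lf [lA lP]] := dickson n.+2 (fun a => exists2 v, A v & a = code v).
have [l [lA' lf_l]] : exists l : seq V, (forall v, v \in l -> A v) /\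
    forall a, List.In a lf -> exists2 v, v \in l & a = code v.
  elim: lf lA {lP} => [|a lf IH] lA; first by exists [::].
  have [v Av av] := lA a (or_introl erefl).
  have [|l [h1 h2]] := IH; first by move=> b bl; apply: lA; right.
  exists (v :: l); split=> [u|b /= [<-|/h2[u ul ->]]].
  - by rewrite inE => /orP[/eqP->|/h1].
  - by exists v; rewrite ?inE ?eqxx.
  - by exists u; rewrite // inE ul orbT.
exists l; split=> // u Au.
have [_ /lf_l[v vl ->] le] := lP _ (ex_intro2 _ _ u Au erefl).
have e1 : u.1 = v.1.
  apply: val_inj; have := le n (leqnSn _); have := le n.+1 (leqnn _).
  rewrite /code !eqxx eqn_leq ltnn /=; have := ltn_ord u.1; have := ltn_ord v.1.
  by rewrite /=; lia.
have [x|w pw] := @count_mem_extend _ v.2 u.2; last by exists v, w.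
have := le x (ltn_trans (ltn_ord x) (ltnW (leqnn _))).
by rewrite /code !ltn_eqF ?ltn_ord ?(ltn_trans (ltn_ord x)) // valK.
Qed.
End Ranking.

(** * Differential polynomials, leaders and separants *)

Section DPoly.
Variables (s n : nat) (R : nzRingType).
Notation dp := (dpoly R s n).
Notation V := ('I_s * seq 'I_n)%type.

Definition dpV (v : V) : dp := dpY _ v.1 v.2.

Fixpoint ddp (d : 'I_n -> R -> R) l (P : dp) : dp :=
  match P with
  | dpC c => dpC s n (d l c)
  | dpY i w => dpY R i (l :: w)
  | dpAdd P Q => dpAdd (ddp d l P) (ddp d l Q)
  | dpMul P Q => dpAdd (dpMul (ddp d l P) Q) (dpMul P (ddp d l Q))
  | dpOpp P => dpOpp (ddp d l P)
  end.

Lemma deval_ddp (L : DField n) (f : R -> L) (d : 'I_n -> R -> R) (y : 'I_s -> L) l P :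
  (forall i c, f (d i c) = der L i (f c)) ->
  deval f (der L) y (ddp d l P) = der L l (deval f (der L) y P).
Proof.
move=> fd; elim: P => [c|i w|P IHP Q IHQ|P IHP Q IHQ|P IHP] //=.
- by rewrite IHP IHQ raddfD.
- by rewrite IHP IHQ derM.
- by rewrite IHP raddfN.
Qed.

Fixpoint below (k : seq nat) (P : dp) : bool :=
  match P with
  | dpC c => true
  | dpY i w => ltl (rkey (i, w)) k
  | dpAdd P Q => below k P && below k Q
  | dpMul P Q => below k P && below k Q
  | dpOpp P => below k P
  end.

Lemma belowS k k' P : (forall v : V, ltl (rkey v) k -> ltl (rkey v) k') ->
  below k P -> below k' P.
Proof.
move=> kk'; elim: P => [c|i w|P IHP Q IHQ|P IHP Q IHQ|P IHP] //=; first exact: (kk' (i, w)).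
- by case/andP => /IHP-> /IHQ.
- by case/andP => /IHP-> /IHQ.
Qed.

Lemma below_trans k k' P : ltl k k' -> below k P -> below k' P.
Proof. by move=> kk'; apply: belowS => v h; apply: ltl_trans kk'. Qed.

Lemma below_ddp d l (v : V) P : below (rkey v) P -> below (rkey (vder [:: l] v)) (ddp d l P).
Proof.
elim: P => [c|i w|P IHP Q IHQ|P IHP Q IHQ|P IHP] //.
- exact: (@ltl_vder _ _ l (i, w) v).
- by case/andP => /IHP hP /IHQ hQ; apply/andP.
- have lt : ltl (rkey v) (rkey (vder [:: l] v)) by apply: ltl_size.
  case/andP => P1 Q1; apply/andP; split; apply/andP; split.
  + exact: IHP.
  + exact: below_trans lt Q1.
  + exact: below_trans lt P1.
  + exact: IHQ.
Qed.

(** Horner form of a polynomial in the derivative [v] with coefficients [cs]. Then [ptree'] is its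
    partial derivative with respect to [v], that is, the separant when [v] is the leader. *)
Fixpoint ptree (cs : seq dp) (v : V) : dp :=
  if cs is c :: cs' then dpAdd (dpMul (ptree cs' v) (dpV v)) c else dpC s n 0.

Fixpoint ptree' (cs : seq dp) (v : V) : dp :=
  if cs is c :: cs' then dpAdd (dpMul (ptree' cs' v) (dpV v)) (ptree cs' v) else dpC s n 0.

Section Eval.
Variables (L : DField n) (f : R -> L) (y : 'I_s -> L).
Hypothesis f0 : f 0 = 0.
Local Notation ev := (deval f (der L) y).

Lemma deval_ptree cs v : ev (ptree cs v) = (Poly (map ev cs)).[ev (dpV v)].
Proof. by elim: cs => [|c cs IH] /=; rewrite ?horner0 // horner_cons IH. Qed.

Lemma deval_ptree' cs v : ev (ptree' cs v) = (Poly (map ev cs))^`().[ev (dpV v)].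
Proof.
elim: cs => [|c cs IH] /=; first by rewrite deriv0 horner0 f0.
rewrite cons_poly_def derivD derivC addr0 derivM derivX mulr1 hornerD hornerM hornerX.
by rewrite IH deval_ptree.
Qed.

Lemma deval_der_ptree d cs v l : (forall i c, f (d i c) = der L i (f c)) ->
  ev (ddp d l (ptree cs v)) =
  ev (ptree' cs v) * ev (dpV (vder [:: l] v)) + ev (ptree (map (ddp d l) cs) v).
Proof.
move=> fd; elim: cs => [|c cs IH] /=; first by rewrite fd f0 raddf0 mul0r add0r.
by rewrite IH /=; ring.
Qed.
End Eval.

Lemma ptree_below k cs v : ltl (rkey v) k -> all (below k) cs -> below k (ptree cs v).
Proof. by move=> vk; elim: cs => //= c cs IH /andP[-> /IH->]; case: v vk {IH} => i w /= ->. Qed.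

Lemma ptree'_below k cs v : ltl (rkey v) k -> all (below k) cs -> below k (ptree' cs v).
Proof.
move=> vk; elim: cs => //= c cs IH /andP[ck ak]; rewrite IH ?ptree_below //=.
by case: v vk {IH} => i w /= ->.
Qed.

Lemma all_belowS k k' cs : ltl k k' -> all (below k) cs -> all (below k') cs.
Proof. by move=> kk'; apply: sub_all => c; exact: below_trans. Qed.

(* A proper derivative of an algebraic relation for [v] is linear in the derivative of [v]. *)
Lemma der_ptree_linear d cs v l w : all (below (rkey v)) cs ->
  exists2 T, below (rkey (vder (w ++ [:: l]) v)) T &
  forall (L : DField n) (f : R -> L) (y : 'I_s -> L), f 0 = 0 ->
    (forall i c, f (d i c) = der L i (f c)) ->
    foldr (der L) (deval f (der L) y (ptree cs v)) (w ++ [:: l]) =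
    deval f (der L) y (ptree' cs v) * deval f (der L) y (dpV (vder (w ++ [:: l]) v))
    + deval f (der L) y T.
Proof.
move=> ac; elim: w => [|l' w [T bT TP]].
  exists (ptree (map (ddp d l) cs) v) => [|L f y f0 fd].
    apply: ptree_below; first exact: ltl_size.
    by rewrite all_map; apply: sub_all ac => c; exact: below_ddp.
  by rewrite /= -(deval_ddp (d := d)) // (deval_der_ptree y f0 _ _ _ fd).
have [b1 b2] : below (rkey (vder (w ++ [:: l]) v)) (ptree' cs v) /\
    ltl (rkey (vder (w ++ [:: l]) v)) (rkey (vder ((l' :: w) ++ [:: l]) v)).
  have lt : ltl (rkey v) (rkey (vder (w ++ [:: l]) v)).
    by apply: ltl_size; rewrite /= !size_cat /=; lia.
  split; last by apply: ltl_size.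
  by apply: ptree'_below => //; exact: all_belowS ac.
exists (dpAdd (dpMul (ddp d l' (ptree' cs v)) (dpV (vder (w ++ [:: l]) v))) (ddp d l' T)).
  have := below_ddp d l' b1; have := below_ddp d l' bT; rewrite /vder /= => -> ->.
  by rewrite andbT; exact: b2.
move=> L f y f0 fd; rewrite [LHS]/= TP // derD derM [RHS]/= !(deval_ddp (d := d)) //.
by rewrite /=; ring.
Qed.

Fixpoint dpvars (P : dp) : seq V :=
  match P with
  | dpC c => [::]
  | dpY i w => [:: (i, w)]
  | dpAdd P Q => dpvars P ++ dpvars Q
  | dpMul P Q => dpvars P ++ dpvars Q
  | dpOpp P => dpvars P
  end.

Lemma belowE k P : below k P = all (fun v : V => ltl (rkey v) k) (dpvars P).
Proof. by elim: P => [c|i w|P IHP Q IHQ|P IHP Q IHQ|P IHP] //=; rewrite ?andbT ?all_cat ?IHP ?IHQ. Qed.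

Lemma max_var (r : seq V) : r != [::] ->
  exists2 u, u \in r & forall v, v \in r -> ltl (rkey v) (rkey u) \/ rkey v = rkey u.
Proof.
elim: r => // u r IH _; have [->|/IH[m mr mP]] := eqVneq r [::].
  by exists u; rewrite ?inE // => v; rewrite inE => /eqP->; right.
have := @ltl_total (rkey u) (rkey m); rewrite !size_rkey => /(_ erefl)[um|um|mu].
- exists m; first by rewrite inE mr orbT.
  by move=> v; rewrite inE => /orP[/eqP->|/mP//]; left.
- exists m; first by rewrite inE mr orbT.
  by move=> v; rewrite inE => /orP[/eqP->|/mP//]; right.
- exists u; first by rewrite inE eqxx.
  move=> v; rewrite inE => /orP[/eqP->|/mP[h|->]]; [by right| |by left].
  by left; exact: ltl_trans mu.
Qed.
End DPoly.

Lemma foldr_der0 n (D : DField n) (w : seq 'I_n) : foldr (der D) 0 w = 0.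
Proof. by elim: w => //= i w ->; rewrite raddf0. Qed.

(** * Specialization to a differentially closed field *)

Section Specialization.
Variables (s n : nat) (C0 L : DField n) (iota : {rmorphism C0 -> L}).
Notation dp := (dpoly C0 s n).
Notation V := ('I_s * seq 'I_n)%type.
Hypotheses (ch0 : [pchar C0] =i pred0) (dcl : diff_closed C0) (dm : dmorph iota).
Variables (y : 'I_s -> L) (Q : dp).
Hypothesis Qy : deval iota (der L) y Q != 0.

Let evy := deval iota (der L) y.
Let evz (z : 'I_s -> C0) := deval id (der C0) z.

Let K (k : seq nat) (a : L) := exists2 P, below k P & a = evy P.

Let subringK k : subring (K k).
Proof.
split=> [|_ _ [P bP ->] [P' bP' ->]|_ _ [P bP ->] [P' bP' ->]].
- by exists (dpC s n 1) => //=; rewrite /evy /= rmorph1.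
- by exists (dpAdd P (dpOpp P')) => //=; rewrite bP.
- by exists (dpMul P P') => //=; rewrite bP.
Qed.

Let algv (v : V) := exists p, [/\ polyS (K (rkey v)) p, p != 0 & p.[evy (dpV C0 v)] = 0].

(** A relation of least degree, lifted to differential polynomials. The condition on [polyseq] says
    that the last coefficient, the initial, does not vanish at [y]. *)
Let algrel (v : V) (cs : seq dp) := [/\ all (below (rkey v)) cs,
   polyseq (Poly (map evy cs)) = map evy cs, (0 < size cs)%N,
   (Poly (map evy cs)).[evy (dpV C0 v)] = 0 &
   forall p, polyS (K (rkey v)) p -> (size p < size cs)%N -> p.[evy (dpV C0 v)] = 0 -> p = 0].

Let algrel_ex v : algv v -> exists cs, algrel v cs.
Proof.
move=> [p0 [Kp0 p00 rp0]].
have [|m [p [Kp p_n0 rp sp]] min] := @least_nat (fun m => exists p,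
    [/\ polyS (K (rkey v)) p, p != 0, p.[evy (dpV C0 v)] = 0 & size p = m]).
  by exists (size p0), p0.
have /choice[c cP] : forall i, exists P, below (rkey v) P /\ p`_i = evy P.
  by move=> i; have [P bP e] := Kp i; exists P.
have ec : map evy (mkseq c (size p)) = p.
  rewrite -map_comp -[RHS](mkseq_nth 0); apply: eq_map => i /=.
  by case: (cP i).
exists (mkseq c (size p)); rewrite /algrel ec size_mkseq polyseqK; split=> //.
- by rewrite all_map; apply/allP => i _ /=; case: (cP i).
- by rewrite size_poly_gt0.
- move=> q Kq sq rq; apply: contraTeq sq => q0; rewrite -leqNgt sp.
  by apply: min; exists q.
Qed.

Let natL k : (k.+1%:R : L) != 0.
Proof. by rewrite -(rmorph_nat iota) fmorph_eq0; move/pcharf0P: ch0 => ->. Qed.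

(** If the separant vanished at [y], the derivative of the minimal relation would be a relation of
    smaller degree, hence zero, which characteristic zero excludes. *)
Let sep_neq0 v cs : algrel v cs -> evy (ptree' cs v) != 0.
Proof.
move=> [acs ecs scs root min]; rewrite /evy deval_ptree' ?rmorph0 //.
set p := Poly _ in ecs root *.
have sp : size p = size cs by rewrite ecs size_map.
have p0 : p != 0 by rewrite -size_poly_gt0 sp.
have Kp : polyS (K (rkey v)) p.
  move=> i; rewrite ecs; have [lt|ge] := ltnP i (size cs).
    rewrite (nth_map (dpC s n 0)) //; exists (nth (dpC s n 0) cs i) => //.
    exact: all_nthP acs i lt.
  by rewrite nth_default ?size_map //; exact: subring0.
have sp2 : (1 < size p)%N.
  rewrite ltnNge; apply/negP => /size1_polyC; move: (p`_0) => c e.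
  by move: p0 root; rewrite e polyC_eq0 hornerC => /eqP.
apply: contra_neq p0 => rd.
have /polyP/(_ (size p).-2) : p^`() = 0.
  by apply: min rd; [exact: polyS_deriv|rewrite -sp lt_size_deriv // -size_poly_gt0 ltnW].
rewrite coef0 coef_deriv -mulr_natr => /eqP; rewrite mulf_eq0 (negPf (natL _)) orbF.
have -> : (size p).-2.+1 = (size p).-1 by lia.
by rewrite -lead_coefE lead_coef_eq0 => /eqP.
Qed.

Let evC P : dpvars P = [::] -> forall z, evy P = iota (evz z P).
Proof.
rewrite /evy /evz; elim: P => [c|i w|P IHP P' IHP'|P IHP P' IHP'|P IHP] //= h z.
- by move: h; case E : (dpvars P) => //= h; rewrite (IHP E z) (IHP' h z) rmorphD.
- by move: h; case E : (dpvars P) => //= h; rewrite (IHP E z) (IHP' h z) rmorphM.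
- by rewrite (IHP h z) rmorphN.
Qed.

Let ev_key (M : DField n) (f : C0 -> M) x (u v : V) : rkey u = rkey v ->
  deval f (der M) x (dpV C0 u) = deval f (der M) x (dpV C0 v).
Proof. by case/rkey_inj => /= -> p; apply: foldr_der_perm. Qed.

(* Solve the minimal relations of the Dickson-minimal algebraic derivatives only, keeping
   their initials and separants nonzero: all other relations follow by reduction. *)
Lemma specialization : exists z : 'I_s -> C0,
  (forall P : dp, deval iota (der L) y P = 0 -> deval id (der C0) z P = 0) /\
  deval id (der C0) z Q != 0.
Proof.
have /choice[CS CSP] : forall v, exists cs, algv v -> algrel v cs.
  by move=> v; have [/algrel_ex[cs h]|n_] := pselect (algv v); [exists cs|exists [::]].
have [l [lA lP]] := dickson_vars algv.
pose init v := nth (dpC s n 0) (CS v) (size (CS v)).-1.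
(* One inequation that carries [Q] together with all initials and separants. *)
pose H := foldr (fun v acc => dpMul acc (dpMul (init v) (ptree' (CS v) v))) Q l.
have init_neq0 v : algv v -> evy (init v) != 0.
  move=> /CSP[_ e sc _ _]; have : lead_coef (Poly (map evy (CS v))) != 0.
    by rewrite lead_coef_eq0 -size_poly_gt0 e size_map.
  by rewrite lead_coefE e size_map (nth_map (dpC s n 0)) // prednK.
have [z [zP zH]] : exists z, dsystem_sol id (der C0) [seq ptree (CS v) v | v <- l] H z.
  apply: dcl; exists L, iota; split=> //; exists y; split.
    move=> P; rewrite -map_comp => /mapP[v vl ->]; rewrite /= deval_ptree ?rmorph0 //.
    by have [] := CSP _ (lA _ vl).
  rewrite /H; elim: l lA {lP H} => //= v l IH lA.
  apply: mulf_neq0; first by apply: IH => u ul; apply: lA; rewrite inE ul orbT.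
  have av := lA v (mem_head _ _).
  by apply: mulf_neq0; [exact: init_neq0|exact: sep_neq0 (CSP v av)].
exists z; move: zH; rewrite -/(evz z H) /H.
have {zP} zP v : v \in l -> evz z (ptree (CS v) v) = 0.
  by move=> vl; apply: zP; rewrite -map_comp; apply/mapP; exists v.
have split_H : evz z H != 0 -> evz z Q != 0 /\
    forall v, v \in l -> evz z (init v) != 0 /\ evz z (ptree' (CS v) v) != 0.
  rewrite /H; elim: (l) => //= v l' IH.
  rewrite /evz /= !mulf_eq0 !negb_or => /andP[/IH[hQ hl] /andP[h1 h2]]; split=> // u.
  by rewrite inE => /orP[/eqP->|/hl].
move=> /split_H[zQ {split_H}zl]; split=> //.
(* Induction along the ranking on a strict bound for the derivatives in [P]; a key of larger order
   than the leader is such a bound. *)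
suff main : forall k, size k = n.+2 -> forall P, below k P -> evy P = 0 -> evz z P = 0.
  move=> P; have [e|nv] := eqVneq (dpvars P) [::].
    by apply: (main (nseq n.+2 0%N)); rewrite ?size_nseq // belowE e.
  have [u _ uP] := max_var nv.
  apply: (main ((size u.2).+1 :: behead (rkey u))).
    by rewrite /= size_map size_enum_ord.
  rewrite belowE; apply/allP => v /uP[h|->]; last by rewrite /= ltnS leqnn.
  by apply: ltl_trans h _; rewrite /= ltnS leqnn.
apply: ltl_ind => k sk IH P bP eP.
have [e|nv] := eqVneq (dpvars P) [::].
  by move: eP; rewrite (evC e z) => /eqP; rewrite fmorph_eq0 => /eqP.
have [u uP umax] := max_var nv.
have {IH} IH : forall P', below (rkey u) P' -> evy P' = 0 -> evz z P' = 0.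
  by apply: IH; [exact: size_rkey|move: bP; rewrite belowE => /allP; apply].
(* Pairs of values at [y] and at [z]. The induction hypothesis makes [S] the graph of a ring
   morphism, and [P] becomes a polynomial over [S] in its leader [u]. *)
pose S (x : L * C0) := exists2 c, below (rkey u) c & x = (evy c, evz z c).
have sS : subring S.
  split=> [|_ _ [a ba ->] [b bb ->]|_ _ [a ba ->] [b bb ->]].
  - by exists (dpC s n 1) => //=; rewrite /evy /= rmorph1.
  - by exists (dpAdd a (dpOpp b)) => //=; rewrite ba.
  - by exists (dpMul a b) => //=; rewrite ba.
have S0 b : S (0, b) -> b = 0 by move=> [c bc [e ->]]; apply: IH.
pose x : L * C0 := (evy (dpV C0 u), evz z (dpV C0 u)).
have [q Sq qx] : exists2 q, polyS S q & q.[x] = (evy P, evz z P).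
  move: umax; clear bP eP nv uP; elim: P => [c|i w|P IHP P' IHP'|P IHP P' IHP'|P IHP] h.
  - exists (iota c, c)%:P; last by rewrite hornerC.
    by apply: polyS_C => //; exists (dpC s n c).
  - have [lt|eq] := h (i, w) (mem_head _ _).
      exists (evy (dpY C0 i w), evz z (dpY C0 i w))%:P; last by rewrite hornerC.
      by apply: polyS_C => //; exists (dpY C0 i w).
    exists 'X; first exact: polyS_X.
    by rewrite hornerX /x /evy /evz -!(ev_key _ _ eq).
  - have [|p Sp px] := IHP; first by move=> v vP; apply: h; rewrite mem_cat vP.
    have [|p' Sp' px'] := IHP'; first by move=> v vP; apply: h; rewrite mem_cat vP orbT.
    by exists (p + p'); [exact: polyS_D|rewrite hornerD px px'].
  - have [|p Sp px] := IHP; first by move=> v vP; apply: h; rewrite mem_cat vP.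
    have [|p' Sp' px'] := IHP'; first by move=> v vP; apply: h; rewrite mem_cat vP orbT.
    by exists (p * p'); [exact: polyS_M|rewrite hornerM px px'].
  - have [//|p Sp px] := IHP.
    by exists (- p); [exact: polyS_N|rewrite hornerN px].
have fstP (p : {poly L * C0}) : polyS S p -> polyS (K (rkey u)) (map_poly fst p) /\ (map_poly fst p).[evy (dpV C0 u)] = p.[x].1.
  move=> Sp; split; last by rewrite -horner_map.
  by move=> i; rewrite coef_map; have [c bc ->] := Sp i; exists c.
have fst0 (p : {poly L * C0}) : map_poly fst p = 0 -> forall i, (p`_i).1 = 0.
  by move=> /polyP e i; have := e i; rewrite coef_map coef0.
have pairB cs : (Poly [seq (evy c, evz z c) | c <- cs]).[x] = (evy (ptree cs u), evz z (ptree cs u)).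
  elim: cs => [|c cs IHc] /=; first by rewrite horner0 /evy /= rmorph0.
  by rewrite horner_cons IHc.
have q0 : q.[x].1 = 0 by rewrite qx.
suff : q.[x].2 = 0 by rewrite qx.
have [au|nau] := pselect (algv u); last first.
  suff -> : q = 0 by rewrite horner0.
  have e0 : map_poly fst q = 0.
    apply: contra_notP nau => /eqP ne; exists (map_poly fst q).
    by have [h ->] := fstP q Sq; split.
  apply/polyP => i; have := fst0 _ e0 i; have := Sq i; rewrite coef0.
  by case: (q`_i) => a b Sab /= a0; rewrite a0 in Sab *; rewrite (S0 _ Sab).
have [v [w [vl e1 pw]]] := lP u au.
have ku : rkey u = rkey (vder w v) by apply: rkey_perm.
have [zi zs] := zl v vl.
have av := lA v vl; have [bcs ecs scs rcs mincs] := CSP v av.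
(* If [u] is one of the chosen derivatives, reduce by its minimal relation. If it is a proper
   derivative of one, reduce by the differentiated relation, which has degree 1 in [u] and the
   separant as leading coefficient. *)
case/lastP: w pw ku => [|w d] pw ku.
  have {}ku : rkey u = rkey v by rewrite ku; case: (v).
  pose B := Poly [seq (evy c, evz z c) | c <- CS v].
  have eB : polyseq B = [seq (evy c, evz z c) | c <- CS v].
    apply: (@PolyK _ 0); rewrite -nth_last size_map (nth_map (dpC s n 0)) ?prednK //.
    by apply: contra_neq (init_neq0 v av) => -[].
  have sB : size B = size (CS v) by rewrite eB size_map.
  have lB : lead_coef B = (evy (init v), evz z (init v)).
    by rewrite lead_coefE sB eB (nth_map (dpC s n 0)) // prednK.
  apply: (@pair_reduction _ _ S x B) => //.
  - move=> i; rewrite eB; have [lt|ge] := ltnP i (size (CS v)); last first.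
      by rewrite nth_default ?size_map //; exact: subring0.
    rewrite (nth_map (dpC s n 0)) //; exists (nth (dpC s n 0) (CS v) i) => //.
    by rewrite ku; apply: all_nthP.
  - by rewrite sB.
  - by rewrite lB.
  - rewrite /B pairB; have -> : evz z (ptree (CS v) u) = 0.
      by rewrite -(zP v vl) /evz !deval_ptree // (ev_key _ _ ku).
    by rewrite /evy deval_ptree ?rmorph0 // (ev_key _ _ ku) rcs.
  - move=> p Sp sp px; apply: fst0; have [Kp rp] := fstP p Sp.
    apply: mincs; first by rewrite -ku.
      by apply: leq_ltn_trans (size_poly _ _) _; rewrite -sB.
    by rewrite /evy -(ev_key _ _ ku) -/(evy _) rp.
have bc := bcs; have [T bT TP] := der_ptree_linear (der C0) d w bc.
rewrite cats1 in bT TP; rewrite -ku in bT.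
pose sep := ptree' (CS v) v; pose B := Poly [:: (evy T, evz z T); (evy sep, evz z sep)].
have sepy : evy sep != 0 by exact: sep_neq0 (CSP v av).
have eB : polyseq B = [:: (evy T, evz z T); (evy sep, evz z sep)].
  by apply: (@PolyK _ 0) => /=; apply: contra_neq sepy => -[].
have bsep : below (rkey u) sep.
  have vu : ltl (rkey v) (rkey u).
    by rewrite ku; apply: ltl_size; rewrite size_cat size_rcons addSn ltnS leq_addl.
  by apply: ptree'_below => //; exact: all_belowS bcs.
apply: (@pair_reduction _ _ S x B) => //.
- move=> i; rewrite eB; case: i => [|[|i]] /=; [by exists T|by exists sep|].
  by rewrite nth_nil; exact: subring0.
- by rewrite eB.
- by rewrite lead_coefE eB.
- have Ty := TP L iota y (rmorph0 _) (fun i c => dm i c).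
  have Tz := TP C0 id z erefl (fun i c => erefl).
  rewrite /B /= horner_cons horner_cons horner0 mul0r add0r.
  rewrite /x /evy /evz !(ev_key _ _ ku) /= in Ty Tz *.
  rewrite [X in foldr _ X]deval_ptree ?rmorph0 // rcs foldr_der0 in Ty.
  have := zP v vl; rewrite /evz => zv; rewrite zv foldr_der0 in Tz.
  by congr (_, _); [rewrite -Ty|rewrite -Tz].
- move=> p Sp; rewrite eB ltnS => /size1_polyC e px i; move: px; rewrite e hornerC coefC.
  by case: (i == 0%N).
Qed.
End Specialization.

(** * Differential field quotients *)

Local Open Scope quotient_scope.

Record prime_ideal (R : comNzRingType) := PrimeIdeal {
  pid :> R -> Prop;
  pid0 : pid 0;
  pidD : forall x y, pid x -> pid y -> pid (x + y);
  pidM : forall r x, pid x -> pid (r * x);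
  pid1 : ~ pid 1;
  pidP : forall x y, pid (x * y) -> pid x \/ pid y }.

Section ResidueField.
Variables (R : comNzRingType) (I : prime_ideal R).

Definition unz (x : R) : bool := `[< ~ I x >].

Lemma unz1 : unz 1. Proof. by apply/asboolP; exact: pid1. Qed.

Lemma unzM x y : unz x -> unz y -> unz (x * y).
Proof. by move=> /asboolP hx /asboolP hy; apply/asboolP => /pidP[]. Qed.

(** Denominators outside [I] and cross products compared modulo [I] yield the fraction field of R/I
    in a single quotient. *)
Record rfrac := RFrac { rpair :> R * R; rpairP : unz rpair.2 }.
HB.instance Definition _ := [isSub for rpair].
HB.instance Definition _ := [Choice of rfrac by <:].

Definition rfeq (f g : rfrac) : bool := `[< I (f.1 * g.2 - g.1 * f.2) >].

Lemma rfeq_refl : reflexive rfeq.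
Proof. by move=> f; apply/asboolP; rewrite subrr; exact: pid0. Qed.

Lemma rfeq_sym : symmetric rfeq.
Proof.
have h f g : rfeq f g -> rfeq g f.
  move=> /asboolP /(pidM (-1)) e; apply/asboolP.
  by have <- : -1 * (f.1 * g.2 - g.1 * f.2) = g.1 * f.2 - f.1 * g.2 by ring.
by move=> f g; apply/idP/idP; exact: h.
Qed.

Lemma rfeq_trans : transitive rfeq.
Proof.
move=> g f h /asboolP /(pidM h.2) fg; move: (rpairP g) => /asboolP ng.
move=> /asboolP /(pidM f.2) gh; apply/asboolP.
have : I (g.2 * (f.1 * h.2 - h.1 * f.2)).
  by have := pidD fg gh; congr (I _); ring.
by case/pidP.
Qed.

Canonical rfeq_equiv := EquivRel rfeq rfeq_refl rfeq_sym rfeq_trans.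
Definition rfield := {eq_quot rfeq}.
HB.instance Definition _ : EqQuotient _ rfeq rfield := EqQuotient.on rfield.
HB.instance Definition _ := Choice.on rfield.

Definition rf_mk x y (h : unz y) := @RFrac (x, y) h.
Definition rf0 := rf_mk 0 unz1.
Definition rf1 := rf_mk 1 unz1.
Definition rf_add (f g : rfrac) := rf_mk (f.1 * g.2 + g.1 * f.2) (unzM (rpairP f) (rpairP g)).
Definition rf_opp (f : rfrac) := rf_mk (- f.1) (rpairP f).
Definition rf_mul (f g : rfrac) := rf_mk (f.1 * g.1) (unzM (rpairP f) (rpairP g)).
Definition rf_inv (f : rfrac) := if @idP (unz f.1) is ReflectT h then rf_mk f.2 h else rf0.

Definition rq0 : rfield := \pi_rfield rf0.
Definition rq1 : rfield := \pi_rfield rf1.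
Definition rq_add (f g : rfield) : rfield := \pi_rfield (rf_add (repr f) (repr g)).
Definition rq_opp (f : rfield) : rfield := \pi_rfield (rf_opp (repr f)).
Definition rq_mul (f g : rfield) : rfield := \pi_rfield (rf_mul (repr f) (repr g)).
Definition rq_inv (f : rfield) : rfield := \pi_rfield (rf_inv (repr f)).

Lemma rq_eqP (f g : rfrac) : \pi_rfield f = \pi_rfield g <-> I (f.1 * g.2 - g.1 * f.2).
Proof. by split=> [/eqmodP/asboolP|h] //; apply/eqmodP/asboolP. Qed.

Lemma repr_piP (f : rfrac) : I ((repr (\pi_rfield f)).1 * f.2 - f.1 * (repr (\pi_rfield f)).2).
Proof. by apply/rq_eqP; rewrite reprK. Qed.

Lemma pid_comb (a b x y z : R) : I x -> I y -> z = a * x + b * y -> I z.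
Proof. by move=> Ix Iy ->; apply: pidD; exact: pidM. Qed.

Lemma rq_addE f g : rq_add (\pi f) (\pi g) = \pi_rfield (rf_add f g).
Proof.
apply/rq_eqP; have hf := repr_piP f; have hg := repr_piP g.
move: (repr (\pi_rfield f)) hf => f' hf; move: (repr (\pi_rfield g)) hg => g' hg /=.
by apply: (pid_comb (a := g'.2 * g.2) (b := f'.2 * f.2) hf hg); ring.
Qed.

Lemma rq_oppE f : rq_opp (\pi f) = \pi_rfield (rf_opp f).
Proof.
apply/rq_eqP; have hf := repr_piP f; move: (repr _) hf => f' hf /=.
by apply: (pid_comb (a := -1) (b := 0) hf hf); ring.
Qed.

Lemma rq_mulE f g : rq_mul (\pi f) (\pi g) = \pi_rfield (rf_mul f g).
Proof.
apply/rq_eqP; have hf := repr_piP f; have hg := repr_piP g.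
move: (repr (\pi_rfield f)) hf => f' hf; move: (repr (\pi_rfield g)) hg => g' hg /=.
by apply: (pid_comb (a := g'.1 * g.2) (b := f.1 * f'.2) hf hg); ring.
Qed.

Ltac rqz := apply/rq_eqP => /=;
  match goal with |- pid _ ?x => have -> : x = 0 by ring end; exact: pid0.

Lemma rq_addA : associative rq_add.
Proof. by elim/quotW=> f; elim/quotW=> g; elim/quotW=> h; rewrite !rq_addE; rqz. Qed.
Lemma rq_addC : commutative rq_add.
Proof. by elim/quotW=> f; elim/quotW=> g; rewrite !rq_addE; rqz. Qed.
Lemma rq_add0 : left_id rq0 rq_add.
Proof. by elim/quotW=> f; rewrite !rq_addE; rqz. Qed.
Lemma rq_addN : left_inverse rq0 rq_opp rq_add.
Proof. by elim/quotW=> f; rewrite !rq_oppE !rq_addE; rqz. Qed.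
HB.instance Definition _ := GRing.isZmodule.Build rfield rq_addA rq_addC rq_add0 rq_addN.

Lemma rq_mulA : associative rq_mul.
Proof. by elim/quotW=> f; elim/quotW=> g; elim/quotW=> h; rewrite !rq_mulE; rqz. Qed.
Lemma rq_mulC : commutative rq_mul.
Proof. by elim/quotW=> f; elim/quotW=> g; rewrite !rq_mulE; rqz. Qed.
Lemma rq_mul1 : left_id rq1 rq_mul.
Proof. by elim/quotW=> f; rewrite !rq_mulE; rqz. Qed.
Lemma rq_mulD : left_distributive rq_mul rq_add.
Proof.
by elim/quotW=> f; elim/quotW=> g; elim/quotW=> h; rewrite !(rq_mulE, rq_addE); rqz.
Qed.
Lemma rq_1_neq0 : rq1 != 0.
Proof. by apply/eqP => /rq_eqP /=; rewrite mulr1 mul0r subr0; exact: pid1. Qed.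
HB.instance Definition _ :=
  GRing.Zmodule_isComNzRing.Build rfield rq_mulA rq_mulC rq_mul1 rq_mulD rq_1_neq0.

Lemma rq_mulV (f : rfield) : f != 0 -> rq_mul (rq_inv f) f = 1.
Proof.
rewrite -{1 3}[f]reprK /rq_inv => nf; rewrite rq_mulE /rf_inv.
case: {-}_ / idP => [h|h]; first by rqz.
case/eqP: nf; apply/rq_eqP => /=; rewrite mul0r subr0 mulr1; apply: contrapT => h'.
by apply: h; apply/asboolP.
Qed.
Lemma rq_inv0 : rq_inv 0 = 0.
Proof.
rewrite /rq_inv; have nu : ~~ unz (repr (0 : rfield)).1; last first.
  by rewrite /rf_inv; case: {-}_ / idP => // h; case/negP: nu.
apply/negP => /asboolP; apply.
have /rq_eqP /= : \pi_rfield (repr (0 : rfield)) = \pi_rfield rf0 := reprK _.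
by rewrite mulr1 mul0r subr0.
Qed.
HB.instance Definition _ := GRing.ComNzRing_isField.Build rfield rq_mulV rq_inv0.

Definition to_rfield (x : R) : rfield := \pi_rfield (rf_mk x unz1).

Lemma to_rfield_zmod : zmod_morphism to_rfield.
Proof.
move=> x y; rewrite -[RHS]/(rq_add _ (rq_opp _)) rq_oppE rq_addE; rqz.
Qed.
Lemma to_rfield_monoid : monoid_morphism to_rfield.
Proof.
by split=> // x y; rewrite -[RHS]/(rq_mul _ _) rq_mulE; rqz.
Qed.
HB.instance Definition _ := GRing.isZmodMorphism.Build R rfield to_rfield to_rfield_zmod.
HB.instance Definition _ := GRing.isMonoidMorphism.Build R rfield to_rfield to_rfield_monoid.

Lemma to_rfield_eq0 x : to_rfield x = 0 <-> I x.
Proof.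
split=> [/rq_eqP /=|Ix]; first by rewrite mul0r subr0 mulr1.
by apply/rq_eqP => /=; rewrite mul0r subr0 mulr1.
Qed.

Lemma rfieldW (f : rfield) : exists x y, ~ I y /\ f = to_rfield x / to_rfield y.
Proof.
elim/quotW: f => f; have /asboolP nf := rpairP f; exists f.1, f.2; split=> //.
have n0 : to_rfield f.2 != 0 by apply/eqP => /to_rfield_eq0.
apply: (mulIf n0); rewrite divfK // -[LHS]/(rq_mul _ _) rq_mulE; rqz.
Qed.
End ResidueField.

Definition ring_derivation (R : nzRingType) (d : R -> R) :=
  (forall x y, d (x + y) = d x + d y) /\ (forall x y, d (x * y) = d x * y + x * d y).

Section FractionDerivation.
Variables (R : comNzRingType) (F : fieldType) (h : {rmorphism R -> F}).
Variables (n : nat) (d : 'I_n -> R -> R).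
Hypotheses (dD : forall i, ring_derivation (d i))
  (hC : forall i j x, h (d i (d j x)) = h (d j (d i x)))
  (hd : forall i x, h x = 0 -> h (d i x) = 0)
  (hW : forall f, exists x y, h y != 0 /\ f = h x / h y).

Let d0 i : d i 0 = 0.
Proof. by have [dd _] := dD i; apply: (addIr (d i 0)); rewrite -dd !add0r. Qed.

Let d1 i : d i 1 = 0.
Proof.
have [_ dm] := dD i; have := dm 1 1; rewrite !mulr1 mul1r.
by move/(congr1 (fun z => z - d i 1)); rewrite addrK subrr.
Qed.

Let hd_eq i x y : h x = h y -> h (d i x) = h (d i y).
Proof.
have [dd dm] := dD i.
have dB u v : d i (u - v) = d i u - d i v by apply: (addIr (d i v)); rewrite -dd !subrK.
move/eqP; rewrite -subr_eq0 -rmorphB => /eqP /(hd i).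
by rewrite dB rmorphB => /eqP; rewrite subr_eq0 => /eqP.
Qed.

(** The quotient rule on a chosen fraction; [fder_frac] removes the choice. In [hC] the derivations
    commute only after [h], because lifts to a polynomial ring of derivations of a quotient commute
    only modulo the kernel. *)
Definition fder i (f : F) : F :=
  let: exist x P := cid (hW f) in let: exist y _ := cid P in
  (h (d i x) * h y - h x * h (d i y)) / (h y) ^+ 2.

Lemma fder_frac i x y : h y != 0 ->
  fder i (h x / h y) = (h (d i x) * h y - h x * h (d i y)) / (h y) ^+ 2.
Proof.
move=> y0; rewrite /fder; case: (cid _) => x' P; case: (cid P) => y' [y'0 e].
have [dd dm] := dD i.
have e1 : h (x * y') = h (x' * y).
  rewrite !rmorphM; have -> : h x = h x' / h y' * h y by rewrite -e divfK.
  by field.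
have := hd_eq i e1; rewrite !dm !(rmorphD, rmorphM) => e2.
have -> : h (d i x) = (h (d i x') * h y + h x' * h (d i y) - h x * h (d i y')) / h y'.
  by rewrite -e2; field.
have -> : h x = h x' * h y / h y'.
  by move: e1; rewrite !rmorphM => <-; rewrite mulfK.
by field; rewrite y0 y'0.
Qed.

Lemma fder_to i x : fder i (h x) = h (d i x).
Proof.
have := @fder_frac i x 1; rewrite rmorph1 divr1 oner_eq0 => -> //.
by rewrite d1 rmorph0 mulr0 subr0 mulr1 expr1n divr1.
Qed.

Let addE x y x' y' : h y != 0 -> h y' != 0 ->
  h x / h y + h x' / h y' = h (x * y' + x' * y) / h (y * y').
Proof. by move=> ny ny'; rewrite !(rmorphD, rmorphM); field; rewrite ny ny'. Qed.

Let mulE x y x' y' : h y != 0 -> h y' != 0 ->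
  (h x / h y) * (h x' / h y') = h (x * x') / h (y * y').
Proof. by move=> ny ny'; rewrite !(rmorphD, rmorphM); field; rewrite ny ny'. Qed.

Let hM x y : h x != 0 -> h y != 0 -> h (x * y) != 0.
Proof. by move=> nx ny; rewrite rmorphM mulf_neq0. Qed.

Lemma fder_derivation i : is_derivation (fder i).
Proof.
have [dd dm] := dD i; split=> f g.
  have [x [y [ny ->]]] := hW f; have [x' [y' [ny' ->]]] := hW g.
  rewrite addE // !fder_frac //; last exact: hM.
  by rewrite !(dd, dm, rmorphD, rmorphM); field; rewrite ny ny'.
have [x [y [ny ->]]] := hW f; have [x' [y' [ny' ->]]] := hW g.
rewrite mulE // !fder_frac //; last exact: hM.
by rewrite !(dd, dm, rmorphD, rmorphM); field; rewrite ny ny'.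
Qed.

Lemma fder_comm i j f : fder i (fder j f) = fder j (fder i f).
Proof.
have [x [y [ny ->]]] := hW f; rewrite !fder_frac //.
have [dd dm] := dD i; have [dd' dm'] := dD j.
have e k : (h (d k x) * h y - h x * h (d k y)) / h y ^+ 2 = h (d k x * y + - 1 * (x * d k y)) / h (y * y).
  by rewrite !(rmorphD, rmorphM, rmorphN, rmorph1); congr (_ / _); ring.
have d1N k : h (d k (- 1)) = 0.
  have [ddk _] := dD k; have : d k (-1 + 1) = 0 by rewrite addNr d0.
  by rewrite ddk d1 addr0 => ->; rewrite rmorph0.
have n2 := hM ny ny.
rewrite !e !fder_frac // !(dd, dm, dd', dm', rmorphD, rmorphM, d1N, rmorphN, rmorph1).
by rewrite (hC j i x) (hC j i y); field.
Qed.

Definition fraction_D : DField n := {| df_car := F; der := fder;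
  der_is_derivation := fder_derivation; der_comm := fder_comm |}.
End FractionDerivation.

(* A differential ideal maximal among those containing no power of [t] is prime. *)
Lemma dfield_avoiding (R : comNzRingType) n (d : 'I_n -> R -> R) (t : R) :
  (forall i, ring_derivation (d i)) ->
  (forall i j x, d i (d j x) = d j (d i x)) ->
  (forall k, exists c : R, c * k.+1%:R = 1) ->
  (forall N, t ^+ N != 0) ->
  exists (F : DField n) (h : {rmorphism R -> F}),
    (forall i x, h (d i x) = der F i (h x)) /\ h t != 0.
Proof.
move=> dD dC invn tN.
pose P (A : set R) := [/\ forall x y, A x -> A y -> A (x + y), forall r x, A x -> A (r * x),
  forall i x, A x -> A (d i x) & forall N, ~ A (t ^+ N)].
have [|I [[ID IM Id It] Imax]] := @Zorn_bigcup R P.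
  move=> F FP tot; split.
  - move=> x y [A FA Ax] [B FB By]; have [AB|BA] := tot A B FA FB.
      by exists B => //; have [h _ _ _] := FP B FB; apply: h => //; exact: AB.
    by exists A => //; have [h _ _ _] := FP A FA; apply: h => //; exact: BA.
  - by move=> r x [A FA Ax]; exists A => //; have [_ h _ _] := FP A FA; exact: h.
  - by move=> i x [A FA Ax]; exists A => //; have [_ _ h _] := FP A FA; exact: h.
  - by move=> N [A FA Ax]; have [_ _ _ h] := FP A FA; exact: h Ax.
have d0 i : d i 0 = 0.
  by have [dd _] := dD i; apply: (addIr (d i 0)); rewrite -dd !add0r.
have d1 i : d i 1 = 0.
  have [_ dm] := dD i; have := dm 1 1; rewrite !mulr1 mul1r.
  by move/(congr1 (fun z => z - d i 1)); rewrite addrK subrr.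
have {}Imax J : P J -> (forall x, I x -> J x) -> forall x, J x -> I x.
  move=> PJ IJ x Jx; apply: contrapT => nIx; apply: (Imax J) => //; split=> //.
  by move=> h; apply/nIx/h.
(* The predicate [P] does not ask for 0, so that the union of the empty chain satisfies it. A
   maximal [I] without 0 would be empty and could be enlarged to the zero ideal. *)
have I0 : I 0.
  apply: contrapT => n0; have e x : ~ I x by move=> /(IM 0); rewrite mul0r.
  apply: n0; apply: (Imax (fun x => x = 0)) => //; last by move=> x /e.
  split=> [x y -> ->|r x ->|i x ->|N /eqP]; rewrite ?addr0 ?mulr0 //.
  by rewrite (negPf (tN N)).
have dX i x k : d i (x ^+ k.+1) = k.+1%:R * (x ^+ k * d i x).
  have [_ dm] := dD i; elim: k => [|k IH]; first by rewrite expr0 expr1 !mul1r.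
  by rewrite exprS dm IH -[k.+2%:R]natr1 exprS; ring.
have Inat k x : I (k.+1%:R * x) -> I x.
  by have [c e] := invn k => /(IM c); rewrite mulrA e mul1r.
(* The radical of [I] is again a differential ideal avoiding the powers of [t], so maximality makes
   [I] radical. *)
have Irad N x : I (x ^+ N) -> I x.
  move=> Ix; apply: (Imax (fun x => exists N, I (x ^+ N))); last by exists N.
    split.
    - move=> u v [a Ia] [b Ib]; exists (a + b)%N; rewrite exprDn.
      elim/big_ind: _ => // i _; rewrite -mulr_natl; apply: (IM).
      have [le|lt] := leqP b i.
        by rewrite -(subnK le) [v ^+ _]exprD mulrA; exact: (IM).
      have -> : (a + b - i = (b - i) + a)%N by lia.
      by rewrite exprD -mulrA [u ^+ a * _]mulrC mulrA; exact: (IM).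
    - by move=> r u [a Ia]; exists a; rewrite exprMn; exact: (IM).
    - move=> i u [a Ia]; exists (a + a)%N.
      (* Differentiating and multiplying by [d i u] trades one factor [u] for two factors [d i u];
         the integer that appears is cancelled by [Inat]. *)
      suff h k : (k <= a)%N -> I (u ^+ (a - k) * d i u ^+ (k + k)).
        by have := h a (leqnn a); rewrite subnn expr0 mul1r.
      elim: k => [|k IH] ka; first by rewrite subn0 mulr1.
      have {IH} := IH (ltnW ka).
      have -> : (a - k = (a - k.+1).+1)%N by lia.
      set m := (a - k.+1)%N => Iw; have := IM (d i u) _ (Id i _ Iw).
      have [_ dm] := dD i; rewrite dm dX.
      case: k {ka} @m Iw => [|k] m Iw.
        rewrite addn0 expr0 d1 mulr0 addr0 mulr1 => h; apply: (Inat m); move: h.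
        by congr (I _); rewrite (_ : (1 + 1 = 2)%N) //; ring.
      have -> : (k.+1 + k.+1 = (k + k).+2)%N by lia.
      rewrite dX => h; apply: (Inat m).
      have := ID _ _ h (IM (- (k + k).+2%:R * d i (d i u)) _ Iw); congr (I _).
      have -> : (k.+2 + k.+2 = (k + k).+4)%N by lia.
      have -> : (k.+1 + k.+1 = (k + k).+2)%N by lia.
      by rewrite !exprS; ring.
    - by move=> M [a]; rewrite -exprM; exact: It.
  by move=> u Iu; exists 1%N.
(* The square of [x * d i y] is a combination of [x * y] and its derivative. Thus ideal quotients of
   [I] are differential. *)
have Iprod i x y : I (x * y) -> I (x * d i y).
  move=> Ixy; apply: (Irad 2); have [_ dm] := dD i.
  have := ID _ _ (IM (x * d i y) _ (Id i _ Ixy)) (IM (- (d i x * d i y)) _ Ixy).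
  by congr (I _); rewrite dm expr2; ring.
have Icolon x : P (fun y => I (x * y)) \/ exists N, I (x * t ^+ N).
  have [h|h] := pselect (exists N, I (x * t ^+ N)); [by right|left]; split.
  - by move=> u v Iu Iv; rewrite mulrDr; exact: ID.
  - by move=> r u Iu; rewrite mulrCA; exact: IM.
  - by move=> i u; exact: Iprod.
  - by move=> N hN; apply: h; exists N.
(* If the quotient of [I] by [x] avoids the powers of [t], it equals [I] by maximality and contains
   [y]. Otherwise [x] lies in the quotient by some [t ^+ N], which does avoid them. *)
have Iprime x y : I (x * y) -> I x \/ I y.
  move=> Ixy; have [Px|[N IN]] := Icolon x.
    by right; apply: (Imax _ Px) => // u; exact: IM.
  left; have [PN|[M]] := Icolon (t ^+ N); last by rewrite -exprD => /It.
  by apply: (Imax _ PN) => [u|]; [exact: IM|rewrite mulrC].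
pose pI := PrimeIdeal I0 ID IM (It 0%N) Iprime.
pose h : {rmorphism R -> rfield pI} := @to_rfield R pI.
have hd i x : h x = 0 -> h (d i x) = 0 by move/to_rfield_eq0/Id => ?; apply/to_rfield_eq0.
have hW f : exists x y, h y != 0 /\ f = h x / h y.
  have [x [y [ny ->]]] := rfieldW f; exists x, y; split=> //.
  by apply/eqP => /to_rfield_eq0.
have hC i j x : h (d i (d j x)) = h (d j (d i x)) by rewrite dC.
exists (fraction_D dD hC hd hW), h; split; first by move=> i x; apply: esym; exact: (fder_to dD hd hW).
by apply/eqP => /to_rfield_eq0; rewrite -[t]expr1; exact: It.
Qed.

(** * The tensor square of a differential field *)

Local Open Scope quotient_scope.

Section Functional.
Variables (k K : fieldType) (phi : {rmorphism k -> K}).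

Definition klinear (f : K -> K) :=
  (forall x y, f (x + y) = f x + f y) /\ (forall a x, f (phi a * x) = phi a * f x).

(** A subspace maximal among those that absorb [phi k] and avoid [v] is a complement of the line
    through [v]; [f] is the coordinate along [v]. *)
Lemma functional_ex (v : K) : (forall a, phi a != v) ->
  exists f : K -> k, [/\ klinear (phi \o f), f 1 = 0 & f v = 1].
Proof.
move=> nv.
pose P (A : set K) := [/\ forall x y, A x -> A y -> A (x + y), forall a x, A x -> A (phi a * x),
  forall x a, A x -> A (x + phi a) & ~ A v].
have [|A [[AD AZ A1 Av] Amax]] := @Zorn_bigcup K P.
  move=> F FP tot; split.
  - move=> x y [A FA Ax] [B FB By]; have [AB|BA] := tot A B FA FB.
      by exists B => //; have [h _ _ _] := FP B FB; apply: h => //; exact: AB.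
    by exists A => //; have [h _ _ _] := FP A FA; apply: h => //; exact: BA.
  - by move=> r x [A FA Ax]; exists A => //; have [_ h _ _] := FP A FA; exact: h.
  - by move=> x a [A FA Ax]; exists A => //; have [_ _ h _] := FP A FA; exact: h.
  - by move=> [A FA Ax]; have [_ _ _ h] := FP A FA; exact: h Ax.
have {}Amax J : P J -> (forall x, A x -> J x) -> forall x, J x -> A x.
  move=> PJ AJ x Jx; apply: contrapT => nAx; apply: (Amax J) => //; split=> //.
  by move=> h; apply/nAx/h.
have A0 : A 0.
  apply: contrapT => n0; have e x : ~ A x by move=> /(AZ 0); rewrite rmorph0 mul0r.
  apply: n0; apply: (Amax (fun x => exists a, phi a = x)); last by exists 0; rewrite rmorph0.
    split=> [x y [a <-] [b <-]|a x [b <-]|x a [b <-]|[a av]].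
    - by exists (a + b); rewrite rmorphD.
    - by exists (a * b); rewrite rmorphM.
    - by exists (b + a); rewrite rmorphD.
    - by have := nv a; rewrite av eqxx.
  by move=> x /e.
have AN x : A x -> A (- x) by move=> /(AZ (-1)); rewrite rmorphN1 mulN1r.
have /choice[f fP] : forall y, exists c, A (y - phi c * v).
  move=> y; have [Ay|nAy] := pselect (A y); first by exists 0; rewrite rmorph0 mul0r subr0.
  pose B z := exists a c, A a /\ z = a + phi c * y.
  have [a [c [Aa e]]] : B v.
    apply: contrapT => nB; apply: nAy; apply: (Amax B); last first.
    - by exists 0, 1; rewrite rmorph1 mul1r add0r.
    - by move=> x Ax; exists x, 0; rewrite rmorph0 mul0r addr0.
    split=> // [_ _ [a [c [Aa ->]]] [b [c' [Ab ->]]]|b _ [a [c [Aa ->]]]|_ b [a [c [Aa ->]]]].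
    - by exists (a + b), (c + c'); split; [exact: AD|rewrite rmorphD; ring].
    - by exists (phi b * a), (b * c); split; [exact: AZ|rewrite rmorphM; ring].
    - by exists (a + phi b), c; split; [exact: A1|ring].
  have c0 : c != 0 by apply/eqP => c0; apply: Av; rewrite e c0 rmorph0 mul0r addr0.
  exists c^-1; have := AZ c^-1 _ (AN _ Aa); congr (A _); rewrite e fmorphV.
  by field; rewrite fmorph_eq0.
have funiq y c : A (y - phi c * v) -> f y = c.
  move=> Ac; apply/eqP; rewrite -subr_eq0; apply: contrapT => /negP ne; apply: Av.
  have := AZ (f y - c)^-1 _ (AD _ _ Ac (AN _ (fP y))); congr (A _).
  by rewrite fmorphV rmorphB; field; rewrite -rmorphB fmorph_eq0.
exists f; split; first split=> [x y|a x] /=.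
- rewrite -rmorphD; congr (phi _); apply: funiq.
  by have := AD _ _ (fP x) (fP y); congr (A _); rewrite rmorphD; ring.
- rewrite -rmorphM; congr (phi _); apply: funiq.
  by have := AZ a _ (fP x); congr (A _); rewrite rmorphM; ring.
- by apply: funiq; rewrite rmorph0 mul0r subr0 -[1]add0r -(rmorph1 phi); exact: A1.
- by apply: funiq; rewrite rmorph1 mul1r subrr.
Qed.
End Functional.

(* The ring [K (x)_k K]: a formal sum of tensors vanishes when every k-linear map
   applied to the right factors kills it. *)
Section Tensor.
Variables (k K : fieldType) (phi : {rmorphism k -> K}).
Notation lin := (klinear phi).

Definition tval (f : K -> K) (l : seq (K * K)) := \sum_(p <- l) p.1 * f p.2.

Definition teq (l l' : seq (K * K)) : bool :=
  `[< forall f, lin f -> tval f l = tval f l' >].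

Lemma teq_refl : reflexive teq. Proof. by move=> l; apply/asboolP. Qed.
Lemma teq_sym : symmetric teq.
Proof.
by move=> l m; apply/asboolP/asboolP => h f lf; rewrite h.
Qed.
Lemma teq_trans : transitive teq.
Proof.
by move=> m l p /asboolP h1 /asboolP h2; apply/asboolP => f lf; rewrite h1 ?h2.
Qed.
Canonical teq_equiv := EquivRel teq teq_refl teq_sym teq_trans.
Definition tensor := {eq_quot teq}.
HB.instance Definition _ : EqQuotient _ teq tensor := EqQuotient.on tensor.
HB.instance Definition _ := Choice.on tensor.

Lemma teqP (l m : seq (K * K)) :
  \pi_tensor l = \pi_tensor m <-> forall f, lin f -> tval f l = tval f m.
Proof. by split=> [/eqmodP/asboolP|h] //; apply/eqmodP/asboolP. Qed.

Lemma tval_repr l f : lin f -> tval f (repr (\pi_tensor l)) = tval f l.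
Proof. by move=> lf; have /teqP/(_ f lf) := reprK (\pi_tensor l). Qed.

Definition tmul (l m : seq (K * K)) := [seq (p.1 * q.1, p.2 * q.2) | p <- l, q <- m].
Definition topp (l : seq (K * K)) := [seq (- p.1, p.2) | p <- l].

Lemma tval_cat f l m : tval f (l ++ m) = tval f l + tval f m.
Proof. by rewrite /tval big_cat. Qed.

Lemma tval_opp f l : tval f (topp l) = - tval f l.
Proof. by rewrite /tval big_map -sumrN; apply: eq_bigr => p _; rewrite mulNr. Qed.

Lemma tval_mul f l m : tval f (tmul l m) = \sum_(p <- l) \sum_(q <- m) p.1 * q.1 * f (p.2 * q.2).
Proof. by rewrite /tval /tmul big_allpairs_dep. Qed.

Lemma tval_mull f l m : tval f (tmul l m) = \sum_(p <- l) p.1 * tval (fun x => f (p.2 * x)) m.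
Proof.
rewrite tval_mul; apply: eq_bigr => p _; rewrite /tval mulr_sumr.
by apply: eq_bigr => q _; rewrite mulrA.
Qed.

Lemma tval_mulC f l m : tval f (tmul l m) = tval f (tmul m l).
Proof.
rewrite !tval_mul exchange_big; apply: eq_bigr => p _; apply: eq_bigr => q _.
by rewrite [q.1 * _]mulrC [q.2 * _]mulrC.
Qed.

Lemma lin_mul f a : lin f -> lin (fun x => f (a * x)).
Proof. by case=> fD fZ; split=> [x y|c x]; rewrite ?mulrDr ?fD // mulrCA fZ. Qed.

Definition tq0 : tensor := \pi_tensor [::].
Definition tq1 : tensor := \pi_tensor [:: (1, 1)].
Definition tq_add (l m : tensor) : tensor := \pi_tensor (repr l ++ repr m).
Definition tq_opp (l : tensor) : tensor := \pi_tensor (topp (repr l)).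
Definition tq_mul (l m : tensor) : tensor := \pi_tensor (tmul (repr l) (repr m)).

Lemma tq_addE l m : tq_add (\pi_tensor l) (\pi_tensor m) = \pi_tensor (l ++ m).
Proof. by apply/teqP => f lf; rewrite !tval_cat !tval_repr. Qed.
Lemma tq_oppE l : tq_opp (\pi_tensor l) = \pi_tensor (topp l).
Proof. by apply/teqP => f lf; rewrite !tval_opp !tval_repr. Qed.
(** One factor is changed at a time: a k-linear [f] preceded by a multiplication is still k-linear,
    so it detects equality of the factor that changes. *)
Lemma tq_mulE l m : tq_mul (\pi_tensor l) (\pi_tensor m) = \pi_tensor (tmul l m).
Proof.
apply/teqP => f lf; transitivity (tval f (tmul (repr (\pi_tensor l)) m)).
  by rewrite !tval_mull; apply: eq_bigr => p _; rewrite tval_repr //; exact: lin_mul.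
rewrite !(tval_mulC _ _ m) !tval_mull.
by apply: eq_bigr => p _; rewrite tval_repr //; exact: lin_mul.
Qed.

Lemma tq_addA : associative tq_add.
Proof.
elim/quotW=> l; elim/quotW=> m; elim/quotW=> p.
by rewrite (tq_addE m p) (tq_addE l m) !tq_addE catA.
Qed.
Lemma tq_addC : commutative tq_add.
Proof.
elim/quotW=> l; elim/quotW=> m; rewrite !tq_addE; apply/teqP => f _.
by rewrite !tval_cat addrC.
Qed.
Lemma tq_add0 : left_id tq0 tq_add.
Proof. by elim/quotW=> l; rewrite !tq_addE. Qed.
Lemma tq_addN : left_inverse tq0 tq_opp tq_add.
Proof.
elim/quotW=> l; rewrite tq_oppE tq_addE; apply/teqP => f _.
by rewrite tval_cat tval_opp addNr /tval big_nil.
Qed.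
HB.instance Definition _ := GRing.isZmodule.Build tensor tq_addA tq_addC tq_add0 tq_addN.

Lemma tq_mulA : associative tq_mul.
Proof.
elim/quotW=> l; elim/quotW=> m; elim/quotW=> p.
rewrite (tq_mulE m p) (tq_mulE l m) !tq_mulE; apply/teqP => f _.
rewrite tval_mull [RHS]tval_mulC [RHS]tval_mull.
under eq_bigr => x _ do rewrite tval_mul mulr_sumr.
under [RHS]eq_bigr => x _ do rewrite tval_mul mulr_sumr.
rewrite [RHS]exchange_big.
under [LHS]eq_bigr => x _.
  under eq_bigr => y _ do rewrite mulr_sumr.
  over.
rewrite /=.
under [RHS]eq_bigr => x _.
  under eq_bigr => y _ do rewrite mulr_sumr.
  rewrite exchange_big. over.
rewrite /=; apply: eq_bigr => x _; apply: eq_bigr => y _; apply: eq_bigr => z _.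
by rewrite !mulrA; congr (_ * f _); ring.
Qed.
Lemma tq_mulC : commutative tq_mul.
Proof.
elim/quotW=> l; elim/quotW=> m; rewrite !tq_mulE; apply/teqP => f _.
exact: tval_mulC.
Qed.
Lemma tq_mul1 : left_id tq1 tq_mul.
Proof.
elim/quotW=> l; rewrite tq_mulE; apply/teqP => f _.
by rewrite tval_mull big_seq1 mul1r; apply: eq_bigr => x _; rewrite mul1r.
Qed.
Lemma tq_mulD : left_distributive tq_mul tq_add.
Proof.
elim/quotW=> l; elim/quotW=> m; elim/quotW=> p.
rewrite (tq_addE l m) (tq_mulE l p) (tq_mulE m p) tq_mulE tq_addE; apply/teqP => f _.
by rewrite tval_cat !tval_mull big_cat.
Qed.

Lemma lin_id : lin id. Proof. by []. Qed.

Lemma tq_1_neq0 : tq1 != 0.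
Proof.
apply/eqP => /teqP/(_ id lin_id); rewrite /tval big_seq1 big_nil mulr1.
by move/eqP; rewrite oner_eq0.
Qed.
HB.instance Definition _ :=
  GRing.Zmodule_isComNzRing.Build tensor tq_mulA tq_mulC tq_mul1 tq_mulD tq_1_neq0.

Definition tl (a : K) : tensor := \pi_tensor [:: (a, 1)].
Definition tr (a : K) : tensor := \pi_tensor [:: (1, a)].

Lemma lin0 f : lin f -> f 0 = 0.
Proof. by case=> fD _; apply: (addIr (f 0)); rewrite -fD !add0r. Qed.

Lemma linN f x : lin f -> f (- x) = - f x.
Proof.
by move=> lf; case: (lf) => fD _; apply/eqP; rewrite -addr_eq0 -fD addNr lin0.
Qed.

Lemma tl_zmod : zmod_morphism tl.
Proof.
move=> x y; rewrite -[RHS]/(tq_add _ (tq_opp _)) tq_oppE tq_addE; apply/teqP => f _.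
by rewrite /tval !big_cons !big_nil /=; ring.
Qed.
Lemma tl_monoid : monoid_morphism tl.
Proof.
split=> // x y; rewrite -[RHS]/(tq_mul _ _) tq_mulE; apply/teqP => f _.
by rewrite /tval !big_cons !big_nil /= mulr1.
Qed.
HB.instance Definition _ := GRing.isZmodMorphism.Build K tensor tl tl_zmod.
HB.instance Definition _ := GRing.isMonoidMorphism.Build K tensor tl tl_monoid.

Lemma tr_zmod : zmod_morphism tr.
Proof.
move=> x y; rewrite -[RHS]/(tq_add _ (tq_opp _)) tq_oppE tq_addE; apply/teqP => f lf.
by rewrite /tval !big_cons !big_nil /=; case: (lf) => -> _; rewrite linN //; ring.
Qed.
Lemma tr_monoid : monoid_morphism tr.
Proof.
split=> // x y; rewrite -[RHS]/(tq_mul _ _) tq_mulE; apply/teqP => f _.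
by rewrite /tval !big_cons !big_nil /= mulr1.
Qed.
HB.instance Definition _ := GRing.isZmodMorphism.Build K tensor tr tr_zmod.
HB.instance Definition _ := GRing.isMonoidMorphism.Build K tensor tr tr_monoid.

Lemma tl_tr a : tl (phi a) = tr (phi a).
Proof.
apply/teqP => f [_ fZ]; rewrite /tval !big_seq1 /=.
by rewrite -fZ mulr1 mul1r.
Qed.

Definition teval (f : K -> K) (u : tensor) := tval f (repr u).

Lemma tevalD f u v : lin f -> teval f (u + v) = teval f u + teval f v.
Proof.
move=> lf; rewrite /teval -[u]reprK -[v]reprK -[_ + _]/(tq_add _ _) tq_addE.
by rewrite !tval_repr // tval_cat.
Qed.

Lemma teval_lr f a b : lin f -> teval f (tl a * tr b) = a * f b.
Proof.
move=> lf; rewrite /teval -[_ * _]/(tq_mul _ _) tq_mulE tval_repr //.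
by rewrite /tval big_seq1 /= mul1r mulr1.
Qed.

Lemma teval_sum f I (r : seq I) (F : I -> tensor) : lin f ->
  teval f (\sum_(i <- r) F i) = \sum_(i <- r) teval f (F i).
Proof.
move=> lf; apply: (big_morph (teval f)) => [u v|]; first exact: tevalD.
by rewrite /teval tval_repr // /tval big_nil.
Qed.

Hypothesis ch0 : [pchar k] =i pred0.

Let natK m : (m.+1%:R : K) != 0.
Proof. by rewrite -(rmorph_nat phi) fmorph_eq0; move/pcharf0P: ch0 => ->. Qed.

Variable x : K.
Hypothesis nx : forall a, phi a != x.

Let s := tl x - tr x.

(** Apply to the binomial expansion a functional with [f 1 = 0] and [f x = 1]. The result is a
    polynomial relation for [x] whose coefficient in degree N-1 is -N, nonzero in characteristic
    zero. *)
Let algebraic_of_nilpotent N : (0 < N)%N -> s ^+ N = 0 ->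
  exists q : {poly k}, q != 0 /\ root (map_poly phi q) x.
Proof.
case: N => // N _ sN; have [f [lf f1 fx]] := functional_ex nx.
pose c (i : nat) := (-1) ^+ i * f (x ^+ i) *+ 'C(N.+1, i) : k.
exists (\sum_(i < N.+2) (c i)%:P * 'X^(N.+1 - i)); split.
  apply/eqP => /polyP/(_ N); rewrite coef_sum coef0.
  rewrite (bigD1 (Ordinal (isT : (1 < N.+2)%N))) //= big1 => [|i ni].
    rewrite addr0 coefCM subSS subn0 coefXn eqxx mulr1 /c !expr1 fx mulr1 bin1.
    have := natK N; rewrite -(rmorph_nat phi) fmorph_eq0 => /eqP n0 /eqP.
    by rewrite mulNrn oppr_eq0 => /eqP.
  rewrite coefCM coefXn; case: eqP => [e|]; last by rewrite mulr0.
  case/eqP: ni; apply: val_inj => /=; have := ltn_ord i; lia.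
have : teval (phi \o f) (s ^+ N.+1) = 0 by rewrite sN /teval tval_repr // /tval big_nil.
rewrite exprBn teval_sum // => e; rewrite rootE rmorph_sum horner_sum -[X in _ == X]e.
apply/eqP; apply: eq_bigr => i _.
rewrite rmorphM /= map_polyC map_polyXn hornerM hornerC hornerXn /c.
have -> : ((-1) ^+ i * tl x ^+ (N.+1 - i) * tr x ^+ i) *+ 'C(N.+1, i) =
    tl ((-1) ^+ i * x ^+ (N.+1 - i) *+ 'C(N.+1, i)) * tr (x ^+ i).
  by rewrite rmorphMn rmorphM !rmorphXn rmorphN1 mulrnAl.
rewrite teval_lr // /= rmorphMn rmorphM rmorphXn rmorphN1 /=.
by rewrite !mulrnAl; congr (_ *+ _); ring.
Qed.

(** Otherwise [x] is algebraic with a separable minimal polynomial (X - x) r, r(x) nonzero.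
    Evaluation at 1 (x) x shows that s kills r(x) (x) 1 - s w for some w. Multiplying by a power of
    s lowers the nilpotency index, which is at least 2 since s is nonzero. *)
Lemma tensor_diff_not_nilpotent N : s ^+ N != 0.
Proof.
apply/eqP => sN0.
have [M sM min] := @least_nat (fun N => s ^+ N = 0) (ex_intro _ _ sN0).
have M0 : (0 < M)%N.
  by case: M sM {min} => // /eqP; rewrite expr0 oner_eq0.
have [q0 [q00 rq0]] := algebraic_of_nilpotent M0 sM.
have [m [q [qn0 rq sq]] qmin] := @least_nat (fun m => exists q : {poly k},
  [/\ q != 0, root (map_poly phi q) x & size q = m])
  (ex_intro _ _ (ex_intro _ q0 (And3 q00 rq0 erefl))).
have q'x : (map_poly phi q)^`().[x] != 0.
  apply/eqP; rewrite deriv_map => /eqP rq'.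
  have sq2 : (1 < size q)%N.
    rewrite ltnNge; apply/negP => /size1_polyC; move: (q`_0) => c e.
    move: qn0 rq; rewrite e polyC_eq0 map_polyC rootC fmorph_eq0.
    by move/negPf->.
  have q'0 : q^`() = 0.
    apply: contrapT => /eqP n0.
    have := qmin _ (ex_intro _ _ (And3 n0 rq' erefl)); rewrite -sq leqNgt.
    by rewrite lt_size_deriv // -size_poly_gt0 ltnW.
  have /polyP/(_ (size q).-2) := q'0; rewrite coef0 coef_deriv.
  have -> : (size q).-2.+1 = (size q).-1 by lia.
  move/eqP; rewrite -mulr_natr mulf_eq0 -lead_coefE lead_coef_eq0 (negPf qn0) /=.
  by have := natK (size q).-2; rewrite -(rmorph_nat phi) fmorph_eq0 => /negPf; rewrite (_ : (size q).-2.+1 = (size q).-1) // => [->|]; lia.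
have [r er] := factor_theorem _ _ rq.
have rx : r.[x] != 0.
  move: q'x; rewrite er derivM derivXsubC !hornerE subrr mulr0 add0r.
  by [].
have sr : s * (map_poly tl r).[tr x] = 0.
  have : (map_poly tl (map_poly phi q)).[tr x] = 0.
    have -> : map_poly tl (map_poly phi q) = map_poly tr (map_poly phi q).
      by apply/polyP => i; rewrite !coef_map; exact: tl_tr.
    by rewrite horner_map; move/eqP: rq => ->; rewrite rmorph0.
  rewrite er rmorphM /= map_polyXsubC hornerM hornerXsubC => e.
  by apply/eqP; rewrite -oppr_eq0 -mulNr opprB mulrC e.
have [w ew] : exists w, (map_poly tl r).[tr x] = tl r.[x] - s * w.
  have : root (map_poly tl r - (tl r.[x])%:P) (tl x).
    by rewrite rootE hornerD hornerN hornerC horner_map subrr.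
  case/factor_theorem => w e; exists w.[tr x].
  have -> : map_poly tl r = w * ('X - (tl x)%:P) + (tl r.[x])%:P by rewrite -e subrK.
  by rewrite hornerD hornerM hornerXsubC hornerC /s; ring.
have M1 : (0 < M.-1)%N.
  rewrite lt0n; apply/eqP => M1; have {M1}M1 : M = 1%N by lia.
  move: sM; rewrite M1 expr1 => s0; have [f [lf f1 fx]] := functional_ex nx.
  have : teval (phi \o f) s = 0 by rewrite s0 /teval tval_repr // /tval big_nil.
  rewrite /s -[tl x]mulr1 -(rmorph1 tr) -[- tr x]mul1r -mulN1r mul1r -(rmorphN1 tl).
  rewrite tevalD // !teval_lr //= f1 fx rmorph0 rmorph1 mulr0 add0r mulr1.
  by move/eqP; rewrite oppr_eq0 oner_eq0.
have : s ^+ M.-1 = 0.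
  have e : s ^+ M.-2 * (s * (tl r.[x] - s * w)) = 0 by rewrite -ew sr mulr0.
  have sM2 : s ^+ M.-2 * s * s = 0.
    by rewrite -!exprSr (_ : M.-2.+2 = M) //; lia.
  have : s ^+ M.-1 * tl r.[x] = 0.
    rewrite (_ : M.-1 = M.-2.+1) ?exprSr; last by lia.
    have -> : s ^+ M.-2 * s * tl r.[x] = s ^+ M.-2 * (s * (tl r.[x] - s * w)) + s ^+ M.-2 * s * s * w by ring.
    by rewrite e sM2 mul0r addr0.
  move/(congr1 (fun z => z * tl r.[x]^-1)); rewrite mul0r -mulrA -rmorphM divff //.
  by rewrite rmorph1 mulr1.
by move/min; lia.
Qed.
End Tensor.

Local Open Scope quotient_scope.

Section TensorDer.
Variables (n : nat) (k K : DField n) (phi : {rmorphism k -> K}).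
Hypothesis dphi : dmorph phi.
Notation lin := (klinear phi).
Notation T := (tensor phi).

Definition tdl i (l : seq (K * K)) :=
  [seq (der K i p.1, p.2) | p <- l] ++ [seq (p.1, der K i p.2) | p <- l].

Definition tder i (u : T) : T := \pi_(tensor phi) (tdl i (repr u)).

Let comm i (f : K -> K) x := der K i (f x) - f (der K i x).

(** Because [phi] commutes with derivations, the commutator of a derivation with a k-linear map is
    k-linear. This is what makes [tder] independent of representatives. *)
Let lin_comm i f : lin f -> lin (comm i f).
Proof.
move=> [fD fZ]; split=> [x y|a x]; rewrite /comm.
  by rewrite fD !raddfD fD /=; ring.
by rewrite fZ !derM fD -(dphi i a) !fZ; ring.
Qed.

Lemma tval_tdl i f l : tval f (tdl i l) = \sum_(p <- l) (der K i p.1 * f p.2 + p.1 * f (der K i p.2)).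
Proof. by rewrite tval_cat /tval !big_map big_split. Qed.

Lemma tval_tdl_comm i f l : tval f (tdl i l) = der K i (tval f l) - tval (comm i f) l.
Proof.
rewrite tval_tdl /tval raddf_sum -sumrB; apply: eq_bigr => p _ /=.
by rewrite derM /comm; ring.
Qed.

Lemma tderE i l : tder i (\pi_(tensor phi) l) = \pi_(tensor phi) (tdl i l).
Proof.
apply/teqP => f lf; rewrite !tval_tdl_comm !tval_repr //; exact: lin_comm.
Qed.

Lemma tder_derivation i : ring_derivation (tder i).
Proof.
split; elim/quotW=> l; elim/quotW=> m.
  rewrite -[_ + _ in LHS]/(tq_add _ _) tq_addE !tderE -[RHS]/(tq_add _ _) tq_addE.
  by apply/teqP => f lf; rewrite tval_cat !tval_tdl big_cat.
rewrite -[_ * _ in LHS]/(tq_mul _ _) tq_mulE !tderE.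
rewrite -[RHS]/(tq_add (tq_mul _ _) (tq_mul _ _)) !tq_mulE tq_addE.
apply/teqP => f lf; rewrite tval_cat !tval_mull tval_tdl /tmul big_allpairs_dep /=.
rewrite /tdl big_cat /= !big_map -!big_split; apply: eq_bigr => p _ /=.
rewrite /tval big_cat /= !big_map /= mulrDr !mulr_sumr -!big_split /=; apply: eq_bigr => q _.
have [fD _] := lf; rewrite !derM fD; ring.
Qed.

Lemma tder_comm i j u : tder i (tder j u) = tder j (tder i u).
Proof.
elim/quotW: u => l; rewrite (tderE j l) (tderE i l) !tderE; apply/teqP => f lf.
rewrite !tval_tdl /tdl !big_cat /= !big_map /= -!big_split; apply: eq_bigr => p _ /=.
by rewrite (der_comm i j p.1) (der_comm i j p.2); ring.
Qed.

Lemma tder_tl i a : tder i (tl phi a) = tl phi (der K i a).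
Proof.
rewrite tderE; apply/teqP => f lf; rewrite tval_tdl /tval !big_seq1 /= der1.
by rewrite (lin0 lf) mulr0 addr0.
Qed.

Lemma tder_tr i a : tder i (tr phi a) = tr phi (der K i a).
Proof.
rewrite tderE; apply/teqP => f lf; rewrite tval_tdl /tval !big_seq1 /= der1.
by rewrite mul0r add0r.
Qed.
End TensorDer.

Lemma two_embeddings n (k K : DField n) (phi : {rmorphism k -> K}) (x : K) :
  [pchar k] =i pred0 -> dmorph phi -> (forall a, phi a != x) ->
  exists (F : DField n) (f1 f2 : {rmorphism K -> F}),
    [/\ dmorph f1, dmorph f2, forall a, f1 (phi a) = f2 (phi a) & f1 x != f2 x].
Proof.
move=> ch0 dphi nx.
have [m|F [h [hd hs]]] := dfield_avoiding (fun i => tder_derivation dphi i)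
  (fun i j u => tder_comm dphi i j u) _ (tensor_diff_not_nilpotent ch0 nx).
  exists (tl phi m.+1%:R^-1); rewrite -(rmorph_nat (tl phi)) -rmorphM mulVf ?rmorph1 //.
  by rewrite -(rmorph_nat phi) fmorph_eq0; move/pcharf0P: ch0 => ->.
exists F, (h \o tl phi : {rmorphism K -> F}), (h \o tr phi : {rmorphism K -> F}).
split=> [i a|i a|a|] /=.
- by rewrite -(tder_tl dphi) hd.
- by rewrite -(tder_tr dphi) hd.
- by rewrite tl_tr.
- by rewrite -subr_eq0 -rmorphB.
Qed.

(** * Linear independence over constants *)

Lemma pired_comm m (F : DField m.+1) (i j : 'I_m) x :
  der F (lift ord0 i) (der F (lift ord0 j) x) = der F (lift ord0 j) (der F (lift ord0 i) x).
Proof. exact: der_comm. Qed.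

Definition pired m (F : DField m.+1) : DField m := {| df_car := F;
  der := fun i => der F (lift ord0 i);
  der_is_derivation := fun i => der_is_derivation F (lift ord0 i);
  der_comm := @pired_comm m F |}.

Section Constants.
Variables (m : nat) (C0 : DField m) (K : DField m.+1) (e : {rmorphism C0 -> K}).
Hypotheses (e0 : forall c, der K ord0 (e c) = 0)
  (eS : forall x, der K ord0 x = 0 -> exists c, e c = x)
  (eD : forall i c, e (der C0 i c) = der K (lift ord0 i) (e c)).

Definition cindep q (a : 'I_q -> K) :=
  forall c : 'I_q -> C0, \sum_i e (c i) * a i = 0 -> forall i, c i = 0.

Lemma cindep_neq0 q (a : 'I_q -> K) i : cindep a -> a i != 0.
Proof.
move=> ia; apply/eqP => ai; have := ia (fun l => (l == i)%:R).
move=> /(_ _ i); rewrite eqxx => h; suff /h/eqP : \sum_l e (l == i)%:R * a l = 0.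
  by rewrite oner_eq0.
rewrite (bigD1 i) //= ai mulr0 add0r big1 // => l /negPf->.
by rewrite rmorph0 mul0r.
Qed.

(** A relation between these derivatives makes a combination of the quotients a constant, which
    comes from [C0]; multiplying by [a ord0] gives a relation between the [a i]. *)
Lemma cindep_der q (a : 'I_q.+1 -> K) : cindep a ->
  cindep (fun i => der K ord0 (a (lift ord0 i) / a ord0)).
Proof.
move=> ia c sc; have a0 := cindep_neq0 ord0 ia.
have : der K ord0 (\sum_i e (c i) * (a (lift ord0 i) / a ord0)) = 0.
  rewrite raddf_sum -[RHS]sc; apply: eq_bigr => i _.
  by rewrite /= derM e0 mul0r add0r.
case/eS => c' ec'.
pose cc i := if unlift ord0 i is Some l then c l else - c'.
have := ia cc; rewrite big_ord_recl /cc unlift_none => h i.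
have := h _ (lift ord0 i); rewrite liftK; apply.
rewrite rmorphN ec' mulNr mulr_suml -sumrN -big_split big1 // => l _ /=.
by rewrite liftK -mulrA divfK // addNr.
Qed.

(* Divide by the first element and differentiate. *)
Lemma cindep_ext (F : DField m.+1) (f : {rmorphism K -> F}) : dmorph f ->
  forall q (a : 'I_q -> K), cindep a -> forall b : 'I_q -> F,
  (forall i, der F ord0 (b i) = 0) -> \sum_i f (a i) * b i = 0 -> forall i, b i = 0.
Proof.
move=> df; elim=> [|q IH] a ia b b0 sb; first by case.
have a0 := cindep_neq0 ord0 ia; have fa0 : f (a ord0) != 0 by rewrite fmorph_eq0.
have sb' : b ord0 + \sum_i f (a (lift ord0 i) / a ord0) * b (lift ord0 i) = 0.
  apply: (mulfI fa0); rewrite mulr0 -[RHS]sb big_ord_recl mulrDr mulr_sumr.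
  congr (_ + _); apply: eq_bigr => i _.
  by rewrite mulrA -rmorphM mulrC [a ord0 * _]mulrC divfK // mulrC.
have bl i : b (lift ord0 i) = 0.
  apply: (IH _ (cindep_der ia) (fun i => b (lift ord0 i))) => //.
  have := congr1 (der F ord0) sb'; rewrite raddf0 raddfD /= b0 add0r raddf_sum => h; rewrite -[RHS]h.
  by apply: eq_bigr => l _; rewrite /= [RHS]derM b0 mulr0 addr0 df.
move=> i; case: (unliftP ord0 i) => [l ->|->] //.
by move: sb'; rewrite big1 ?addr0 // => l _; rewrite bl mulr0.
Qed.

Lemma cbasis_ex (l : seq K) : exists q (a : 'I_q -> K), [/\ cindep a,
  (forall i, a i \in l) & forall x, x \in l -> exists c : 'I_q -> C0, x = \sum_i e (c i) * a i].
Proof.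
elim: l => [|x l [q [a [ia al lP]]]].
  by exists 0%N, (fun _ => 0); split=> // [c _ []|[]].
have [[c xc]|nx] := pselect (exists c : 'I_q -> C0, x = \sum_i e (c i) * a i).
  exists q, a; split=> // [i|y]; first by rewrite inE al orbT.
  by rewrite inE => /orP[/eqP->|/lP//]; exists c.
exists q.+1, (fun i => if unlift ord0 i is Some l then a l else x); split.
- move=> c; rewrite big_ord_recl unlift_none.
  under eq_bigr do rewrite liftK.
  move=> s0; have [c0|c0] := eqVneq (c ord0) 0.
    rewrite c0 rmorph0 mul0r add0r in s0 => i; case: (unliftP ord0 i) => [l' ->|->] //.
    exact: (ia (fun i => c (lift ord0 i))).
  case: nx; exists (fun i => - c (lift ord0 i) / c ord0).
  have ec0 : e (c ord0) != 0 by rewrite fmorph_eq0.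
  apply: (mulfI ec0); move/eqP: s0; rewrite addr_eq0 => /eqP->.
  rewrite mulr_sumr -sumrN; apply: eq_bigr => i _.
  by rewrite rmorphM rmorphN fmorphV; field.
- by move=> i; case: unliftP => [l' _|_]; rewrite inE ?eqxx ?al ?orbT.
- move=> y; rewrite inE => /orP[/eqP->|/lP[c yc]].
    exists (fun i => (i == ord0)%:R); rewrite big_ord_recl unlift_none rmorph1 mul1r.
    rewrite big1 ?addr0 // => i _; rewrite eq_sym -[_ == _]negbK neq_lift.
    by rewrite rmorph0 mul0r.
  exists (fun i => if unlift ord0 i is Some l then c l else 0).
  rewrite big_ord_recl unlift_none rmorph0 mul0r add0r yc.
  by apply: eq_bigr => i _; rewrite !liftK.
Qed.

Section Definable.
Variable s : nat.
Notation dp := (dpoly C0 s m).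

Definition cval (F : DField m.+1) (f : K -> F) (y : 'I_s -> F) (P : dp) : F :=
  deval (f \o e) (der (pired F)) y P.

(** Quantities defined uniformly over all extensions of [K], so that an identity found in a large
    [F] can be read again in [K] itself. *)
Definition cfun := forall F : DField m.+1, {rmorphism K -> F} -> ('I_s -> F) -> F.

Definition good (F : DField m.+1) (f : K -> F) (y : 'I_s -> F) :=
  dmorph f /\ forall i, der F ord0 (y i) = 0.

Definition definable (g : cfun) := exists L : seq (K * dp),
  forall (F : DField m.+1) (f : {rmorphism K -> F}) y, good f y ->
    g F f y = \sum_(p <- L) f p.1 * cval f y p.2.

Lemma cval_const (F : DField m.+1) (f : {rmorphism K -> F}) y P : good f y ->
  der F ord0 (cval f y P) = 0.
Proof.
move=> [df y0]; elim: P => [c|i w|P IHP Q IHQ|P IHP Q IHQ|P IHP]; rewrite /cval /=.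
- by rewrite -df e0 rmorph0.
- elim: w => [|i' w IHw] /=; first exact: y0.
  by rewrite der_comm IHw raddf0.
- by rewrite raddfD /= -/(cval f y P) IHP -/(cval f y Q) IHQ addr0.
- by rewrite derM -/(cval f y P) IHP -/(cval f y Q) IHQ mulr0 mul0r addr0.
- by rewrite raddfN /= -/(cval f y P) IHP oppr0.
Qed.

Lemma cval_ddp (F : DField m.+1) (f : {rmorphism K -> F}) y P i : good f y ->
  cval f y (ddp (der C0) i P) = der F (lift ord0 i) (cval f y P).
Proof.
move=> [df _]; apply: (@deval_ddp s m C0 (pired F) (f \o e) (der C0)) => l c /=.
by rewrite eD df.
Qed.

Lemma definable_const a : definable (fun F f y => f a).
Proof.
exists [:: (a, dpC s m 1)] => F f y _.
by rewrite big_seq1 /= /cval /= !rmorph1 mulr1.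
Qed.

Lemma definable_var i : definable (fun F f y => y i).
Proof. by exists [:: (1, dpY C0 i [::])] => F f y _; rewrite big_seq1 /= rmorph1 mul1r. Qed.

Lemma definable_add g h : definable g -> definable h ->
  definable (fun F f y => g F f y + h F f y).
Proof.
move=> [L gL] [M hM]; exists (L ++ M) => F f y gd.
by rewrite big_cat gL // hM.
Qed.

Lemma definable_mul g h : definable g -> definable h ->
  definable (fun F f y => g F f y * h F f y).
Proof.
move=> [L gL] [M hM]; exists [seq (p.1 * q.1, dpMul p.2 q.2) | p <- L, q <- M] => F f y gd.
rewrite big_allpairs_dep gL // hM // mulr_suml; apply: eq_bigr => p _.
rewrite mulr_sumr; apply: eq_bigr => q _ /=.
by rewrite rmorphM /cval /=; ring.
Qed.

Lemma definable_opp g : definable g -> definable (fun F f y => - g F f y).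
Proof.
move=> [L gL]; exists [seq (- p.1, p.2) | p <- L] => F f y gd.
by rewrite big_map gL // -sumrN; apply: eq_bigr => p _; rewrite rmorphN mulNr.
Qed.

Lemma definable_der g i : definable g -> definable (fun F f y => der F i (g F f y)).
Proof.
move=> [L gL]; case: (unliftP ord0 i) => [l ->|->].
  exists ([seq (der K (lift ord0 l) p.1, p.2) | p <- L] ++
          [seq (p.1, ddp (der C0) l p.2) | p <- L]) => F f y gd.
  rewrite gL // big_cat /= !big_map -big_split raddf_sum; apply: eq_bigr => p _ /=.
  by rewrite derM cval_ddp //; case: gd => ->.
exists [seq (der K ord0 p.1, p.2) | p <- L] => F f y gd.
rewrite gL // big_map raddf_sum; apply: eq_bigr => p _ /=.
by rewrite derM cval_const // mulr0 addr0; case: gd => ->.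
Qed.

Lemma definable_sum I (r : seq I) (g : I -> cfun) : (forall i, definable (g i)) ->
  definable (fun F f y => \sum_(i <- r) g i F f y).
Proof.
move=> dg; elim: r => [|i r [L gL]].
  by exists [::] => F f y _; rewrite !big_nil.
have [M gM] := dg i; exists (M ++ L) => F f y gd.
by rewrite big_cons big_cat gL // gM.
Qed.

(** Write the coefficients in a basis over the constants. By [cindep_ext] the basis stays
    independent over the constants of [F], so one equation over [K] splits into finitely many
    equations over [C0], the same for every [F]. *)
Lemma definable_zeros g : definable g -> exists q (Q : 'I_q -> dp),
  forall (F : DField m.+1) (f : {rmorphism K -> F}) y, good f y ->
    g F f y = 0 <-> forall i, cval f y (Q i) = 0.
Proof.
move=> [L gL]; have [q [a [ia _ lP]]] := cbasis_ex [seq p.1 | p <- L].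
have [Q QP] : exists Q : 'I_q -> dp, forall (F : DField m.+1) (f : {rmorphism K -> F}) y,
    good f y -> g F f y = \sum_i f (a i) * cval f y (Q i).
  suff [Q QP] : exists Q : 'I_q -> dp, forall (F : DField m.+1) (f : {rmorphism K -> F}) y,
      \sum_(p <- L) f p.1 * cval f y p.2 = \sum_i f (a i) * cval f y (Q i).
    by exists Q => F f y gd; rewrite gL // QP.
  elim: L lP {gL} => [|[b P] L IH] lP.
    exists (fun _ => dpC s m 0) => F f y; rewrite big_nil big1 // => i _.
    by rewrite /cval /= !rmorph0 mulr0.
  have [|Q QP] := IH; first by move=> x xl; apply: lP; rewrite inE xl orbT.
  have [|c bc] := lP b; first by rewrite inE eqxx.
  exists (fun i => dpAdd (dpMul (dpC s m (c i)) P) (Q i)) => F f y.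
  rewrite big_cons QP /= bc rmorph_sum mulr_suml -big_split; apply: eq_bigr => i _ /=.
  by rewrite rmorphM /cval /=; ring.
exists q, Q => F f y gd; rewrite QP //; split=> [s0|Q0]; last first.
  by apply: big1 => i _; rewrite Q0 mulr0.
have [df _] := gd; apply: (cindep_ext df ia _ s0) => i; exact: cval_const.
Qed.
End Definable.
End Constants.

(** * Automorphisms from constant matrices *)

Lemma der_mulmx n (F : DField n) i p q r (A : 'M[F]_(p, q)) (B : 'M[F]_(q, r)) :
  map_mx (der F i) (A *m B) = map_mx (der F i) A *m B + A *m map_mx (der F i) B.
Proof.
apply/matrixP => a b; rewrite !mxE raddf_sum -big_split; apply: eq_bigr => c _.
by rewrite !mxE /= derM.
Qed.

Lemma der_solutions n (F : DField n) i p (A X Y : 'M[F]_p) : X \in unitmx ->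
  map_mx (der F i) X = A *m X -> map_mx (der F i) Y = A *m Y ->
  map_mx (der F i) (invmx X *m Y) = 0.
Proof.
move=> uX dX dY; have := der_mulmx i X (invmx X *m Y).
rewrite mulKVmx // dY dX -mulmxA mulKVmx // -[LHS]addr0 => /addrI/esym h.
by rewrite -[LHS](mulKmx uX) h mulmx0.
Qed.

Definition zvar (R : Type) n (X : 'M[R]_n) : 'I_(n * n) -> R := fun i => mxvec X 0 i.

Lemma eq_deval (R : Type) s n (L : nzRingType) (f g : R -> L) D (y z : 'I_s -> L) (P : dpoly R s n) :
  f =1 g -> y =1 z -> deval f D y P = deval g D z P.
Proof.
move=> fg yz; elim: P => [c|i w|P IHP Q IHQ|P IHP Q IHQ|P IHP] /=; rewrite ?IHP ?IHQ //.
by rewrite yz.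
Qed.

Lemma deval_morph (R : Type) s n (K F : DField n) (h : {rmorphism K -> F}) (f : R -> K)
    (y : 'I_s -> K) (P : dpoly R s n) : dmorph h ->
  h (deval f (der K) y P) = deval (h \o f) (der F) (h \o y) P.
Proof.
move=> dh; elim: P => [c|i w|P IHP Q IHQ|P IHP Q IHQ|P IHP] //=.
- exact: dmorph_foldr.
- by rewrite rmorphD IHP IHQ.
- by rewrite rmorphM IHP IHQ.
- by rewrite rmorphN IHP.
Qed.

Section PPV.
Variables (m n : nat) (k K : DField m.+1) (A : 'M[k]_n) (phi : {rmorphism k -> K}).
Hypothesis dphi : dmorph phi.
Variable Z : 'M[K]_n.
Hypotheses (uZ : Z \in unitmx) (dZ : map_mx (der K ord0) Z = map_mx phi A *m Z)
  (genZ : forall x : K, dgen phi (fun y => exists i j, y = Z i j) x).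
Notation dp := (dpoly k (n * n) m.+1).

Definition zev (X : 'M[K]_n) (P : dp) : K := deval phi (der K) (zvar X) P.

Lemma zev_ddp X i P : zev X (ddp (der k) i P) = der K i (zev X P).
Proof. by apply: deval_ddp => l c; exact: dphi. Qed.

Lemma ppv_fraction x : exists P Q, zev Z Q != 0 /\ x = zev Z P / zev Z Q.
Proof.
apply: (genZ x (P := fun x => exists P Q, zev Z Q != 0 /\ x = zev Z P / zev Z Q)).
- split; first split.
  + exists (dpC _ _ 0), (dpC _ _ 1); rewrite /zev /= rmorph0 rmorph1 mul0r oner_eq0.
    by split.
  + by exists (dpC _ _ 1), (dpC _ _ 1); rewrite /zev /= rmorph1 divr1 oner_eq0.
  + move=> _ _ [P [Q [nQ ->]]] [P' [Q' [nQ' ->]]].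
    exists (dpAdd (dpMul P Q') (dpOpp (dpMul P' Q))), (dpMul Q Q'); split.
      by rewrite mulf_neq0.
    by rewrite /zev /= -!/(zev _ _); field; rewrite nQ nQ'.
  + move=> _ _ [P [Q [nQ ->]]] [P' [Q' [nQ' ->]]].
    exists (dpMul P P'), (dpMul Q Q'); split; first by rewrite mulf_neq0.
    by rewrite /zev /= -!/(zev _ _); field; rewrite nQ nQ'.
  + move=> _ [P [Q [nQ ->]]]; rewrite mulf_eq0 invr_eq0 negb_or => /andP[nP _].
    by exists Q, P; split=> //; rewrite invf_div.
  + move=> i _ [P [Q [nQ ->]]].
    exists (dpAdd (dpMul (ddp (der k) i P) Q) (dpOpp (dpMul P (ddp (der k) i Q)))), (dpMul Q Q).
    split; first by rewrite mulf_neq0.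
    by rewrite der_div // /zev /= -!/(zev _ _) !zev_ddp expr2.
- by move=> a; exists (dpC _ _ a), (dpC _ _ 1); rewrite /zev /= rmorph1 divr1 oner_eq0.
- move=> _ [i [j ->]]; exists (dpY _ (mxvec_index i j) [::]), (dpC _ _ 1).
  by rewrite /zev /= rmorph1 divr1 oner_eq0 /zvar mxvecE.
Qed.

Definition specializes (N : 'M[K]_n) := forall P, zev Z P = 0 -> zev (Z *m N) P = 0.

Lemma zev_subst (N : 'M[k]_n) P : exists P', forall X, zev X P' = zev (X *m map_mx phi N) P.
Proof.
elim: P => [c|i w|P [P' hP] Q [Q' hQ]|P [P' hP] Q [Q' hQ]|P [P' hP]].
- by exists (dpC _ _ c).
- elim: w => [|l w [P' hP]].
    case/mxvec_indexP: i => a b.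
    exists (\big[@dpAdd _ _ _/dpC _ _ 0]_(c < n) dpMul (dpY _ (mxvec_index a c) [::]) (dpC _ _ (N c b))).
    move=> X; rewrite /zev /= /zvar mxvecE mxE.
    rewrite (big_morph (deval phi (der K) (mxvec X 0)) (id1 := 0) (op1 := +%R)) //=; last first.
      by rewrite rmorph0.
    by apply: eq_bigr => c _; rewrite mxE mxvecE.
  by exists (ddp (der k) l P') => X; rewrite zev_ddp hP.
- by exists (dpAdd P' Q') => X; rewrite /zev /= -!/(zev _ _) hP hQ.
- by exists (dpMul P' Q') => X; rewrite /zev /= -!/(zev _ _) hP hQ.
- by exists (dpOpp P') => X; rewrite /zev /= -!/(zev _ _) hP.
Qed.

(** The substitution of [Z *m N] for [Z] in fractions, kept as a relation until it is shown to be
    single-valued. *)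
Definition zgraph N (u v : K) := exists P Q,
  [/\ zev Z Q != 0, u = zev Z P / zev Z Q & v = zev (Z *m N) P / zev (Z *m N) Q].

Section Aut.
Variables (N N' : 'M[k]_n).
Hypotheses (NN' : N *m N' = 1%:M) (sN : specializes (map_mx phi N)) (sN' : specializes (map_mx phi N')).
Local Notation ZN := (Z *m map_mx phi N).

(** Specializing by [N'] undoes the substitution of [N]; this keeps denominators nonzero. *)
Lemma specializes_inj P : zev ZN P = 0 -> zev Z P = 0.
Proof.
have [P' hP] := zev_subst N P; move=> e; have := @sN' P'; rewrite hP e => /(_ erefl).
rewrite hP -mulmxA -map_mxM (mulmx1C NN') map_mx1 mulmx1 //.
Qed.

Lemma zgraph_fun u v w : zgraph (map_mx phi N) u v -> zgraph (map_mx phi N) u w -> v = w.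
Proof.
move=> [P [Q [nQ -> ->]]] [P' [Q' [nQ' e ->]]].
have nZ R : zev Z R != 0 -> zev ZN R != 0 by apply: contra_neq => /specializes_inj.
have := @sN (dpAdd (dpMul P Q') (dpOpp (dpMul P' Q))).
rewrite /zev /= -!/(zev _ _) => h.
have e1 : zev Z P * zev Z Q' + - (zev Z P' * zev Z Q) = 0.
  have -> : zev Z P = zev Z P' / zev Z Q' * zev Z Q by rewrite -e divfK.
  by field.
have {}h := h e1; have nq := nZ _ nQ; have nq' := nZ _ nQ'.
have -> : zev ZN P = zev ZN P' * zev ZN Q / zev ZN Q'.
  by move/eqP: h; rewrite subr_eq0 => /eqP <-; rewrite mulfK.
by field; rewrite nq nq'.
Qed.

Lemma zgraph_swap u v : zgraph (map_mx phi N) u v -> zgraph (map_mx phi N') v u.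
Proof.
move=> [P [Q [nQ -> ->]]]; have [P' hP] := zev_subst N P; have [Q' hQ] := zev_subst N Q.
exists P', Q'; rewrite !hP !hQ -mulmxA -map_mxM (mulmx1C NN') map_mx1 mulmx1; split=> //.
by apply: contra_neq nQ => /specializes_inj.
Qed.
End Aut.

Lemma aut_of_matrix (N N' : 'M[k]_n) : N *m N' = 1%:M ->
  specializes (map_mx phi N) -> specializes (map_mx phi N') ->
  exists2 sigma, PPV_group phi sigma & forall P Q, zev Z Q != 0 ->
    sigma (zev Z P / zev Z Q) = zev (Z *m map_mx phi N) P / zev (Z *m map_mx phi N) Q.
Proof.
move=> NN' sN sN'; have N'N := mulmx1C NN'.
have nZ R : zev Z R != 0 -> zev (Z *m map_mx phi N) R != 0.
  by apply: contra_neq => /(specializes_inj NN' sN').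
have ex (M : 'M[k]_n) u : exists v, zgraph (map_mx phi M) u v.
  by have [P [Q [nQ ->]]] := ppv_fraction u; eexists; exists P, Q; split.
have /choice[f fP] := ex N; have /choice[g gP] := ex N'.
have fE P Q : zev Z Q != 0 -> f (zev Z P / zev Z Q) = zev (Z *m map_mx phi N) P / zev (Z *m map_mx phi N) Q.
  by move=> nQ; apply: (zgraph_fun NN' sN sN' (fP _)); exists P, Q; split.
have fun' := zgraph_fun N'N sN' sN.
exists f => //; split.
- move=> x y; have [P [Q [nQ ->]]] := ppv_fraction x; have [P' [Q' [nQ' ->]]] := ppv_fraction y.
  have nq := nZ _ nQ; have nq' := nZ _ nQ'.
  transitivity (f (zev Z (dpAdd (dpMul P Q') (dpMul P' Q)) / zev Z (dpMul Q Q'))).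
    by congr (f _); rewrite /zev /= -!/(zev _ _); field; rewrite nQ nQ'.
  rewrite !fE //; last by rewrite mulf_neq0.
  by rewrite /zev /= -!/(zev _ _); field; rewrite nq nq'.
- move=> x y; have [P [Q [nQ ->]]] := ppv_fraction x; have [P' [Q' [nQ' ->]]] := ppv_fraction y.
  have nq := nZ _ nQ; have nq' := nZ _ nQ'.
  transitivity (f (zev Z (dpMul P P') / zev Z (dpMul Q Q'))).
    by congr (f _); rewrite /zev /= -!/(zev _ _); field; rewrite nQ nQ'.
  rewrite !fE //; last by rewrite mulf_neq0.
  by rewrite /zev /= -!/(zev _ _); field; rewrite nq nq'.
- exists g => x.
    by apply: fun' (gP _) _; apply: zgraph_swap NN' sN' _ _ (fP x).
  apply: (zgraph_fun NN' sN sN') (fP _) _; exact: zgraph_swap N'N sN _ _ (gP x).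
- move=> a; have n1 : zev Z (dpC _ _ 1) != 0 by rewrite /zev /= rmorph1 oner_eq0.
  by have := fE (dpC _ _ a) _ n1; rewrite /zev /= rmorph1 !divr1.
- move=> i x; have [P [Q [nQ ->]]] := ppv_fraction x; have nq := nZ _ nQ.
  rewrite der_div // !fE // der_div // -!zev_ddp.
  transitivity (f (zev Z (dpAdd (dpMul (ddp (der k) i P) Q) (dpOpp (dpMul P (ddp (der k) i Q)))) / zev Z (dpMul Q Q))).
    by congr f; rewrite expr2.
  by rewrite fE ?mulf_neq0 // expr2.
Qed.

Hypothesis nnc : no_new_constants phi.
Hypothesis ch0 : [pchar k] =i pred0.
Variables (C0 : DField m) (j : {rmorphism C0 -> k}).
Hypotheses (j0 : forall x, der k ord0 (j x) = 0)
  (jS : forall c, der k ord0 c = 0 -> exists x, j x = c)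
  (jD : forall i x, j (der C0 i x) = der k (lift ord0 i) (j x)) (dcl : diff_closed C0).

Local Notation e := (phi \o j : {rmorphism C0 -> K}).

Lemma const0 c : der K ord0 (e c) = 0. Proof. by rewrite /= -dphi j0 rmorph0. Qed.

Lemma constS x : der K ord0 x = 0 -> exists c, e c = x.
Proof.
move=> dx; have [a ea] := nnc dx; have [|c jc] := jS (c := a).
  by apply: (fmorph_inj phi); rewrite dphi ea dx rmorph0.
by exists c; rewrite /= jc ea.
Qed.

Lemma constD i c : e (der C0 i c) = der K (lift ord0 i) (e c).
Proof. by rewrite /= jD dphi. Qed.

Lemma char0_C0 : [pchar C0] =i pred0.
Proof.
move=> p; rewrite -(ch0 p) !inE; congr (_ && _).
by rewrite -(rmorph_nat j) fmorph_eq0.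
Qed.

Lemma ppv_normal (x : K) : (forall a, phi a != x) ->
  exists2 sigma, PPV_group phi sigma & sigma x != x.
Proof.
move=> nx; have [F [f1 [f2 [df1 df2 f12 f1x]]]] := two_embeddings ch0 dphi nx.
have [P [Q [nQ xPQ]]] := ppv_fraction x.
pose Z1 := map_mx f1 Z; pose Z2 := map_mx f2 Z.
have uZ1 : Z1 \in unitmx by rewrite map_unitmx.
have uZ2 : Z2 \in unitmx by rewrite map_unitmx.
pose B := map_mx (f1 \o phi) A.
have dZf (f : {rmorphism K -> F}) : dmorph f -> (forall a, f (phi a) = f1 (phi a)) ->
    map_mx (der F ord0) (map_mx f Z) = B *m map_mx f Z.
  move=> df ff; have -> : B *m map_mx f Z = map_mx f (map_mx (der K ord0) Z).
    rewrite dZ map_mxM; congr (_ *m _); apply/matrixP => a b; rewrite !mxE /=; exact/esym/ff.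
  by apply/matrixP => a b; rewrite !mxE df.
have dZ1 := dZf f1 df1 (fun _ => erefl).
have dZ2 := dZf f2 df2 (fun a => esym (f12 a)).
pose M := invmx Z1 *m Z2; pose M' := invmx Z2 *m Z1.
have dM : map_mx (der F ord0) M = 0 by exact: der_solutions dZ1 dZ2.
have dM' : map_mx (der F ord0) M' = 0 by exact: der_solutions dZ2 dZ1.
have Z1M : Z1 *m M = Z2 by rewrite mulKVmx.
have Z2M' : Z2 *m M' = Z1 by rewrite mulKVmx.
have MM' : M *m M' = 1%:M by rewrite mulmxA mulmxK // mulVmx.
(* The unknowns are the entries of a matrix and of its inverse, so that the specialized pair is
   again inverse and both substitutions are controlled. *)
pose s := (n * n + n * n)%N.
pose Xl (R : pzRingType) (y : 'I_s -> R) : 'M[R]_n := \matrix_(a, b) y (lshift _ (mxvec_index a b)).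
pose Xr (R : pzRingType) (y : 'I_s -> R) : 'M[R]_n := \matrix_(a, b) y (rshift _ (mxvec_index a b)).
pose y (i : 'I_s) : F := row_mx (mxvec M) (mxvec M') 0 i.
have yl : Xl _ y = M by apply/matrixP => a b; rewrite mxE /y row_mxEl mxvecE.
have yr : Xr _ y = M' by apply/matrixP => a b; rewrite mxE /y row_mxEr mxvecE.
have y0 i : der F ord0 (y i) = 0.
  rewrite /y -(splitK i); case: (split i) => l /=; rewrite ?row_mxEl ?row_mxEr.
    by case/mxvec_indexP: l => a b; rewrite mxvecE; move/matrixP/(_ a b): dM; rewrite !mxE.
  by case/mxvec_indexP: l => a b; rewrite mxvecE; move/matrixP/(_ a b): dM'; rewrite !mxE.
pose def := @definable m C0 K e s.
pose wev (G : forall F : DField m.+1, ('I_s -> F) -> 'M[F]_n) R : cfun K s :=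
  fun F f y => deval (f \o phi) (der F) (zvar (map_mx f Z *m G F y)) R.
have wev_def (G : forall F : DField m.+1, ('I_s -> F) -> 'M[F]_n) (ix : 'I_n -> 'I_n -> 'I_s) :
    (forall F y a b, G F y a b = y (ix a b)) -> forall R, def (wev G R).
  move=> GE; elim=> [c|i w|R IHR R' IHR'|R IHR R' IHR'|R IHR].
  - exact: definable_const.
  - elim: w => [|l w IHw]; last by apply: definable_der IHw; [exact: const0|exact: constD].
    case/mxvec_indexP: i => a b.
    suff [L LP] : def (fun F f y => \sum_(c < n) f (Z a c) * y (ix c b)).
      exists L => F' f y' gd; rewrite -LP // /wev /= /zvar mxvecE mxE.
      by apply: eq_bigr => c _; rewrite mxE GE.
    apply: definable_sum => c; apply: definable_mul; first exact: definable_const.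
    exact: definable_var.
  - exact: definable_add.
  - exact: definable_mul.
  - exact: definable_opp.
have ldef R : def (wev (fun F y => Xl F y) R).
  by apply: (wev_def _ (fun a b => lshift _ (mxvec_index a b))) => *; rewrite mxE.
have rdef R : def (wev (fun F y => Xr F y) R).
  by apply: (wev_def _ (fun a b => rshift _ (mxvec_index a b))) => *; rewrite mxE.
have f1good : good f1 y by split.
have f2good : good f2 y by split.
have zeros (g : cfun K s) : def g -> exists q (Qs : 'I_q -> dpoly C0 s m),
    forall (F : DField m.+1) (f : {rmorphism K -> F}) y, good f y ->
    g F f y = 0 <-> forall i, cval e f y (Qs i) = 0.
  by apply: definable_zeros; [exact: const0|exact: constS].
(* Its vanishing expresses that the substitution fixes [x], with denominators cleared; at [M] it is
   nonzero because [f1 x] and [f2 x] differ. *)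
pose gx : cfun K s := fun F f y => f (zev Z Q) * wev (fun F y => Xl F y) P F f y
  + - (f (zev Z P) * wev (fun F y => Xl F y) Q F f y).
have gx_def : def gx.
  apply: definable_add; [|apply: definable_opp]; apply: definable_mul; by [exact: definable_const|exact: ldef].
have ev2 R : wev (fun F y => Xl F y) R F f1 y = f2 (zev Z R).
  rewrite /wev yl Z1M (deval_morph _ _ _ df2); apply: eq_deval => [a|i] //=.
  by rewrite /zvar -map_mxvec mxE.
have ev1 R : wev (fun F y => Xr F y) R F f2 y = f1 (zev Z R).
  rewrite /wev yr Z2M' (deval_morph _ _ _ df1); apply: eq_deval => [a|i] //=.
  by rewrite /zvar -map_mxvec mxE.
have gxy : gx F f1 y != 0.
  rewrite /gx !ev2; apply: contra_neq f1x => h.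
  rewrite xPQ !fmorph_div; have n1 : f1 (zev Z Q) != 0 by rewrite fmorph_eq0.
  have n2 : f2 (zev Z Q) != 0 by rewrite fmorph_eq0.
  apply: (mulfI n1); rewrite mulrCA divff // mulr1; apply: (mulIf n2).
  by rewrite mulrA divfK //; apply/eqP; rewrite -subr_eq0 -oppr_eq0 opprB h.
have [q [Qs QsP]] := zeros _ gx_def.
(* A single polynomial over the constants witnesses that [x] moves; it is the inequation handed to
   [specialization]. *)
have [i0 Qi0] : exists i, cval e f1 y (Qs i) != 0.
  apply: contrapT => h; case/eqP: gxy; apply/(QsP _ _ _ f1good) => i.
  by apply: contrapT => hi; apply: h; exists i; apply/eqP.
have d1 : dmorph (f1 \o e : {rmorphism C0 -> pired F}).
  by move=> i c; rewrite -[LHS]/(f1 (e (der C0 i c))) constD df1.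
have [z [zP zQ]] := @specialization s m C0 (pired F) (f1 \o e : {rmorphism C0 -> pired F})
  char0_C0 dcl d1 y (Qs i0) Qi0.
have zgood : good (idfun : {rmorphism K -> K}) (e \o z).
  by split=> // i; exact: const0.
have cvalz (R : dpoly C0 s m) : cval e (idfun : {rmorphism K -> K}) (e \o z) R = e (deval id (der C0) z R).
  rewrite (@deval_morph _ _ _ C0 (pired K) (e : {rmorphism C0 -> pired K})) //.
  by move=> i c; exact: constD.
(* Both embeddings agree on the constants of [k], so relations seen through either of them are
   relations of [y] over [C0] and pass to [z]. Those for [N] are seen through [f1], those for [N']
   through [f2]. *)
have transfer (g : cfun K s) : def g -> g F f1 y = 0 \/ g F f2 y = 0 ->
    g K (idfun : {rmorphism K -> K}) (e \o z) = 0.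
  move=> /zeros[q' [R RP]] h; apply/(RP _ _ _ zgood) => i; rewrite cvalz zP ?rmorph0 //.
  case: h => [/(RP _ _ _ f1good)/(_ i)//|/(RP _ _ _ f2good)/(_ i) <-].
  by apply: eq_deval => // a; rewrite /= f12.
pose N := map_mx j (Xl _ z); pose N' := map_mx j (Xr _ z).
have eN : Xl K (e \o z) = map_mx phi N by apply/matrixP => a b; rewrite !mxE.
have eN' : Xr K (e \o z) = map_mx phi N' by apply/matrixP => a b; rewrite !mxE.
have id_wev G R : wev G R K (idfun : {rmorphism K -> K}) (e \o z) = zev (Z *m G K (e \o z)) R.
  by rewrite /wev map_mx_id.
have [|||sigma Gs sE] := @aut_of_matrix N N'.
- apply: (map_mx_inj (f := phi)); rewrite map_mxM map_mx1 -eN -eN'.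
  apply/matrixP => a b; apply/eqP; rewrite -subr_eq0; apply/eqP.
  pose g : cfun K s := fun F f y => \sum_c y (lshift _ (mxvec_index a c)) * y (rshift _ (mxvec_index c b))
    + f (- (a == b)%:R).
  have gE (F' : DField m.+1) (f : {rmorphism K -> F'}) y' : g F' f y' = (Xl _ y' *m Xr _ y' - 1%:M) a b.
    by rewrite /g !mxE rmorphN rmorph_nat; congr (_ - _); apply: eq_bigr => c _; rewrite !mxE.
  have := transfer g; rewrite !gE yl yr MM' subrr !mxE => h; rewrite -[RHS]h ?mxE //; last by left.
  apply: definable_add; last exact: definable_const.
  by apply: definable_sum => c; apply: definable_mul; exact: definable_var.
- move=> R hR; rewrite -eN -(id_wev (fun F y => Xl F y)); apply: transfer; first exact: ldef.
  by left; rewrite ev2 hR rmorph0.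
- move=> R hR; rewrite -eN' -(id_wev (fun F y => Xr F y)); apply: transfer; first exact: rdef.
  by right; rewrite ev1 hR rmorph0.
exists sigma => //.
have gxz : gx K (idfun : {rmorphism K -> K}) (e \o z) != 0.
  apply/eqP => /(QsP _ _ _ zgood)/(_ i0); rewrite cvalz => /eqP; rewrite fmorph_eq0.
  by move/negP: zQ.
apply: contra_neq gxz; rewrite xPQ sE // /gx !id_wev eN /= => h.
(* A zero denominator would make [sigma] send 1, written as [Q] over [Q], to 0. *)
have nQN : zev (Z *m map_mx phi N) Q != 0.
  apply: contra_neq f1x => h0.
  have s1 : sigma 1 = 1 by have := (let: And5 _ _ _ h _ := Gs in h) 1; rewrite rmorph1.
  have := sE Q Q nQ; rewrite divff // h0 invr0 mulr0 s1 => /eqP; rewrite oner_eq0 //.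
have -> : zev (Z *m map_mx phi N) P = zev Z P / zev Z Q * zev (Z *m map_mx phi N) Q by rewrite -h divfK.
by field.
Qed.
End PPV.

(** * Differentially closed fields are algebraically closed *)

Lemma irreducible_factor (F : fieldType) (p : {poly F}) : (1 < size p)%N ->
  exists2 q, irreducible_poly q & q %| p.
Proof.
move=> sp; have [|N [q [sq qp eN]] min] := @least_nat (fun N => exists q : {poly F},
  [/\ (1 < size q)%N, q %| p & size q = N]); first by exists (size p), p; split.
exists q => //; split=> // d sd dq.
have q0 : q != 0 by rewrite -size_poly_gt0 ltnW.
have sd1 : (1 < size d)%N.
  by rewrite ltn_neqAle eq_sym sd size_poly_gt0; apply: contraNneq q0 => d0; rewrite d0 dvd0p in dq.
rewrite -dvdp_size_eqp // eqn_leq dvdp_leq //= eN; apply: min.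
by exists d; split=> //; exact: dvdp_trans qp.
Qed.

Lemma commutator_derivation (R : comNzRingType) (d1 d2 : R -> R) :
  ring_derivation d1 -> ring_derivation d2 ->
  ring_derivation (fun u => d1 (d2 u) - d2 (d1 u)).
Proof.
move=> [D1 M1] [D2 M2]; split=> u v; first by rewrite !(D1, D2); ring.
by rewrite !(M1, M2) !(D1, D2) !(M1, M2); ring.
Qed.

Section PolyDer.
Variables (n : nat) (C : DField n) (w : 'I_n -> {poly C}).

(** The derivation of C[X] that extends [der C i] and sends X to [w i]. *)
Definition pder i (u : {poly C}) : {poly C} := map_poly (der C i) u + u^`() * w i.

Lemma map_der_M i (u v : {poly C}) :
  map_poly (der C i) (u * v) = map_poly (der C i) u * v + u * map_poly (der C i) v.
Proof.
apply/polyP => l; rewrite coefD !coefM coef_map coefM raddf_sum -big_split.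
by apply: eq_bigr => a _; rewrite /= !coef_map derM.
Qed.

Lemma pder_derivation i : ring_derivation (pder i).
Proof.
split=> u v; rewrite /pder; first by rewrite raddfD derivD; ring.
by rewrite map_der_M derivM; ring.
Qed.

(** Both sides are derivations in [u] that vanish on [C] and agree at X. *)
Lemma pder_comm i j u :
  pder i (pder j u) - pder j (pder i u) = u^`() * (pder i (w j) - pder j (w i)).
Proof.
have ext (d1 d2 : {poly C} -> {poly C}) : ring_derivation d1 -> ring_derivation d2 ->
    (forall c, d1 c%:P = d2 c%:P) -> d1 'X = d2 'X -> d1 =1 d2.
  move=> [D1 M1] [D2 M2] ec eX; elim/poly_ind => [|v c IH]; first exact: ec.
  by rewrite D1 D2 M1 M2 IH ec eX.
have di := pder_derivation i; have dj := pder_derivation j.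
apply: (ext (fun u => pder i (pder j u) - pder j (pder i u))
  (fun u => u^`() * (pder i (w j) - pder j (w i)))).
- exact: commutator_derivation.
- by split=> u1 u2; rewrite ?derivD ?derivM; ring.
- move=> c; rewrite derivC mul0r /pder !derivC !mul0r !addr0 !map_polyC /=.
  by rewrite !derivC !mul0r !addr0 der_comm subrr.
- have e l : pder l 'X = w l.
    rewrite /pder derivX mul1r; have -> : map_poly (der C l) 'X = 0; last by rewrite add0r.
    apply/polyP => a; rewrite coef_map coefX coef0 /=.
    by case: (a == 1%N); rewrite ?der1 ?raddf0.
  by rewrite !e derivX mul1r.
Qed.
End PolyDer.

(* Derivations extend to a simple algebraic extension [C[z]], so an algebraic equation
   with coefficients in a differentially closed field has a solution there. *)
Lemma diff_closed_root_closed n (C : DField n) : [pchar C] =i pred0 ->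
  diff_closed C -> root_closed C.
Proof.
move=> ch0 dcl p0 /irreducible_factor[q irr /dvdpP[r ->]].
suff [x rx] : exists x, root q x by exists x; rewrite rootM rx orbT.
have [L _ [z rz gen]] := irredp_FAdjoin irr; have [sq irrq] := irr.
pose h : {rmorphism {poly C} -> L} := horner_eval z \o map_poly (in_alg L).
have hE u : h u = (map_poly (in_alg L) u).[z] by [].
have hC c : h c%:P = in_alg L c by rewrite hE map_polyC hornerC.
have hq : h q = 0 by apply/eqP; rewrite hE -rootE.
have h_onto x : exists u, h u = x.
  have : x \in <<1; z>>%VS by rewrite gen memvf.
  by case/Fadjoin1_polyP => u ->; exists u.
have hdvd u : h u = 0 -> q %| u.
  move=> hu; have : ~~ coprimep q u.
    apply/negP => /Bezout_eq1_coprimepP[[a b] /= e].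
    have := congr1 h e; rewrite rmorphD !rmorphM hq hu !mulr0 addr0 rmorph1.
    by move/eqP; rewrite eq_sym oner_eq0.
  move=> nc; have := irrq _ nc (dvdp_gcdl q u).
  by move/eqp_dvdl => <-; exact: dvdp_gcdr.
have hq' : h q^`() != 0.
  apply/eqP => /hdvd; apply/negP; rewrite gtNdvdp //; last by rewrite lt_size_deriv // -size_poly_gt0 ltnW.
  apply/eqP => /polyP/(_ (size q).-2); rewrite coef_deriv coef0.
  have -> : (size q).-2.+1 = (size q).-1 by lia.
  move/eqP; rewrite -mulr_natr mulf_eq0 -lead_coefE lead_coef_eq0 -size_poly_eq0.
  move/pcharf0P: ch0 => ->; lia.
(* The derivative of a root is forced by differentiating its equation; [w i] lifts this value to a
   polynomial. *)
have /choice[w wP] : forall i, exists u, h u = - h (map_poly (der C i) q) / h q^`().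
  by move=> i; exact: h_onto.
have dq i : h (pder w i q) = 0.
  by rewrite /pder rmorphD rmorphM wP mulrC divfK // subrr.
have dD := pder_derivation w.
have hd i u : h u = 0 -> h (pder w i u) = 0.
  have [_ dm] := dD i.
  by move/hdvd/dvdpP => [v ->]; rewrite dm rmorphD !rmorphM hq dq !mulr0 addr0.
have hw f : exists x y, h y != 0 /\ f = h x / h y.
  by have [u <-] := h_onto f; exists u, 1; rewrite rmorph1 divr1 oner_eq0.
(* Commutation holds only modulo [q]. The commutator sends [q] into the kernel of [h], and it is the
   derivative of [q] times the value at X; since [hq'] makes the first factor invertible, that value
   is in the kernel. *)
have hcomm i j u : h (pder w i (pder w j u)) = h (pder w j (pder w i u)).
  apply/eqP; rewrite -subr_eq0 -rmorphB pder_comm rmorphM; apply/eqP.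
  suff -> : h (pder w i (w j) - pder w j (w i)) = 0 by rewrite mulr0.
  apply: (mulfI hq'); rewrite mulr0 -rmorphM -pder_comm rmorphB.
  by rewrite (hd i _ (dq j)) (hd j _ (dq i)) subrr.
pose LD := fraction_D dD hcomm hd hw.
pose iota : {rmorphism C -> LD} := in_alg L : {rmorphism C -> L}.
have di : dmorph iota.
  move=> i c; have := fder_to dD hd hw i c%:P.
  by rewrite [pder w i _]/pder map_polyC derivC mul0r addr0 !hC.
pose v : 'I_1 * seq 'I_n := (ord0, [::]).
have [|x [xP _]] := dcl 1%N [:: ptree [seq dpC 1 n c | c <- q] v] (dpC 1 n 1).
  exists LD, iota; split=> //; exists (fun _ => z); split; last by rewrite -[deval _ _ _ _]/(iota 1) rmorph1 oner_eq0.
  move=> _ /[!inE] /eqP ->; rewrite deval_ptree ?rmorph0 // -map_comp /=.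
  by move: rz; rewrite rootE map_polyE => /eqP.
exists (x ord0); have := xP _ (mem_head _ _).
by rewrite deval_ptree // -map_comp /= map_id polyseqK => /eqP.
Qed.

(** * Subfields and liouvillian towers *)

Definition subfield (L : fieldType) (E : L -> Prop) :=
  subring E /\ forall x, E x -> E x^-1.

Lemma image_subfield (F L : fieldType) (f : {rmorphism F -> L}) :
  subfield (fun y => exists a, f a = y).
Proof.
split; first split.
- by exists 1; rewrite rmorph1.
- by move=> _ _ [a <-] [b <-]; exists (a - b); rewrite rmorphB.
- by move=> _ _ [a <-] [b <-]; exists (a * b); rewrite rmorphM.
- by move=> _ [a <-]; exists a^-1; rewrite fmorphV.
Qed.

Section Subfields.
Variable L : fieldType.
Implicit Types (E F S : L -> Prop) (x t : L).

Lemma subfieldV E x : subfield E -> E x -> E x^-1. Proof. by case=> _; apply. Qed.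

Lemma subfield_div E x y : subfield E -> E x -> E y -> E (x / y).
Proof. by move=> [sE VE] Ex Ey; apply: subringM => //; exact: VE. Qed.

Definition fgen S x := forall P, subfield P -> (forall y, S y -> P y) -> P x.

Lemma fgen_subfield S : subfield (fgen S).
Proof.
split; first split.
- by move=> P [sP _] _; exact: subring1.
- by move=> x y gx gy P sP SP; apply: subringB; [case: sP|exact: gx|exact: gy].
- by move=> x y gx gy P sP SP; apply: subringM; [case: sP|exact: gx|exact: gy].
- by move=> x gx P sP SP; apply: subfieldV => //; exact: gx.
Qed.

Lemma fgen_base S x : S x -> fgen S x. Proof. by move=> Sx P _; apply. Qed.

Definition adj E t := fgen (fun x => E x \/ x = t).

Lemma adj_subfield E t : subfield (adj E t). Proof. exact: fgen_subfield. Qed.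
Lemma adj_base E t x : E x -> adj E t x. Proof. by move=> Ex; apply: fgen_base; left. Qed.
Lemma adj_elt E t : adj E t t. Proof. by apply: fgen_base; right. Qed.
Lemma adjS E E' t x : (forall y, E y -> E' y) -> adj E t x -> adj E' t x.
Proof.
move=> EE' h; apply: h => [|y [/EE'|->]]; [exact: adj_subfield|exact: adj_base|exact: adj_elt].
Qed.

Lemma adjP E t x : subfield E -> adj E t x -> exists p q : {poly L},
  [/\ polyS E p, polyS E q, q.[t] != 0 & x = p.[t] / q.[t]].
Proof.
move=> [sE VE] ax; pose P x := exists p q : {poly L},
  [/\ polyS E p, polyS E q, q.[t] != 0 & x = p.[t] / q.[t]].
apply: (ax P) => [|y [Ey|->]]; first split; first split.
- by exists 1, 1; split; rewrite ?hornerC ?divr1 ?oner_eq0 //; exact: polyS_1.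
- move=> _ _ [p [q [Ep Eq nq ->]]] [p' [q' [Ep' Eq' nq' ->]]].
  exists (p * q' - p' * q), (q * q'); split.
  + by apply: polyS_B => //; exact: polyS_M.
  + exact: polyS_M.
  + by rewrite hornerM mulf_neq0.
  + by rewrite !hornerE; field; rewrite nq nq'.
- move=> _ _ [p [q [Ep Eq nq ->]]] [p' [q' [Ep' Eq' nq' ->]]].
  exists (p * p'), (q * q'); split; try exact: polyS_M.
  + by rewrite hornerM mulf_neq0.
  + by rewrite !hornerM; field; rewrite nq nq'.
- move=> _ [p [q [Ep Eq nq ->]]]; have [p0|np] := eqVneq p.[t] 0.
    exists 0, 1; rewrite p0 mul0r invr0 horner0 mul0r hornerC oner_eq0.
    by split=> //; [exact: polyS_0|exact: polyS_1].
  by exists q, p; rewrite invf_div.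
- exists y%:P, 1; rewrite !hornerC divr1 oner_eq0; split=> //; last exact: polyS_1.
  exact: polyS_C.
- by exists 'X, 1; rewrite hornerX hornerC divr1 oner_eq0; split=> //; [exact: polyS_X|exact: polyS_1].
Qed.

(** Partial homomorphisms are total functions constrained on [F] only, so that intermediate fields
    remain predicates on [L]. *)
Definition hom_on F (f : L -> L) := [/\ f 1 = 1,
  (forall x y, F x -> F y -> f (x - y) = f x - f y) &
  forall x y, F x -> F y -> f (x * y) = f x * f y].

Section HomOn.
Variables (F : L -> Prop) (f : L -> L).
Hypotheses (sF : subfield F) (hf : hom_on F f).

Let sR : subring F. Proof. by case: sF. Qed.

Lemma hom_on1 : f 1 = 1. Proof. by case: hf. Qed.
Lemma hom_onB x y : F x -> F y -> f (x - y) = f x - f y.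
Proof. by case: hf => _ + _; apply. Qed.
Lemma hom_onM x y : F x -> F y -> f (x * y) = f x * f y.
Proof. by case: hf => _ _; apply. Qed.
Lemma hom_on0 : f 0 = 0.
Proof.
have F1 := subring1 sR.
by have := hom_onB F1 F1; rewrite !subrr.
Qed.
Lemma hom_onN x : F x -> f (- x) = - f x.
Proof. by move=> Fx; rewrite -sub0r hom_onB ?hom_on0 ?sub0r //; exact: subring0. Qed.
Lemma hom_onD x y : F x -> F y -> f (x + y) = f x + f y.
Proof.
by move=> Fx Fy; rewrite -{1}(opprK y) hom_onB ?hom_onN ?opprK //; exact: subringN.
Qed.
Lemma hom_on_eq0 x : F x -> f x = 0 -> x = 0.
Proof.
move=> Fx fx; apply/eqP; apply/contraT => x0.
have : f (x / x) = 1 by rewrite divff // hom_on1.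
rewrite hom_onM ?fx ?mul0r //; last exact: subfieldV.
by move/eqP; rewrite eq_sym oner_eq0.
Qed.
Lemma hom_onV x : F x -> f x^-1 = (f x)^-1.
Proof.
move=> Fx; have [->|x0] := eqVneq x 0; first by rewrite invr0 hom_on0 invr0.
have fx0 : f x != 0 by apply: contra_neq x0; exact: hom_on_eq0.
apply: (mulfI fx0); rewrite -hom_onM ?divff ?hom_on1 //; exact: subfieldV.
Qed.
Lemma hom_on_div x y : F x -> F y -> f (x / y) = f x / f y.
Proof. by move=> Fx Fy; rewrite hom_onM ?hom_onV //; exact: subfieldV. Qed.
Lemma hom_on_sum I (r : seq I) (P : pred I) (G : I -> L) : (forall i, P i -> F (G i)) ->
  f (\sum_(i <- r | P i) G i) = \sum_(i <- r | P i) f (G i).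
Proof.
move=> FG; suff [] : F (\sum_(i <- r | P i) G i) /\
  f (\sum_(i <- r | P i) G i) = \sum_(i <- r | P i) f (G i) by [].
elim/big_ind2: _ => [|x a y b [Fx <-] [Fy <-]|i Pi].
- by split; [exact: subring0|exact: hom_on0].
- by split; [exact: subringD|rewrite hom_onD].
- by split; [exact: FG|].
Qed.
Lemma hom_onX x n : F x -> f (x ^+ n) = f x ^+ n.
Proof.
move=> Fx; elim: n => [|n IH]; first by rewrite !expr0 hom_on1.
by rewrite !exprS hom_onM ?IH //; exact: subringX.
Qed.

Definition pmap (p : {poly L}) := map_poly f p.

Lemma coef_pmap p i : (pmap p)`_i = f p`_i.
Proof. by rewrite coef_map_id0 // hom_on0. Qed.
Lemma pmapC c : pmap c%:P = (f c)%:P.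
Proof. by apply/polyP => i; rewrite coef_pmap !coefC; case: ifP; rewrite ?hom_on0. Qed.
Lemma pmapX : pmap 'X = 'X.
Proof.
by apply/polyP => i; rewrite coef_pmap !coefX; case: (_ == _); rewrite ?hom_on0 ?hom_on1.
Qed.
Lemma pmapB p q : polyS F p -> polyS F q -> pmap (p - q) = pmap p - pmap q.
Proof. by move=> Fp Fq; apply/polyP => i; rewrite coefB !coef_pmap coefB hom_onB. Qed.
Lemma pmapM p q : polyS F p -> polyS F q -> pmap (p * q) = pmap p * pmap q.
Proof.
move=> Fp Fq; apply/polyP => i; rewrite coef_pmap !coefM hom_on_sum => [|j _].
  by apply: eq_bigr => j _; rewrite hom_onM // !coef_pmap.
exact: subringM.
Qed.
Lemma hom_fix_subfield : subfield (fun x => F x /\ f x = x).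
Proof.
split; first split.
- by split; [exact: subring1|exact: hom_on1].
- by move=> x y [Fx fx] [Fy fy]; split; [exact: subringB|rewrite hom_onB // fx fy].
- by move=> x y [Fx fx] [Fy fy]; split; [exact: subringM|rewrite hom_onM // fx fy].
- by move=> x [Fx fx]; split; [exact: subfieldV|rewrite hom_onV // fx].
Qed.
Lemma hom_preim_subfield E : subfield E -> subfield (fun x => F x /\ E (f x)).
Proof.
move=> sE; have [rE VE] := sE; split; first split.
- by split; [exact: subring1|rewrite hom_on1; exact: subring1].
- move=> x y [Fx fx] [Fy fy]; split; [exact: subringB|rewrite hom_onB //; exact: subringB].
- move=> x y [Fx fx] [Fy fy]; split; [exact: subringM|rewrite hom_onM //; exact: subringM].
- move=> x [Fx fx]; split; [exact: subfieldV|rewrite hom_onV //; exact: VE].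
Qed.
Lemma pmap_eq0 p : polyS F p -> pmap p = 0 -> p = 0.
Proof.
move=> Fp /polyP e; apply/polyP => i; rewrite coef0; apply: hom_on_eq0 => //.
by rewrite -coef_pmap e coef0.
Qed.
End HomOn.

Lemma hom_onS F F' f : (forall x, F' x -> F x) -> hom_on F f -> hom_on F' f.
Proof. by move=> FF [f1 fB fM]; split=> // x y /FF Fx /FF Fy; [exact: fB|exact: fM]. Qed.

Lemma hom_on_comp F f g : hom_on F f -> hom_on F g -> (forall x, F x -> F (g x)) ->
  hom_on F (f \o g).
Proof.
move=> [f1 fB fM] [g1 gB gM] Fg; split=> [|x y Fx Fy|x y Fx Fy] /=; first by rewrite g1.
  by rewrite gB // fB //; exact: Fg.
by rewrite gM // fM //; exact: Fg.
Qed.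

(** Apply [f] to the coefficients of a fraction in [t]. The first condition makes this independent
    of the fraction, the second keeps denominators nonzero. *)
Lemma hom_ext F f t : subfield F -> hom_on F f ->
  (forall p, polyS F p -> p.[t] = 0 -> (pmap f p).[t] = 0) ->
  (forall p, polyS F p -> (pmap f p).[t] = 0 -> p.[t] = 0) ->
  exists f', [/\ hom_on (adj F t) f', forall x, F x -> f' x = f x & f' t = t].
Proof.
move=> sF hf ft ft'; have [rF _] := sF.
have /choice[f' fP] : forall x, exists y, adj F t x -> exists p q,
    [/\ polyS F p, polyS F q, q.[t] != 0, x = p.[t] / q.[t] & y = (pmap f p).[t] / (pmap f q).[t]].
  move=> x; have [ax|] := pselect (adj F t x); last by exists 0.
  have [p [q [Fp Fq nq ->]]] := adjP sF ax.
  by exists ((pmap f p).[t] / (pmap f q).[t]) => _; exists p, q.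
have nz q : polyS F q -> q.[t] != 0 -> (pmap f q).[t] != 0.
  by move=> Fq; apply: contra_neq; exact: ft'.
have fE p q : polyS F p -> polyS F q -> q.[t] != 0 ->
    f' (p.[t] / q.[t]) = (pmap f p).[t] / (pmap f q).[t].
  move=> Fp Fq nq.
  have at_ r : polyS F r -> adj F t r.[t].
    have [rA _] := adj_subfield F t; move=> Fr; apply: (polyS_horner rA) => [i|].
      exact: adj_base.
    exact: adj_elt.
  have a : adj F t (p.[t] / q.[t]) by apply: (subfield_div (adj_subfield F t)); exact: at_.
  have [p' [q' [Fp' Fq' nq' e ->]]] := fP _ a.
  have h : (p * q' - p' * q).[t] = 0.
    rewrite !hornerE; have -> : p.[t] = p'.[t] / q'.[t] * q.[t] by rewrite -e divfK.
    by field.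
  have Fpq : polyS F (p * q') by exact: polyS_M.
  have Fpq' : polyS F (p' * q) by exact: polyS_M.
  have := ft _ (polyS_B rF Fpq Fpq') h.
  rewrite (pmapB sF hf) // !(pmapM sF hf) // hornerD hornerN !hornerM => /eqP.
  rewrite subr_eq0 => /eqP {}h; have n1 := nz _ Fq nq; have n2 := nz _ Fq' nq'.
  have -> : (pmap f p).[t] = (pmap f p').[t] * (pmap f q).[t] / (pmap f q').[t].
    by rewrite -h mulfK.
  by field; rewrite n1 n2.
have P1 : polyS F 1 by exact: polyS_1.
have pm1 : (pmap f 1).[t] = 1 by rewrite (pmapC sF hf) hornerC (hom_on1 hf).
have one0 : (1 : {poly L}).[t] != 0 by rewrite hornerC oner_eq0.
exists f'; split.
- split.
  + by have := fE 1 1 P1 P1 one0; rewrite pm1 hornerC divr1.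
  + move=> x y /(adjP sF)[p [q [Fp Fq nq ->]]] /(adjP sF)[p' [q' [Fp' Fq' nq' ->]]].
    have -> : p.[t] / q.[t] - p'.[t] / q'.[t] = (p * q' - p' * q).[t] / (q * q').[t].
      by rewrite !hornerE; field; rewrite nq nq'.
    have F1 : polyS F (p * q') by exact: polyS_M.
    have F2 : polyS F (p' * q) by exact: polyS_M.
    have F3 : polyS F (q * q') by exact: polyS_M.
    rewrite !fE ?hornerM ?mulf_neq0 //; last exact: polyS_B.
    rewrite (pmapB sF hf) // !(pmapM sF hf) // hornerD hornerN !hornerM.
    by field; rewrite !nz.
  + move=> x y /(adjP sF)[p [q [Fp Fq nq ->]]] /(adjP sF)[p' [q' [Fp' Fq' nq' ->]]].
    have -> : p.[t] / q.[t] * (p'.[t] / q'.[t]) = (p * p').[t] / (q * q').[t].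
      by rewrite !hornerM; field; rewrite nq nq'.
    have F1 : polyS F (p * p') by exact: polyS_M.
    have F3 : polyS F (q * q') by exact: polyS_M.
    rewrite !fE ?hornerM ?mulf_neq0 // !(pmapM sF hf) // !hornerM.
    by field; rewrite !nz.
- move=> x Fx; have := fE x%:P 1 (polyS_C rF Fx) P1 one0.
  by rewrite pm1 (pmapC sF hf) !hornerC !divr1.
- have := fE 'X 1 (polyS_X rF) P1 one0.
  by rewrite pm1 (pmapX sF hf) !hornerC !hornerX !divr1.
Qed.

Definition minrel F t (B : {poly L}) := [/\ polyS F B, B \is monic, B.[t] = 0 &
  forall p, polyS F p -> (size p < size B)%N -> p.[t] = 0 -> p = 0].

Lemma minrel_ex F t : subfield F -> (exists p, [/\ polyS F p, p != 0 & p.[t] = 0]) ->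
  exists B, minrel F t B.
Proof.
move=> [rF VF] [p0 [Fp0 p00 rp0]].
have [|N [p [Fp np rp sp]] min] := @least_nat (fun N => exists p : {poly L},
  [/\ polyS F p, p != 0, p.[t] = 0 & size p = N]); first by exists (size p0), p0.
exists ((lead_coef p)^-1 *: p); split.
- by apply: polyS_Z => //; apply: VF; exact: Fp.
- by rewrite monicE lead_coefZ mulVf // lead_coef_eq0.
- by rewrite hornerZ rp mulr0.
- move=> q Fq; rewrite size_scale ?invr_eq0 ?lead_coef_eq0 // sp => sq rq.
  by apply: contraTeq sq => nq; rewrite -leqNgt; apply: min; exists q.
Qed.

Lemma minrel_div F t B p : subfield F -> minrel F t B -> polyS F p -> p.[t] = 0 ->
  exists2 u, polyS F u & p = u * B.
Proof.
move=> [rF _] [FB mB rB min].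
elim/ltn_ind: {p}(size p) {-2}p (erefl (size p)) => N IH p sp Fp rp.
have [lt|ge] := ltnP (size p) (size B).
  by exists 0; [exact: polyS_0|rewrite mul0r (min p)].
have [p0|np] := eqVneq p 0; first by exists 0; [exact: polyS_0|rewrite mul0r p0].
pose c := lead_coef p *: 'X^(size p - size B).
have Fc : polyS F c by apply: polyS_Z => //; [exact: Fp|apply: polyS_X_exp => //; exact: polyS_X].
have nc : c != 0 by rewrite scaler_eq0 negb_or lead_coef_eq0 np -size_poly_eq0 size_polyXn.
have sc : size (c * B) = size p.
  rewrite size_Mmonic // size_scale ?lead_coef_eq0 // size_polyXn.
  by rewrite addSn /= subnK.
have [|||u Fu eu] := IH (size (p - c * B)) _ (p - c * B) erefl.
- rewrite -sp -(prednK (n := size p)) ?size_poly_gt0 // ltnS; apply/leq_sizeP => i hi.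
  rewrite coefB; have [e|ne] := eqVneq i (size p).-1.
    rewrite e -lead_coefE; have -> : (size p).-1 = (size (c * B)).-1 by rewrite sc.
    rewrite -lead_coefE lead_coef_Mmonic // lead_coefZ lead_coefXn mulr1 subrr //.
  have hi' : (size p <= i)%N by rewrite -(prednK (n := size p)) ?size_poly_gt0 // ltn_neqAle eq_sym ne.
  by rewrite !nth_default ?subrr ?sc.
- by apply: polyS_B => //; exact: polyS_M.
- by rewrite hornerD hornerN hornerM rp rB mulr0 subrr.
exists (u + c); first exact: polyS_D.
by rewrite mulrDl -eu subrK.
Qed.

(** Peel off an irreducible factor: a divisor either contains it or is coprime to it and divides the
    cofactor. The list later bounds the images of a minimal polynomial under automorphisms. *)
Lemma fin_set_monic_divisors (p : {poly L}) : p != 0 ->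
  fin_set (fun q : {poly L} => q \is monic /\ q %| p).
Proof.
elim/ltn_ind: {p}(size p) {-2}p (erefl (size p)) => N IH p sp np.
have [le|gt] := leqP (size p) 1.
  exists [:: 1] => q [mq qp]; rewrite inE.
  have sq : (size q <= 1)%N by apply: leq_trans le; exact: dvdp_leq.
  move: mq; have [c ->] : exists c, q = c%:P by exists q`_0; exact: size1_polyC.
  by rewrite monicE lead_coefC => /eqP ->.
have [pi irr /dvdpP[r er]] := irreducible_factor gt.
have npi := irredp_neq0 irr; have lpi : lead_coef pi != 0 by rewrite lead_coef_eq0.
have nr : r != 0 by apply: contraNneq np => r0; rewrite er r0 mul0r.
have sr : (size r < N)%N.
  rewrite -sp er size_mul //; have := irr.1; case: (size pi) => [|[|d]] //= _.
  by rewrite !addnS /= ltnS leq_addr.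
have [l lP] := IH _ sr r erefl nr.
exists (l ++ [seq ((lead_coef pi)^-1 *: q) * pi | q <- l]) => q [mq qp]; rewrite mem_cat.
have [/dvdpP[q1 e1]|ndiv] := boolP (pi %| q).
  apply/orP; right; apply/mapP; exists (lead_coef pi *: q1); last first.
    by rewrite scalerA mulVf // scale1r.
  apply: lP; split.
    by rewrite monicE lead_coefZ mulrC -lead_coefM -e1.
  rewrite dvdpZl //; move: qp; rewrite er e1 dvdp_mul2r //.
apply/orP; left; apply: lP; split=> //.
have cop : coprimep q pi.
  apply: contraNT ndiv => nc; rewrite coprimep_sym in nc.
  by have /eqp_dvdl <- := irr _ nc (dvdp_gcdl pi q); exact: dvdp_gcdr.
by rewrite -(Gauss_dvdpl _ cop) -er.
Qed.

End Subfields.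

(** * Towers of plain extensions and their union *)

Section Towers.
Variables (m : nat) (L : DField m.+1).
Implicit Types (E : L -> Prop) (t x : L) (ts us : seq L).
Local Notation d := (der L ord0).

(* A step adjoins a single element to a plain field: closure under the other
   derivations is recovered for the union [lunion] of all towers. *)
Definition lstep E t := [\/ E (d t), (t != 0 /\ E (d t / t)) |
  exists p : {poly L}, [/\ p != 0, polyS E p & root p t]].

Fixpoint ltower E ts := if ts is t :: ts' then lstep E t /\ ltower (adj E t) ts' else True.

Fixpoint adjs E ts := if ts is t :: ts' then adjs (adj E t) ts' else E.

Lemma lstepS E E' t : (forall x, E x -> E' x) -> lstep E t -> lstep E' t.
Proof.
move=> EE' [/EE'|[t0 /EE']|[p [p0 Ep rp]]]; [by constructor 1|by constructor 2|].
by constructor 3; exists p; split=> // i; exact: EE'.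
Qed.

Lemma adjsS E E' ts x : (forall y, E y -> E' y) -> adjs E ts x -> adjs E' ts x.
Proof. by elim: ts E E' => [|t ts IH] E E' EE' /=; [exact: EE'|apply: IH => y; exact: adjS]. Qed.

Lemma ltowerS E E' ts : (forall x, E x -> E' x) -> ltower E ts -> ltower E' ts.
Proof.
elim: ts E E' => //= t ts IH E E' EE' [/(lstepS EE') st tt]; split=> //.
by apply: IH tt => x; exact: adjS.
Qed.

Lemma adjs_base E ts x : E x -> adjs E ts x.
Proof. by elim: ts E => //= t ts IH E Ex; apply: IH; exact: adj_base. Qed.

Lemma adjs_subfield E ts : subfield E -> subfield (adjs E ts).
Proof. by elim: ts E => //= t ts IH E sE; apply: IH; exact: adj_subfield. Qed.

Lemma adjs_cat E ts us x : adjs E (ts ++ us) x <-> adjs (adjs E ts) us x.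
Proof. by elim: ts E => //= t ts IH E. Qed.

Lemma ltower_cat E ts us : ltower E (ts ++ us) <-> ltower E ts /\ ltower (adjs E ts) us.
Proof. by elim: ts E => [|t ts IH] E /=; rewrite ?IH; intuition. Qed.

Lemma adjs_sub E F ts x : subfield F -> (forall y, E y -> F y) ->
  (forall t, t \in ts -> F t) -> adjs E ts x -> F x.
Proof.
move=> sF; elim: ts E => [|t ts IH] E EF tF /=; first exact: EF.
apply: IH => [y ay|u us]; last by apply: tF; rewrite inE us orbT.
by apply: (ay F) => // z [/EF|->] //; apply: tF; exact: mem_head.
Qed.

Lemma ltower_nth E ts i : ltower E ts -> (i < size ts)%N ->
  lstep (adjs E (take i ts)) (nth 0 ts i).
Proof. by elim: ts E i => [|t ts IH] E [|i] //= [st tt] //; exact: IH. Qed.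

Lemma der_horner i (p : {poly L}) t :
  der L i p.[t] = (map_poly (der L i) p).[t] + p^`().[t] * der L i t.
Proof.
elim/poly_ind: p => [|p c IH]; first by rewrite raddf0 deriv0 !horner0 raddf0 mul0r addr0.
have -> : map_poly (der L i) (p * 'X + c%:P) = map_poly (der L i) p * 'X + (der L i c)%:P.
  apply/polyP => a; rewrite coef_map !coefD !coefMX !coefC /= raddfD /=.
  by case: (a == 0%N); rewrite ?raddf0 ?coef_map.
rewrite derivD derivC addr0 derivM derivX mulr1 !hornerE /= raddfD /= derM IH.
by ring.
Qed.

Lemma adj_der E F i t : subfield F -> (forall x, E x -> F x) ->
  (forall x, E x -> F (der L i x)) -> F t -> F (der L i t) ->
  forall x, adj E t x -> F x /\ F (der L i x).
Proof.
move=> [rF VF] EF dEF Ft Fdt x ax.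
apply: (ax (fun y => F y /\ F (der L i y))) => [|y [Ey|->]] //; last first.
  by split; [exact: EF|exact: dEF].
split; first split.
- by rewrite der1; split; [exact: (subring1 rF)|exact: (subring0 rF)].
- by move=> u v [Fu Fdu] [Fv Fdv]; rewrite raddfB; split; exact: (subringB rF).
- move=> u v [Fu Fdu] [Fv Fdv]; rewrite derM; split; first exact: (subringM rF).
  by apply: (subringD rF); exact: (subringM rF).
- move=> u [Fu Fdu]; have [->|u0] := eqVneq u 0.
    by rewrite invr0 raddf0; split; exact: (subring0 rF).
  rewrite derV //; split; first exact: VF.
  apply: (subringM rF); first exact: (subringN rF).
  by apply: VF; exact: (subringX rF).
Qed.

(** Implicit differentiation of the minimal relation [B], whose formal derivative does not vanish at
    [t] by minimality and characteristic zero. *)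
Lemma der_algebraic E F i t p : [pchar L] =i pred0 -> subfield E -> subfield F ->
  (forall x, E x -> F x) -> (forall x, E x -> F (der L i x)) -> F t ->
  p != 0 -> polyS E p -> root p t -> F (der L i t).
Proof.
move=> ch0 sE sF EF dEF Ft p0 Ep rp; have [rF VF] := sF.
have [B [EB mB rB min]] := minrel_ex sE (ex_intro _ p (And3 Ep p0 (eqP rp))).
have := der_horner i B t; rewrite rB raddf0 => e.
have sB : (0 < size B)%N by rewrite size_poly_gt0 monic_neq0.
have B'0 : B^`().[t] != 0.
  apply/eqP => r'.
  have /polyP/(_ (size B).-2) : B^`() = 0.
    apply: min => //; last exact: lt_size_deriv (monic_neq0 mB).
    by apply: polyS_deriv => //; case: sE.
  rewrite coef_deriv coef0.
  have s2 : (1 < size B)%N.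
    rewrite ltnNge; apply/negP => /size1_polyC; move: (B`_0) => c ec.
    by move: mB rB; rewrite ec monicE lead_coefC hornerC => /eqP -> /eqP; rewrite oner_eq0.
  have -> : (size B).-2.+1 = (size B).-1 by lia.
  rewrite -lead_coefE (monicP mB) => /eqP; move/pcharf0P: ch0 => ->; lia.
have -> : der L i t = - (map_poly (der L i) B).[t] / B^`().[t].
  apply: (mulfI B'0); rewrite mulrCA divff // mulr1; apply/eqP.
  by rewrite -addr_eq0 addrC -e.
apply: (subfield_div sF).
  apply: (subringN rF); apply: (polyS_horner rF) => // a; rewrite coef_map /=.
  exact: dEF.
by apply: (polyS_horner rF) => //; apply: (polyS_deriv rF) => a; exact: EF.
Qed.

Section Union.
Variable k0 : L -> Prop.
Hypotheses (sk : subfield k0) (dk : forall i x, k0 x -> k0 (der L i x)).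

Definition lunion x := exists2 ts, ltower k0 ts & adjs k0 ts x.

(** Towers over [k0] can be concatenated, since a tower stays a tower over a larger base. *)
Lemma lunion_common (xs : seq L) : (forall x, x \in xs -> lunion x) ->
  exists2 ts, ltower k0 ts & forall x, x \in xs -> adjs k0 ts x.
Proof.
elim: xs => [|x xs IH] h; first by exists [::].
have [|ts tts tsP] := IH; first by move=> y yx; apply: h; rewrite inE yx orbT.
have [us tus usx] := h x (mem_head _ _).
have kt y : k0 y -> adjs k0 ts y by exact: adjs_base.
exists (ts ++ us); first by apply/ltower_cat; split=> //; exact: ltowerS tus.
move=> y; rewrite inE => /orP[/eqP->|/tsP h']; apply/adjs_cat; first exact: adjsS usx.
exact: adjs_base.
Qed.

Lemma lunion_subfield : subfield lunion.
Proof.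
split; first split.
- by exists [::] => //; case: sk => rk _; exact: subring1.
- move=> x y Wx Wy; have [|ts tts tsP] := @lunion_common [:: x; y].
    by move=> z; rewrite !inE => /orP[/eqP->|/eqP->].
  have [rA _] := adjs_subfield ts sk.
  by exists ts => //; apply: (subringB rA); apply: tsP; rewrite !inE eqxx ?orbT.
- move=> x y Wx Wy; have [|ts tts tsP] := @lunion_common [:: x; y].
    by move=> z; rewrite !inE => /orP[/eqP->|/eqP->].
  have [rA _] := adjs_subfield ts sk.
  by exists ts => //; apply: (subringM rA); apply: tsP; rewrite !inE eqxx ?orbT.
- by move=> x [ts tts tsx]; exists ts => //; apply: subfieldV => //; exact: adjs_subfield.
Qed.

Lemma lunion_base x : k0 x -> lunion x. Proof. by exists [::]. Qed.

Lemma lunion_step t : lstep lunion t -> lunion t.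
Proof.
move=> st; suff [ts tts st'] : exists2 ts, ltower k0 ts & lstep (adjs k0 ts) t.
  exists (ts ++ [:: t]); first by apply/ltower_cat.
  by apply/adjs_cat; exact: adj_elt.
case: st => [[ts tts e]|[t0 [ts tts e]]|[p [p0 Wp rp]]].
- by exists ts => //; constructor 1.
- by exists ts => //; constructor 2.
have [x /(nthP 0)[i _ <-]|ts tts tsP] := @lunion_common p; first exact: Wp.
exists ts => //; constructor 3; exists p; split=> // i.
have [lt|ge] := ltnP i (size p); first by apply: tsP; rewrite mem_nth.
by rewrite nth_default //; have [rA _] := adjs_subfield ts sk; exact: subring0.
Qed.

(** Derivations commute. So if [t] is a primitive, [der L i t] is a primitive of [der L i (d t)]; if
    [t] is an exponential, [der L i t / t] is a primitive of the derivative of [d t / t]. An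
    algebraic [t] needs no new step. *)
Lemma lunion_der x i : [pchar L] =i pred0 -> lunion x -> lunion (der L i x).
Proof.
move=> ch0 [ts]; elim/last_ind: ts x => [|ts t IH] x tts ax; first by apply/lunion_base/dk.
have [tts' st] : ltower k0 ts /\ lstep (adjs k0 ts) t.
  by move: tts; rewrite -cats1 => /ltower_cat /= [? []].
have {ax} ax : adj (adjs k0 ts) t x by move: ax; rewrite -cats1 => /adjs_cat.
have sA := adjs_subfield ts sk; have sW := lunion_subfield; have [rW VW] := sW.
have WA y : adjs k0 ts y -> lunion y by exists ts.
have Wt : lunion t by apply: lunion_step; exact: lstepS st.
suff Wdt : lunion (der L i t).
  by have [] := @adj_der (adjs k0 ts) lunion i t sW WA (fun y => @IH y tts') Wt Wdt x ax.
case: st => [e|[t0 e]|[p [p0 Ap rp]]].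
- by apply: lunion_step; constructor 1; rewrite der_comm; exact: IH.
- have -> : der L i t = der L i t / t * t by rewrite divfK.
  apply: subringM => //; apply: lunion_step; constructor 1.
  have -> : d (der L i t / t) = der L i (d t / t).
    by rewrite !der_div // der_comm; congr (_ / _); ring.
  exact: IH.
exact: der_algebraic ch0 sA sW WA (fun y => @IH y tts') Wt p0 Ap rp.
Qed.
End Union.
End Towers.

Lemma liouvillian_lunion m (k L : DField m.+1) (psi : {rmorphism k -> L}) :
  [pchar k] =i pred0 -> param_liouvillian psi ->
  forall x, lunion (fun y => exists a, psi a = y) x.
Proof.
move=> ch0 [dpsi _ [ts [gen step]]] x; set k0 := fun y => _.
have chL : [pchar L] =i pred0.
  move=> p; rewrite -(ch0 p) !inE; congr (_ && _).
  by rewrite -(rmorph_nat psi) fmorph_eq0.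
have sk : subfield k0 := image_subfield psi.
have dk i y : k0 y -> k0 (der L i y) by move=> [a <-]; exists (der k i a).
have sW := lunion_subfield sk; have [rW VW] := sW.
have dW : dsubfield (lunion k0).
  split.
  - by split; [exact: subring0|exact: subring1].
  - by move=> u v; exact: subringB.
  - by move=> u v; exact: subringM.
  - by move=> u Wu _; exact: VW.
  - by move=> i u Wu; apply: lunion_der.
have kW a : lunion k0 (psi a) by apply: lunion_base; exists a.
have tsW i : (i <= size ts)%N -> forall y, y \in take i ts -> lunion k0 y.
  elim: i => [|i IH] lt y; first by rewrite take0.
  rewrite (take_nth 0) // mem_rcons inE => /orP[/eqP->|]; last exact: IH (ltnW lt) y.
  have LW z : dgen psi (fun y => y \in take i ts) z -> lunion k0 z.
    by apply=> // u; exact: IH (ltnW lt) u.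
  apply: lunion_step => //; case: (step i lt) => [/LW|[t0 /LW]|[p [p0 Lp rp]]].
  - by constructor 1.
  - by constructor 2.
  - by constructor 3; exists p; split=> // l; exact: LW.
by apply: gen => // y; have := tsW _ (leqnn _) y; rewrite take_size.
Qed.

(** * The PPV group *)

Section GaloisGroup.
Variables (m : nat) (k K : DField m.+1) (phi : k -> K).

(** Packaged as a type so that the results on abstract groups apply; proof irrelevance reduces
    equality to that of functions. *)
Record dgal := DGal { dgal_fun :> K -> K; dgal_P : PPV_group phi dgal_fun }.

Lemma dgal_inj (s t : dgal) : dgal_fun s = dgal_fun t -> s = t.
Proof. by case: s t => [f fP] [g gP] /= e; subst g; congr DGal; exact: Prop_irrelevance. Qed.

Lemma dgal_zmod (s : dgal) : zmod_morphism (dgal_fun s).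
Proof.
case: s => f [fD _ _ _ _] /= x y.
by apply: (addIr (f y)); rewrite -fD !subrK.
Qed.

Lemma dgal_monoid (s : dgal) : monoid_morphism (dgal_fun s).
Proof.
case: s => f [fD fM [g fg gf] _ _] /=; split=> //.
by rewrite -[RHS](gf 1) -[g 1]mul1r fM gf mulr1.
Qed.
HB.instance Definition _ (s : dgal) := GRing.isZmodMorphism.Build K K (dgal_fun s) (dgal_zmod s).
HB.instance Definition _ (s : dgal) := GRing.isMonoidMorphism.Build K K (dgal_fun s) (dgal_monoid s).

Lemma dgal_phi (s : dgal) a : s (phi a) = phi a. Proof. by case: s => f []. Qed.
Lemma dgal_der (s : dgal) i x : s (der K i x) = der K i (s x). Proof. by case: s => f []. Qed.

Lemma dgal_one_P : PPV_group phi id. Proof. by split=> //; exists id. Qed.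

Lemma dgal_mul_P (s t : dgal) : PPV_group phi (s \o t).
Proof.
case: s t => [f [fD fM bf fp fd]] [g [gD gM bg gp gd]]; split=> /= [x y|x y||a|i x].
- by rewrite gD fD.
- by rewrite gM fM.
- exact: bij_comp.
- by rewrite gp fp.
- by rewrite gd fd.
Qed.

Lemma dgal_inv_ex (s : dgal) : exists g, PPV_group phi g /\ cancel (dgal_fun s) g /\ cancel g (dgal_fun s).
Proof.
case: s => [f [fD fM [g fg gf] fp fd]]; exists g; split=> //; split.
- by move=> x y; apply: (can_inj fg); rewrite fD !gf.
- by move=> x y; apply: (can_inj fg); rewrite fM !gf.
- by exists f.
- by move=> a; apply: (can_inj fg); rewrite gf fp.
- by move=> i x; apply: (can_inj fg); rewrite fd !gf.
Qed.

Definition dgal_one := DGal dgal_one_P.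
Definition dgal_mul s t := DGal (dgal_mul_P s t).
Definition dgal_inv (s : dgal) : dgal :=
  let: exist g h := cid (dgal_inv_ex s) in DGal (proj1 h).

Lemma dgal_invK s : cancel (dgal_fun (dgal_inv s)) (dgal_fun s).
Proof. by rewrite /dgal_inv; case: (cid _) => g [? []]. Qed.
Lemma dgal_Kinv s : cancel (dgal_fun s) (dgal_fun (dgal_inv s)).
Proof. by rewrite /dgal_inv; case: (cid _) => g [? []]. Qed.

Lemma dgal_mulA : associative dgal_mul. Proof. by move=> s t u; apply: dgal_inj. Qed.
Lemma dgal_mul1 : left_id dgal_one dgal_mul. Proof. by move=> s; apply: dgal_inj. Qed.
Lemma dgal_1mul : right_id dgal_one dgal_mul. Proof. by move=> s; apply: dgal_inj. Qed.
Lemma dgal_mulV : left_inverse dgal_one dgal_inv dgal_mul.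
Proof. by move=> s; apply: dgal_inj; apply/funext => x; exact: dgal_Kinv. Qed.
Lemma dgal_Vmul : right_inverse dgal_one dgal_inv dgal_mul.
Proof. by move=> s; apply: dgal_inj; apply/funext => x; exact: dgal_invK. Qed.

HB.instance Definition _ := gen_eqMixin dgal.
HB.instance Definition _ := gen_choiceMixin dgal.
HB.instance Definition _ := isGroup.Build dgal dgal_mulA dgal_mul1 dgal_1mul dgal_mulV dgal_Vmul.

Lemma dgalE (s t : dgal) x : (s * t)%g x = s (t x). Proof. by []. Qed.
Lemma dgal1E x : (1%g : dgal) x = x. Proof. by []. Qed.
Lemma dgalVK (s : dgal) x : (s^-1)%g (s x) = x. Proof. exact: dgal_Kinv. Qed.
Lemma dgalKV (s : dgal) x : s ((s^-1)%g x) = x. Proof. exact: dgal_invK. Qed.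

Lemma sgrp_full : sgrp (fun _ : dgal => True). Proof. by []. Qed.

Lemma vsolv_statement : vsolv (fun _ : dgal => True) ->
  exists H : (K -> K) -> Prop,
    [/\ subgroup_of (PPV_group phi) H, solvable_grp H & finite_index (PPV_group phi) H].
Proof.
move=> [H [[H1 HM HV] _ fi [r solH]]].
pose im (A : dgal -> Prop) (f : K -> K) := exists2 s : dgal, A s & f = s.
have sub_im (A B : dgal -> Prop) : sgrp B -> (forall s, B s -> A s) -> subgroup_of (im A) (im B).
  move=> [b1 bM bV] BA; split.
  - by move=> f [s /BA As ->]; exists s.
  - by exists 1%g.
  - by move=> f g [s Bs ->] [t Bt ->]; exists (s * t)%g => //; exact: bM.
  - move=> f [s Bs ->]; exists (s^-1)%g; first by exists (s^-1)%g => //; exact: bV.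
    by split; apply/funext => x /=; [exact: dgalKV|exact: dgalVK].
exists (im H); split.
- have [h1 h2 h3 h4] := sub_im (fun _ => True) H (And3 H1 HM HV) (fun _ _ => I).
  split=> //; by move=> f [s _ ->]; exact: dgal_P.
- have sH : sgrp H by [].
  elim: r H {H1 HM HV fi} sH solH => [|r IH] H sH /=.
    move=> tH; exists 0%N, (fun _ => im H); split=> // f; split=> [[s /tH -> ->]|->] //.
    by exists 1%g => //; case: sH.
  move=> [H1 [s1 H1H cH solH1]].
  have [r' [Hs [Hs0 Hsr Hsi]]] := IH H1 s1 solH1.
  exists r'.+1, (fun i => if i is i'.+1 then Hs i' else im H); split=> //.
  move=> [|i] lt; last exact: Hsi.
  have e f : Hs 0%N f <-> im H1 f by exact: Hs0.
  have [h1 h2 h3 h4] := sub_im H H1 s1 H1H.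
  split.
  + split=> [f /e/h1 //||f g /e hf /e hg|f /e/h4[g hg ?]]; [exact/e|exact/e/h3|].
    by exists g => //; exact/e.
  + move=> f g [s Hs_ ->] /e[t H1t ->]; exists (s * t * s^-1)%g.
      apply/e; exists (s * t * s^-1)%g => //.
      have -> : (s * t * s^-1 = t * [~ t, s^-1])%g.
        by rewrite gcommE ginvK !mulgA mulgV mul1g.
      case: s1 => _ M1 _; apply: M1 => //; apply: cH; first exact: H1H.
      by case: sH => _ _; apply.
    by apply/funext => x /=; rewrite dgalVK.
  + move=> f g [s Hs_ ->] [t Ht ->]; exists [~ s, t]%g.
      by apply/e; exists [~ s, t]%g => //; exact: cH.
    apply/funext => x; rewrite -[LHS]/((s * t)%g x) -[RHS]/((t * (s * [~ s, t]))%g x).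
    by rewrite commgC mulgA.
- have [T [t tP]] := fi; have [rr [_ rP]] := reps sgrp_full tP.
  exists #|T|, (fun i => dgal_fun (rr (nth (t 1%g) (enum T) i))) => f fG.
  pose s := DGal fG; exists (index (t s) (enum T)), ((rr (t s))^-1 * s)%g; split.
  + by rewrite cardT index_mem mem_enum.
  + by exists ((rr (t s))^-1 * s)%g => //; exact: rP.
  + by rewrite nth_index ?mem_enum //; apply/funext => x /=; rewrite dgalKV.
Qed.

Lemma statement_solv (H : (K -> K) -> Prop) : subgroup_of (PPV_group phi) H ->
  solvable_grp H -> finite_index (PPV_group phi) H ->
  [/\ sgrp (fun s : dgal => H s), findex (fun _ : dgal => True) (fun s : dgal => H s)
    & exists r, solv r (fun s : dgal => H s)].
Proof.
have key (G0 H' : (K -> K) -> Prop) : subgroup_of G0 H' -> (forall f, H' f -> PPV_group phi f) ->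
    sgrp (fun s : dgal => H' s).
  move=> [_ h1 hM hV] HG; split=> // [s t|s hs]; first exact: hM.
  have [g hg [e1 e2]] := hV _ hs.
  suff -> : dgal_fun s^-1%g = g by [].
  by apply/funext => x; rewrite -[RHS](dgalVK s); congr ((s^-1)%g _); rewrite -{1}[x]/(id x) -e1.
move=> sH [r [Hs [Hs0 Hsr Hsi]]] [N [c cP]]; have [HG _ _ _] := sH.
have sgH := key _ _ sH HG; split=> //.
  have /choice[i iP] : forall s : dgal, exists i : 'I_N, exists h, H h /\ dgal_fun s = c i \o h.
    move=> s; have [i [h [lt hh e]]] := cP _ (dgal_P s).
    by exists (Ordinal lt), h.
  exists 'I_N, i => s t _ _ e.
  have [h [Hh es]] := iP s; have [h' [Hh' et]] := iP t.
  pose a := DGal (HG _ Hh); pose b := DGal (HG _ Hh').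
  suff -> : (s^-1 * t = a^-1 * b)%g by case: sgH => _ hM hV; apply: hM => //; exact: hV.
  apply: dgal_inj; apply/funext => x /=.
  (* In [finite_index] the [c i] are arbitrary functions; this one is recovered from [s] and [a],
     and then compared with [t] and [b]. *)
  have ec z : c (i s) z = s (a^-1%g z).
    by rewrite es /=; congr (c _ _); rewrite -[LHS](dgalKV a).
  by rewrite {1}et /= -e ec dgalVK.
exists r.
have : forall d j, (j + d = r)%N -> solv d (fun s : dgal => Hs j s).
  elim=> [|d IH] j ejd /=.
    by move=> s; rewrite addn0 in ejd; rewrite ejd => /Hsr e; apply: dgal_inj.
  have lt : (j < r)%N by lia.
  have [sub nor com] := Hsi j lt.
  have HsG f l : (l <= r)%N -> Hs l f -> PPV_group phi f.
    elim: l f => [|l IHl] f ll; first by move/Hs0/HG.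
    by have [[h _ _ _] _ _] := Hsi l ll; move/h; apply: IHl; exact: ltnW.
  exists (fun s : dgal => Hs j.+1 s); split.
  - by apply: key sub _ => f; exact: HsG.
  - by case: sub => h _ _ _ s; exact: h.
  - move=> s t hs ht; have [u hu e] := com _ _ hs ht.
    suff -> : dgal_fun [~ s, t]%g = u by [].
    apply/funext => x; rewrite gcommE /=.
    have -> : s (t x) = t (s (u x)) by have := congr1 (fun f => f x) e.
    by rewrite !dgalVK.
  - by apply: IH => //; lia.
move=> /(_ r 0%N (add0n r)); apply: solv_sub => // s; exact: (Hs0 _).2.
Qed.
End GaloisGroup.

(** * Solvability from liouvillian towers *)

Section PPVMatrix.
Variables (m n : nat) (k K : DField m.+1) (A : 'M[k]_n) (phi : {rmorphism k -> K}).
Hypotheses (dphi : dmorph phi) (nnc : no_new_constants phi).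
Variable Z : 'M[K]_n.
Hypotheses (uZ : Z \in unitmx) (dZ : map_mx (der K ord0) Z = map_mx phi A *m Z)
  (genZ : forall x : K, dgen phi (fun y => exists i j, y = Z i j) x).

(** Since [s] commutes with the derivation and fixes [A], the matrix [map_mx s Z] is another
    solution. Two solutions differ by a constant matrix, and constants come from [k]. *)
Lemma dgal_matrix (s : dgal phi) : exists2 M : 'M[k]_n,
  map_mx s Z = Z *m map_mx phi M & forall a b, der K ord0 (phi (M a b)) = 0.
Proof.
have ds : map_mx (der K ord0) (map_mx s Z) = map_mx phi A *m map_mx s Z.
  have -> : map_mx (der K ord0) (map_mx s Z) = map_mx s (map_mx (der K ord0) Z).
    by apply/matrixP => a b; rewrite !mxE dgal_der.
  rewrite dZ map_mxM; congr (_ *m _); apply/matrixP => a b; rewrite !mxE; exact: dgal_phi.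
have dM := der_solutions uZ dZ ds.
have /choice[M MP] : forall ab : 'I_n * 'I_n, exists c, phi c = (invmx Z *m map_mx s Z) ab.1 ab.2.
  by move=> ab; apply: nnc; move/matrixP/(_ ab.1 ab.2): dM; rewrite !mxE.
exists (\matrix_(a, b) M (a, b)); last first.
  by move=> a b; rewrite mxE MP; move/matrixP/(_ a b): dM; rewrite !mxE.
rewrite -[LHS](mulKVmx uZ); congr (_ *m _).
by apply/matrixP => a b; rewrite [RHS]mxE mxE MP.
Qed.

Lemma dgal_eq_on (s t : dgal phi) : map_mx s Z = map_mx t Z -> s = t.
Proof.
move=> e; apply: dgal_inj; apply/funext => x.
apply: (genZ x (P := fun x => s x = t x)) => [|a|_ [i [j ->]]].
- split=> [|u v eu ev|u v eu ev|u eu _|i u eu].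
  + by rewrite !rmorph0 !rmorph1.
  + by rewrite !rmorphB /= eu ev.
  + by rewrite !rmorphM /= eu ev.
  + by rewrite !fmorphV /= eu.
  + by rewrite !dgal_der eu.
- by rewrite !dgal_phi.
- by move/matrixP/(_ i j): e; rewrite !mxE.
Qed.

Section Liouvillian.
Variables (L : DField m.+1) (psi : {rmorphism k -> L}) (chi : {rmorphism K -> L}).
Hypotheses (dpsi : dmorph psi) (dchi : dmorph chi) (chi_phi : forall a, chi (phi a) = psi a)
  (nncL : no_new_constants psi) (ch0 : [pchar L] =i pred0).
Local Notation d := (der L ord0).
Local Notation G := (dgal phi).

Definition zfield (E : L -> Prop) := fgen (fun x => E x \/ exists a b, x = chi (Z a b)).

Lemma zfield_subfield E : subfield (zfield E). Proof. exact: fgen_subfield. Qed.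
Lemma zfield_base E x : E x -> zfield E x. Proof. by move=> Ex; apply: fgen_base; left. Qed.
Lemma zfield_Z E a b : zfield E (chi (Z a b)).
Proof. by apply: fgen_base; right; exists a, b. Qed.
Lemma zfieldS E E' x : (forall y, E y -> E' y) -> zfield E x -> zfield E' x.
Proof.
move=> EE' h; apply: (h (zfield E')) => [|y [/EE'|[a [b ->]]]]; [exact: zfield_subfield|exact: zfield_base|exact: zfield_Z].
Qed.

(* [f] realizes [s] on [E(Z)]; two mutually inverse realizations make [s] an
   automorphism of [E(Z)] over [E]. *)
Definition isext E (s : G) f := [/\ hom_on (zfield E) f, (forall x, E x -> f x = x)
  & forall a b, f (chi (Z a b)) = chi (s (Z a b))].

Definition GE E (s : G) := (exists f, isext E s f) /\ exists f, isext E s^-1%g f.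

Section Base.
Variable E : L -> Prop.
Hypotheses (sE : subfield E) (kE : forall a, E (psi a)) (dE : forall x, E x -> E (d x)).
Let F := zfield E.
Let sF : subfield F := zfield_subfield E.
Let rF : subring F. Proof. by case: sF. Qed.

Lemma constE c : d c = 0 -> E c. Proof. by move=> /nncL[a <-]. Qed.

Lemma chi_sZ (s : G) : exists M : 'M[k]_n, (forall a b,
  chi (s (Z a b)) = \sum_c chi (Z a c) * psi (M c b)) /\
  forall (t : G) a b, chi (t (s (Z a b))) = \sum_c chi (t (Z a c)) * psi (M c b).
Proof.
have [M eM _] := dgal_matrix s; exists M.
have e a b : s (Z a b) = \sum_c Z a c * phi (M c b).
  by move/matrixP/(_ a b): eM; rewrite !mxE => ->; apply: eq_bigr => c _; rewrite mxE.
split=> [a b|t a b]; rewrite e !rmorph_sum; apply: eq_bigr => c _; rewrite !rmorphM /=.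
  by rewrite chi_phi.
by rewrite dgal_phi chi_phi.
Qed.

Lemma isext_stable s f x : isext E s f -> F x -> F (f x).
Proof.
move=> [hf fE fZ] Fx; have sP := hom_preim_subfield sF hf sF.
suff [] : F x /\ F (f x) by [].
apply: (Fx (fun x => F x /\ F (f x))) => // y [Ey|[a [b ->]]].
  by rewrite fE //; split; exact: zfield_base.
split; first exact: zfield_Z.
have [M [eM _]] := chi_sZ s; rewrite fZ eM; apply: (subring_sum rF) => // c _.
by apply: (subringM rF) => //; [exact: zfield_Z|apply: zfield_base].
Qed.

Lemma isext_comp s t f g : isext E s f -> isext E t g -> isext E (s * t)%g (f \o g).
Proof.
move=> ef eg; have [hf fE fZ] := ef; have [hg gE gZ] := eg; split.
- by apply: hom_on_comp => // x; exact: isext_stable eg.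
- by move=> x Ex /=; rewrite gE // fE.
- move=> a b; have [M [eM eM']] := chi_sZ t.
  rewrite /= gZ eM (hom_on_sum sF hf) => [|c _]; last first.
    by apply: (subringM rF) => //; [exact: zfield_Z|apply: zfield_base].
  rewrite [RHS](eM' s); apply: eq_bigr => c _; rewrite (hom_onM hf) ?fZ ?fE //.
    exact: zfield_Z.
  exact: zfield_base.
Qed.

Lemma isext_uniq s f f' x : isext E s f -> isext E s f' -> F x -> f x = f' x.
Proof.
move=> [hf fE fZ] [hf' fE' fZ'] Fx; suff [] : F x /\ f x = f' x by [].
apply: (Fx (fun x => F x /\ f x = f' x)) => [|y [Ey|[a [b ->]]]].
- split; first split.
  + by split; [exact: (subring1 rF)|rewrite (hom_on1 hf) (hom_on1 hf')].
  + move=> u v [Fu eu] [Fv ev]; split; first exact: (subringB rF).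
    by rewrite (hom_onB hf) ?(hom_onB hf') ?eu ?ev.
  + move=> u v [Fu eu] [Fv ev]; split; first exact: (subringM rF).
    by rewrite (hom_onM hf) ?(hom_onM hf') ?eu ?ev.
  + move=> u [Fu eu]; split; first exact: (subfieldV sF).
    by rewrite (hom_onV sF hf) ?(hom_onV sF hf') ?eu.
- by split; [exact: zfield_base|rewrite fE ?fE'].
- by split; [exact: zfield_Z|rewrite fZ fZ'].
Qed.

Lemma isext_id : isext E 1%g id. Proof. by split. Qed.

Lemma isextK s f g x : isext E s f -> isext E s^-1%g g -> F x -> g (f x) = x.
Proof.
move=> ef eg; have := isext_comp eg ef; rewrite mulVg => e Fx.
exact: (isext_uniq e isext_id).
Qed.

Lemma sgrp_GE : sgrp (GE E).
Proof.
split.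
- by split; exists id; rewrite ?invg1; exact: isext_id.
- move=> s t [[f ef] [f' ef']] [[g eg] [g' eg']]; split; first by exists (f \o g); exact: isext_comp.
  by exists (g' \o f'); rewrite ginvM; exact: isext_comp.
- by move=> s [[f ef] [g eg]]; split; [exists g|exists f; rewrite ginvK].
Qed.

(** A realization is only required to be a ring homomorphism. Commutation with [d] is checked on
    generators, where it is the linear differential equation of [Z]. *)
Lemma isext_der s f x : isext E s f -> F x -> F (d x) /\ f (d x) = d (f x).
Proof.
move=> ef Fx; have [hf fE fZ] := ef.
suff [] : F x /\ (F (d x) /\ f (d x) = d (f x)) by [].
apply: (Fx (fun x => F x /\ (F (d x) /\ f (d x) = d (f x)))) => [|y [Ey|[a [b ->]]]].
- split; first split.
  + split; first exact: (subring1 rF).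
    by rewrite der1 (hom_on0 sF hf) (hom_on1 hf) der1; split=> //; exact: (subring0 rF).
  + move=> u v [Fu [Fdu eu]] [Fv [Fdv ev]]; split; first exact: (subringB rF).
    rewrite raddfB (hom_onB hf) // (hom_onB hf) // raddfB eu ev; split=> //.
    exact: (subringB rF).
  + move=> u v [Fu [Fdu eu]] [Fv [Fdv ev]]; split; first exact: (subringM rF).
    have F1 : F (d u * v) by exact: (subringM rF).
    have F2 : F (u * d v) by exact: (subringM rF).
    rewrite derM (hom_onD sF hf) // !(hom_onM hf) // derM eu ev; split=> //.
    exact: (subringD rF).
  + move=> u [Fu [Fdu eu]]; split; first exact: (subfieldV sF).
    have [->|u0] := eqVneq u 0.
      by rewrite invr0 raddf0 (hom_on0 sF hf) raddf0; split=> //; exact: (subring0 rF).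
    have F1 : F (- d u) by exact: (subringN rF).
    have F2 : F (u ^+ 2) by exact: (subringX rF).
    have fu : f u != 0 by apply: contra_neq u0; exact: (hom_on_eq0 sF hf Fu).
    rewrite derV // (hom_on_div sF hf) // (hom_onN sF hf) // (hom_onX sF hf) // (hom_onV sF hf) //.
    by rewrite derV // eu; split=> //; exact: (subfield_div sF).
- have Edy := dE Ey; rewrite fE // fE //; split; first exact: zfield_base.
  by split=> //; exact: zfield_base.
- split; first exact: zfield_Z.
  have e (t : G) : d (chi (t (Z a b))) = \sum_c psi (A a c) * chi (t (Z c b)).
    rewrite -dchi -dgal_der; move/matrixP/(_ a b): dZ; rewrite !mxE => ->.
    rewrite !rmorph_sum; apply: eq_bigr => c _.
    by rewrite !rmorphM mxE /= dgal_phi chi_phi.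
  have e1 : d (chi (Z a b)) = \sum_c psi (A a c) * chi (Z c b) := e 1%g.
  have Fc c : F (psi (A a c) * chi (Z c b)).
    by apply: (subringM rF) => //; [exact: (zfield_base (kE _))|exact: zfield_Z].
  split; first by rewrite e1; apply: (subring_sum rF).
  rewrite e1 (hom_on_sum sF hf) // fZ e; apply: eq_bigr => c _.
  have F1 : F (psi (A a c)) := zfield_base (kE _).
  have F2 : F (chi (Z c b)) by exact: zfield_Z.
  by rewrite (hom_onM hf F1 F2) fE ?fZ.
Qed.

Lemma isext_adj_intro t s f f' : isext E s f -> hom_on (adj F t) f' ->
  (forall x, F x -> f' x = f x) -> f' t = t -> isext (adj E t) s f'.
Proof.
move=> [_ fE fZ] hf' f'F f't.
have FA : forall x, zfield (adj E t) x -> adj F t x.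
  move=> x h; apply: (h (adj F t)) => [|y [Ay|[a [b ->]]]]; first exact: adj_subfield.
    by apply: adjS Ay => z; exact: zfield_base.
  by apply: adj_base; exact: zfield_Z.
split.
- exact: hom_onS FA hf'.
- move=> x Ax; have sP := hom_fix_subfield (adj_subfield F t) hf'.
  suff [] : adj F t x /\ f' x = x by [].
  apply: (Ax (fun x => adj F t x /\ f' x = x)) => // y [Ey|->].
    have Fy : F y by exact: zfield_base.
    by split; [exact: adj_base|rewrite f'F // fE].
  by split; [exact: adj_elt|].
- by move=> a b; rewrite f'F ?fZ //; exact: zfield_Z.
Qed.

(** Vanishing at [t] is divisibility by [B], which [f] preserves when it fixes [B]; the inverse
    realization [g] gives the converse. So [f] extends with [t] fixed. *)
Lemma isext_adj t B s f g : minrel F t B -> isext E s f -> isext E s^-1%g g ->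
  pmap f B = B -> exists f', isext (adj E t) s f'.
Proof.
move=> mB ef eg fB; have [hf fE fZ] := ef; have [hg _ _] := eg.
have [FB _ rB _] := mB.
have fwd h : hom_on F h -> pmap h B = B -> forall p, polyS F p -> p.[t] = 0 -> (pmap h p).[t] = 0.
  move=> hh hB p Fp rp; have [u Fu ->] := minrel_div sF mB Fp rp.
  by rewrite (pmapM sF hh) // hB hornerM rB mulr0.
have gf p : polyS F p -> pmap g (pmap f p) = p.
  move=> Fp; apply/polyP => i; rewrite (coef_pmap sF hg) (coef_pmap sF hf).
  exact: isextK ef eg _.
have gB : pmap g B = B by rewrite -{1}fB gf.
have [||f' [hf' f'F f't]] := @hom_ext L F f t sF hf.
- exact: fwd.
- move=> p Fp rp; rewrite -(gf p Fp); apply: fwd => // i.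
  by rewrite (coef_pmap sF hf); apply: isext_stable ef _.
by exists f'; exact: isext_adj_intro ef hf' f'F f't.
Qed.

Lemma GE_sub t s : GE (adj E t) s -> GE E s.
Proof.
have h u f : isext (adj E t) u f -> isext E u f.
  move=> [hf fE fZ]; split=> //; last by move=> x Ex; apply: fE; exact: adj_base.
  by apply: hom_onS hf => x; apply: zfieldS => y; exact: adj_base.
by move=> [[f /h ef] [g /h eg]]; split; [exists f|exists g].
Qed.

Lemma GE_adj t B s f : minrel F t B -> GE E s -> isext E s f -> pmap f B = B -> GE (adj E t) s.
Proof.
move=> mB [_ [g eg]] ef fB; have [hf _ _] := ef; have [hg _ _] := eg; split.
  exact: isext_adj mB ef eg fB.
apply: (isext_adj mB eg (g := f)); first by rewrite ginvK.
rewrite -{1}fB; apply/polyP => i; rewrite (coef_pmap sF hg) (coef_pmap sF hf).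
by apply: isextK ef eg _; have [] := mB.
Qed.

Lemma pmap_comp f g p : hom_on F f -> hom_on F g -> pmap (f \o g) p = pmap f (pmap g p).
Proof.
move=> hf hg; apply/polyP => i; rewrite !coef_map_id0 //= ?(hom_on0 sF hg) //.
  by rewrite (hom_on0 sF hf).
by rewrite (hom_on0 sF hf).
Qed.

(** Realizations fix [p], so they send the minimal relation [B] of [t] over E(Z) to one of the
    finitely many monic divisors of [p]. Elements with the same image of [B] have a quotient that
    fixes [B]. *)
Lemma findex_algebraic t p : p != 0 -> polyS E p -> root p t ->
  findex (GE E) (GE (adj E t)).
Proof.
move=> p0 Ep rp; have Fp : polyS F p by move=> i; apply: zfield_base.
have [B mB] := minrel_ex sF (ex_intro _ p (And3 Fp p0 (eqP rp))).
have [FB monB rB _] := mB; have [u Fu eu] := minrel_div sF mB Fp (eqP rp).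
have /choice[f_ fP] : forall s, exists f, GE E s -> isext E s f.
  move=> s; have [[[f ef] _]|ns] := pselect (GE E s); first by exists f.
  by exists id.
have [l lP] := fin_set_monic_divisors p0.
apply: (@findex_fin_set _ _ (fun s => pmap (f_ s) B)).
  exists l => _ [s Gs <-]; apply: lP; have ef := fP _ Gs; have [hf fE _] := ef.
  split.
    have sB : size (pmap (f_ s) B) = size B.
      by rewrite size_map_poly_id0 // (monicP monB) (hom_on1 hf) oner_eq0.
    by rewrite monicE lead_coefE sB (coef_pmap sF hf) -lead_coefE (monicP monB) (hom_on1 hf).
  apply/dvdpP; exists (pmap (f_ s) u); rewrite -(pmapM sF hf) // -eu.
  by apply/polyP => i; rewrite (coef_pmap sF hf) fE.
move=> s t' Gs Gt e; have [_ GM GV] := sgrp_GE.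
have [[_ _] [g eg]] := (Gs, Gs.2); have ef := fP _ Gs; have et := fP _ Gt.
have [hg _ _] := eg; have [hf _ _] := ef; have [ht _ _] := et.
apply: (GE_adj mB (GM _ _ (GV _ Gs) Gt) (isext_comp eg et)).
rewrite pmap_comp // -e; apply/polyP => i; rewrite (coef_pmap sF hg) (coef_pmap sF hf).
exact: isextK ef eg _.
Qed.

Lemma findex_transcendental t : (forall p, polyS F p -> p.[t] = 0 -> p = 0) ->
  forall s, GE E s -> GE (adj E t) s.
Proof.
move=> tr; suff key s f : isext E s f -> exists f', isext (adj E t) s f'.
  by move=> s [[f ef] [g eg]]; split; [exact: key ef|exact: key eg].
move=> ef; have [hf fE fZ] := ef.
have [||f' [hf' f'F f't]] := @hom_ext L F f t sF hf.
- move=> p Fp /(tr _ Fp) ->; have -> : pmap f 0 = 0; last by rewrite horner0.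
  by apply/polyP => i; rewrite (coef_pmap sF hf) !coef0 (hom_on0 sF hf).
- move=> p Fp rp; have /(pmap_eq0 sF hf Fp) -> : pmap f p = 0; last by rewrite horner0.
  by apply: tr => // i; rewrite (coef_pmap sF hf); apply: isext_stable ef _.
by exists f'; exact: isext_adj_intro ef hf' f'F f't.
Qed.

Let nat_neq0 i : (i.+1%:R : L) != 0.
Proof. by move/pcharf0P: ch0 => ->. Qed.

Let Fd x : F x -> F (d x).
Proof. by case/(isext_der isext_id). Qed.

(** Differentiating the relation at [t] gives a relation [R] of smaller degree, hence [R = 0]. Just
    below the top degree N this reads d b + N d t = 0 for the subleading coefficient b of [B], so t
    + b/N is a constant. *)
Lemma primitive_in t B : E (d t) -> minrel F t B -> F t.
Proof.
move=> Et [FB mB rB min]; have := der_horner ord0 B t; rewrite rB raddf0 => e.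
pose R := map_poly d B + d t *: B^`().
have Fdt : F (d t) by exact: zfield_base.
have sB : (1 < size B)%N.
  rewrite ltnNge; apply/negP => /size1_polyC; move: (B`_0) => c ec.
  by move: mB rB; rewrite ec monicE lead_coefC hornerC => /eqP -> /eqP; rewrite oner_eq0.
have eBs : (size B).-2.+1 = (size B).-1 by lia.
have R0 : R = 0.
  apply: min; last by rewrite hornerD hornerZ e mulrC.
    move=> i; rewrite coefD coefZ coef_map; apply: (subringD rF) => //; first exact: Fd.
    by apply: (subringM rF) => //; apply: (polyS_deriv rF).
  rewrite -(prednK (ltnW sB)) ltnS; apply/leq_sizeP => i hi.
  rewrite coefD coefZ coef_map coef_deriv /= [B`_i.+1]nth_default ?mul0rn ?mulr0 ?addr0; last first.
    by rewrite -(prednK (ltnW sB)) ltnS.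
  have [->|ne] := eqVneq i (size B).-1; first by rewrite -lead_coefE (monicP mB) der1.
  by rewrite nth_default ?raddf0 // -(prednK (ltnW sB)) ltn_neqAle eq_sym ne.
have := congr1 (fun p : {poly L} => p`_(size B).-2) R0.
rewrite coefD coefZ coef_map coef_deriv coef0 /= eBs -lead_coefE (monicP mB) => e2.
pose N : L := (size B).-1%:R; have N0 : N != 0 by rewrite /N -eBs.
have dN : d N = 0.
  by rewrite /N; elim: (_.-1) => [|i IH]; rewrite ?raddf0 // -natr1 raddfD /= IH der1 addr0.
have : d (t + B`_(size B).-2 / N) = 0.
  rewrite raddfD /= der_div // dN mulr0 subr0.
  have -> : d (B`_(size B).-2) = - (d t * N).
    by apply/eqP; rewrite -addr_eq0 e2.
  by field.
move/constE => Ec; have -> : t = (t + B`_(size B).-2 / N) - B`_(size B).-2 / N by rewrite addrK.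
apply: (subringB rF) => //; first exact: zfield_base.
apply: (subfield_div sF) => //; exact: (subring_nat rF).
Qed.

(** Subtracting [D%:R * a] times [B] cancels the top term of the differentiated relation, so [R = 0]
    by minimality. With b the constant coefficient of [B] this gives d b = D a b, so t^D / b is a
    constant. A zero b would allow division of [B] by X. *)
Lemma exponential_in t B : t != 0 -> E (d t / t) -> minrel F t B ->
  F (t ^+ (size B).-1).
Proof.
move=> t0 Et [FB mB rB min]; have := der_horner ord0 B t; rewrite rB raddf0 => e.
set D := (size B).-1; pose a := d t / t.
have Fa : F a by exact: zfield_base.
have sB : (0 < size B)%N by rewrite size_poly_gt0 monic_neq0.
have FN : F D%:R by exact: (subring_nat rF).
pose R := map_poly d B + a *: (B^`() * 'X) - (D%:R * a) *: B.
have R0 : R = 0.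
  apply: (min R).
  - apply: (polyS_B rF) => //; last by apply: (polyS_Z rF) => //; exact: (subringM rF).
    apply: (polyS_D rF) => //; first by move=> i; rewrite coef_map; exact: Fd.
    apply: (polyS_Z rF) => //; apply: (polyS_M rF) => //; last exact: (polyS_X rF).
    exact: (polyS_deriv rF).
  - rewrite -(prednK sB) ltnS; apply/leq_sizeP => i hi.
    rewrite coefB coefD !coefZ coefMX coef_map /=.
    have [ei|ne] := eqVneq i D.
      rewrite ei; have -> : (if D == 0%N then 0 else B^`()`_D.-1) = D%:R.
        case ED : D => [|D'] //=; rewrite coef_deriv -ED -lead_coefE (monicP mB).
        by rewrite ED.
      by rewrite -lead_coefE (monicP mB) der1; ring.
    have hi' : (size B <= i)%N by rewrite -(prednK sB) ltn_neqAle eq_sym ne.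
    rewrite [B`_i]nth_default // raddf0; case: (i) hi' => [|i'] hi' /=.
      by rewrite !mulr0; ring.
    by rewrite coef_deriv nth_default // mul0rn !mulr0 addr0 subr0.
  - rewrite hornerD hornerN hornerD !hornerZ hornerMX rB mulr0 subr0.
    rewrite [RHS]e; congr (_ + _); rewrite /a; by field.
have B00 : B`_0 != 0.
  apply/eqP => b0.
  have rX : root B 0 by rewrite rootE horner_coef0 b0.
  have [B1 eB] := factor_theorem _ _ rX; rewrite subr0 in eB.
  have nB : B != 0 by exact: monic_neq0.
  have nB1 : B1 != 0 by apply: contraNneq nB => h; rewrite eB h mul0r.
  case/eqP: (nB1); apply: min.
  - by move=> i; have := FB i.+1; rewrite eB coefMX.
  - by rewrite eB size_mulX.
  - by move/eqP: rB; rewrite eB hornerMX mulf_eq0 (negPf t0) orbF => /eqP.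
have := congr1 (fun p : {poly L} => p`_0) R0.
rewrite coefB coefD !coefZ coefMX coef_map coef0 /= mulr0 addr0 => /eqP.
rewrite subr_eq0 => /eqP dB0.
have : d (t ^+ D / B`_0) = 0.
  rewrite der_div // derX dB0.
  case: (D) => [|D']; first by rewrite expr0 /=; field.
  rewrite /= exprS /a; field.
  by rewrite t0 B00.
move/constE => Ec; rewrite -[t ^+ D](divfK B00); apply: (subringM rF) => //.
exact: zfield_base.
Qed.

Lemma isext_prim s f t : F t -> E (d t) -> isext E s f -> exists2 c, E c & f t = t + c.
Proof.
move=> Ft Et ef; exists (f t - t); last by rewrite addrC subrK.
apply: constE; rewrite raddfB /=; have [_ <-] := isext_der ef Ft.
by case: ef => _ -> //; rewrite subrr.
Qed.

Lemma isext_exp s f y : F y -> y != 0 -> E (d y / y) -> isext E s f ->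
  exists2 c, E c & f y = c * y.
Proof.
move=> Fy y0 Ey ef; exists (f y / y); last by rewrite divfK.
have [hf fE _] := ef; have [_ e] := isext_der ef Fy.
have e1 : d (f y) = d y / y * f y.
  have Fa : F (d y / y) by exact: (zfield_base Ey).
  by rewrite -e -{1}(divfK y0 (d y)) (hom_onM hf Fa Fy) fE.
by apply: constE; rewrite der_div // e1; field.
Qed.

Lemma isext_comm s u f f' g g' : isext E s f -> isext E s^-1%g f' -> isext E u g ->
  isext E u^-1%g g' -> isext E [~ s, u]%g (f' \o (g' \o (f \o g))).
Proof. by move=> ? ? ? ?; rewrite gcommE; do !apply: isext_comp. Qed.

Lemma minrel_X t : F t -> minrel F t ('X - t%:P).
Proof.
move=> Ft; split.
- by apply: (polyS_B rF); [exact: (polyS_X rF)|exact: (polyS_C rF)].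
- exact: monicXsubC.
- by rewrite hornerXsubC subrr.
- move=> p _; rewrite size_XsubC ltnS => /size1_polyC; move: (p`_0) => c ->.
  by rewrite hornerC => ->.
Qed.

(** Realizations translate [t] by elements of [E], and such translations commute; so a commutator
    fixes [t]. *)
Lemma prim_comm t s u : F t -> E (d t) -> GE E s -> GE E u -> GE (adj E t) [~ s, u]%g.
Proof.
move=> Ft Et Gs Gu; have [[f ef] [f' ef']] := Gs; have [[g eg] [g' eg']] := Gu.
have eh := isext_comm ef ef' eg eg'; have [hh _ _] := eh.
apply: (GE_adj (minrel_X Ft) _ eh); first by apply: sgrpR => //; exact: sgrp_GE.
rewrite (pmapB sF hh) ?(pmapX sF hh) ?(pmapC sF hh); last 2 first.
- exact: (polyS_X rF).
- exact: (polyS_C rF).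
have [c Ec fc] := isext_prim Ft Et ef; have [c' Ec' fc'] := isext_prim Ft Et ef'.
have [b Eb gb] := isext_prim Ft Et eg; have [b' Eb' gb'] := isext_prim Ft Et eg'.
have FE z : E z -> F z by exact: zfield_base.
have [rE _] := sE.
have add v h x z : isext E v h -> F x -> E z -> h (x + z) = h x + z.
  by move=> [hk kE' _] Fx Ez; rewrite (hom_onD sF hk Fx (FE _ Ez)) (kE' _ Ez).
have cc : c' + c = 0.
  apply: (addrI t); have := isextK ef ef' Ft.
  by rewrite fc (add _ _ _ _ ef') // fc' addrA addr0.
have bb : b' + b = 0.
  apply: (addrI t); have := isextK eg eg' Ft.
  by rewrite gb (add _ _ _ _ eg') // gb' addrA addr0.
congr ('X - _%:P); rewrite /= gb (add _ _ _ _ ef) // fc -addrA.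
rewrite (add _ _ _ _ eg') ?gb' //; last exact: (subringD rE).
rewrite -addrA (add _ _ _ _ ef') ?fc' //; last by do !apply: (subringD rE).
have -> : t + c' + (b' + (c + b)) = t + (c' + c) + (b' + b) by ring.
by rewrite cc bb !addr0.
Qed.

(** Realizations scale the power [y] of [t] by elements of [E], so commutators fix [y]. As X^D - y
    has the degree of [B], it is itself a minimal relation of [t], and it is fixed. *)
Lemma exp_comm t B s u : t != 0 -> E (d t / t) -> minrel F t B -> GE E s -> GE E u ->
  GE (adj E t) [~ s, u]%g.
Proof.
move=> t0 Et mB Gs Gu; have Fy := exponential_in t0 Et mB.
have [FB monB rB min] := mB; set D := (size B).-1 in Fy.
have sB : (1 < size B)%N.
  rewrite ltnNge; apply/negP => /size1_polyC; move: (B`_0) => c ec.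
  by move: monB rB; rewrite ec monicE lead_coefC hornerC => /eqP -> /eqP; rewrite oner_eq0.
have D0 : (0 < D)%N by rewrite /D; case: (size B) sB => [|[]].
have DE : D.+1 = size B by rewrite /D prednK // ltnW.
set y := t ^+ D in Fy; have y0 : y != 0 by rewrite expf_neq0.
have [rE VE] := sE.
have Ey : E (d y / y).
  have -> : d y / y = D%:R * (d t / t).
    by rewrite /y derX; case: (D) D0 => //= D' _; rewrite exprS; field; rewrite t0 expf_neq0.
  by apply: (subringM rE) => //; exact: (subring_nat rE).
have mB' : minrel F t ('X^D - y%:P).
  have sz : size ('X^D - y%:P) = size B by rewrite size_XnsubC.
  split; last by rewrite sz.
  - apply: (polyS_B rF); last exact: (polyS_C rF).
    by apply: (polyS_X_exp rF); exact: (polyS_X rF).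
  - exact: monicXnsubC.
  - by rewrite hornerD hornerN hornerXn hornerC subrr.
have [[f ef] [f' ef']] := Gs; have [[g eg] [g' eg']] := Gu.
have eh := isext_comm ef ef' eg eg'; have [hh _ _] := eh.
apply: (GE_adj mB' _ eh); first by apply: sgrpR => //; exact: sgrp_GE.
rewrite (pmapB sF hh) ?(pmapC sF hh); last 2 first.
- by apply: (polyS_X_exp rF); exact: (polyS_X rF).
- exact: (polyS_C rF).
have -> : pmap (f' \o (g' \o (f \o g))) 'X^D = 'X^D.
  apply/polyP => i; rewrite (coef_pmap sF hh) coefXn.
  by case: (_ == _); rewrite ?(hom_on0 sF hh) ?(hom_on1 hh).
have [c Ec fc] := isext_exp Fy y0 Ey ef; have [c' Ec' fc'] := isext_exp Fy y0 Ey ef'.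
have [b Eb gb] := isext_exp Fy y0 Ey eg; have [b' Eb' gb'] := isext_exp Fy y0 Ey eg'.
have FE z : E z -> F z by exact: zfield_base.
have scal v h x z : isext E v h -> F x -> E z -> h (z * x) = z * h x.
  by move=> [hk kE' _] Fx Ez; rewrite (hom_onM hk (FE _ Ez) Fx) (kE' _ Ez).
have cc : c * c' = 1.
  apply: (mulIf y0); have := isextK ef ef' Fy.
  by rewrite fc (scal _ _ _ _ ef') // fc' mulrA mul1r.
have bb : b * b' = 1.
  apply: (mulIf y0); have := isextK eg eg' Fy.
  by rewrite gb (scal _ _ _ _ eg') // gb' mulrA mul1r.
congr (_ - _%:P); rewrite /= gb (scal _ _ _ _ ef) // fc mulrA.
rewrite (scal _ _ _ _ eg') ?gb' //; last exact: (subringM rE).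
rewrite mulrA (scal _ _ _ _ ef') ?fc' //; last by do !apply: (subringM rE).
have -> : b * c * b' * (c' * y) = (b * b') * (c * c') * y by ring.
by rewrite cc bb !mul1r.
Qed.

End Base.

Lemma adj_step_der E t x : subfield E -> (forall x, E x -> E (d x)) -> lstep E t ->
  adj E t x -> adj E t (d x).
Proof.
move=> sE dE st ax; have sA := adj_subfield E t; have [rA _] := sA.
have At : adj E t t by exact: adj_elt.
have EA y : E y -> adj E t y by exact: adj_base.
have dEA y : E y -> adj E t (d y) by move/dE/EA.
suff Adt : adj E t (d t) by have [] := adj_der sA EA dEA At Adt ax.
case: st => [/EA|[t0 /EA e]|[q [q0 Eq rq]]] //.
  by rewrite -(divfK t0 (d t)); exact: (subringM rA).
exact: (der_algebraic ch0 sE sA EA dEA At q0 Eq rq).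
Qed.

Lemma vsolv_step E t : subfield E -> (forall a, E (psi a)) ->
  (forall x, E x -> E (d x)) -> lstep E t -> vsolv (GE (adj E t)) -> vsolv (GE E).
Proof.
move=> sE kE dE st vs; have sG := sgrp_GE kE; have sub := @GE_sub E t.
have sF := zfield_subfield E; pose F := zfield E.
have [tr|] := pselect (forall p, polyS F p -> p.[t] = 0 -> p = 0).
  by apply: vsolvS vs => s; split; [exact: sub|exact: (findex_transcendental kE tr)].
move=> /existsNP[p /not_implyP[Fp /not_implyP[rp /eqP p0]]].
have [B mB] := minrel_ex sF (ex_intro _ p (And3 Fp p0 rp)).
have sGA : sgrp (GE (adj E t)) by apply: sgrp_GE => a; exact: adj_base.
case: (st) => [e|[t0 e]|[q [q0 Eq rq]]].
- apply: vsolv_abelian vs => // s u Gs Gu.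
  have Ft : zfield E t by exact: (primitive_in kE dE e mB).
  exact: (prim_comm sE kE dE Ft e Gs Gu).
- apply: vsolv_abelian vs => // s u Gs Gu.
  exact: (exp_comm sE kE dE t0 e mB Gs Gu).
- by apply: vsolv_findex vs => //; exact: (findex_algebraic kE q0 Eq rq).
Qed.


Lemma vsolv_tower E ts : subfield E -> (forall a, E (psi a)) ->
  (forall x, E x -> E (d x)) -> ltower E ts -> (forall a b, adjs E ts (chi (Z a b))) ->
  vsolv (GE E).
Proof.
elim: ts E => [|t ts IH] E sE kE dE /= => [_ ZE|[st tt] ZE].
  (* At the top of the tower [Z] lies in [E], so a realization fixes it and only the identity
     remains. *)
  have triv s : GE E s -> s = 1%g.
    move=> [[f [_ fE fZ]] _]; apply: dgal_eq_on; apply/matrixP => a b; rewrite !mxE.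
    by apply: (fmorph_inj chi); rewrite -fZ fE //; exact: ZE.
  exists (GE E); split=> //; first exact: sgrp_GE.
    by exists unit, (fun _ => tt) => s u /triv-> /triv-> _; rewrite invg1 mulg1; case: (sgrp_GE kE).
  by exists 0%N.
apply: (vsolv_step sE kE dE st); apply: IH => //.
- exact: adj_subfield.
- by move=> a; exact: adj_base.
- by move=> x; exact: adj_step_der.
Qed.

(** Over the image of [k], the field E(Z) lies in the image of [K], so transport along [chi]
    realizes every element of the group and [vsolv_tower] speaks of all of it. *)
Lemma liouvillian_vsolv : [pchar k] =i pred0 -> param_liouvillian psi ->
  vsolv (fun _ : dgal phi => True).
Proof.
move=> chk pl; pose k0 y := exists a, psi a = y.
have sk : subfield k0 := image_subfield psi.
have [|ts tts tsP] := @lunion_common _ _ k0 [seq chi (Z ab.1 ab.2) | ab : 'I_n * 'I_n].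
  by move=> x _; exact: liouvillian_lunion.
have kk a : k0 (psi a) by exists a.
apply: (vsolvS _ (@vsolv_tower k0 ts sk kk _ tts _)).
- move=> s; split=> // _.
  suff key (u : G) : exists f, isext k0 u f by split; exact: key.
  have /choice[f fP] : forall y, exists z, forall x, y = chi x -> z = chi (u x).
    move=> y; have [[x ->]|nx] := pselect (exists x, y = chi x).
      by exists (chi (u x)) => x' /fmorph_inj ->.
    by exists 0 => x ex; case: nx; exists x.
  have fE x : f (chi x) = chi (u x) by exact: fP.
  have im x : zfield k0 x -> exists y, chi y = x.
    move=> h; apply: (h (fun x => exists y, chi y = x)) => [|y [[a <-]|[a [b ->]]]].
    - exact: image_subfield.
    - by exists (phi a).
    - by exists (Z a b).
  exists f; split=> [|_ [a <-]|a b]; last exact: fE.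
    split; first by rewrite -(rmorph1 chi) fE [u 1]rmorph1.
    - by move=> _ _ /im[x <-] /im[y <-]; rewrite -rmorphB !fE [u _]rmorphB rmorphB.
    - by move=> _ _ /im[x <-] /im[y <-]; rewrite -rmorphM !fE [u _]rmorphM rmorphM.
  by rewrite -chi_phi fE dgal_phi.
- by move=> _ [a <-]; exists (der k ord0 a).
- by move=> a b; apply: tsP; apply/mapP; exists (a, b); rewrite ?mem_enum.
Qed.
End Liouvillian.
End PPVMatrix.

(** * Liouvillian towers from solvability *)

Section ConstantSpan.
Variables (m : nat) (C0 : DField m) (K : DField m.+1) (e : {rmorphism C0 -> K}).

Definition cspan q (a : 'I_q -> K) x := exists c : 'I_q -> C0, x = \sum_i e (c i) * a i.

Lemma cspan_base q (a : 'I_q -> K) i : cspan a (a i).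
Proof.
exists (fun l => (l == i)%:R); rewrite (bigD1 i) //= eqxx rmorph1 mul1r big1 ?addr0 //.
by move=> l /negPf->; rewrite rmorph0 mul0r.
Qed.

Lemma cspan_scale q (a : 'I_q -> K) c x : cspan a x -> cspan a (e c * x).
Proof.
move=> [b ->]; exists (fun i => c * b i); rewrite mulr_sumr.
by apply: eq_bigr => i _; rewrite rmorphM mulrA.
Qed.

Lemma cspan_sum q (a : 'I_q -> K) I (r : seq I) (x : I -> K) :
  (forall i, cspan a (x i)) -> cspan a (\sum_(i <- r) x i).
Proof.
move=> ax; elim/big_ind: _ => [|_ _ [b ->] [c ->]|//].
- by exists (fun _ => 0); rewrite big1 // => i _; rewrite rmorph0 mul0r.
- exists (fun i => b i + c i); rewrite -big_split; apply: eq_bigr => i _ /=.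
  by rewrite rmorphD mulrDl.
Qed.
End ConstantSpan.

Section SolvableTower.
Variables (m n : nat) (k K : DField m.+1) (A : 'M[k]_n) (phi : {rmorphism k -> K}).
Hypotheses (dphi : dmorph phi) (nnc : no_new_constants phi).
Variable Z : 'M[K]_n.
Hypotheses (uZ : Z \in unitmx) (dZ : map_mx (der K ord0) Z = map_mx phi A *m Z)
  (genZ : forall x : K, dgen phi (fun y => exists i j, y = Z i j) x).
Hypothesis ch0 : [pchar k] =i pred0.
Variables (C0 : DField m) (j : {rmorphism C0 -> k}).
Hypotheses (j0 : forall x, der k ord0 (j x) = 0)
  (jS : forall c, der k ord0 c = 0 -> exists x, j x = c)
  (jD : forall i x, j (der C0 i x) = der k (lift ord0 i) (j x))
  (dcl : diff_closed C0).
Local Notation e := (phi \o j : {rmorphism C0 -> K}).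
Local Notation d := (der K ord0).
Local Notation G := (dgal phi).
Let k0 (y : K) := exists a, phi a = y.
Let W := lunion k0.

Let sk0 : subfield k0 := image_subfield phi.
Let sW : subfield W := lunion_subfield sk0.
Let rW : subring W. Proof. by case: sW. Qed.
Let acl : root_closed C0 := diff_closed_root_closed (char0_C0 ch0 j) dcl.

Lemma dgal_invariant x : (forall s : G, s x = x) -> k0 x.
Proof.
move=> fx; apply: contrapT => nx.
have [|s sP nsx] := ppv_normal dphi uZ dZ genZ nnc ch0 j0 jS jD dcl (x := x).
  by move=> a; apply/eqP => ax; apply: nx; exists a.
by have /= sx := fx (DGal sP); rewrite sx eqxx in nsx.
Qed.

(* The product of the [X - u] over the finite orbit of [x] is invariant. *)
Lemma invariant_lunion J x : findex (fun _ : G => True) J ->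
  (forall s, J s -> s x = x) -> W x.
Proof.
move=> [T [t tP]] Jx; have [r [_ rP]] := reps (sgrp_full phi) tP.
pose S := undup [seq r c x | c <- enum T].
have gS (g : G) : g x \in S.
  rewrite mem_undup; apply/mapP; exists (t g); first by rewrite mem_enum.
  rewrite -[LHS](dgalKV (r (t g))) -[X in _ = _ X](Jx _ (rP g I)).
  by [].
pose P := \prod_(u <- S) ('X - u%:P).
have PS (s : G) : map_poly (dgal_fun s) P = P.
  rewrite /P rmorph_prod; under eq_bigr do rewrite /= map_polyXsubC.
  rewrite -(big_map (dgal_fun s) xpredT (fun u => 'X - u%:P)).
  apply: perm_big; apply: uniq_perm.
  - by rewrite map_inj_uniq ?undup_uniq //; exact: fmorph_inj.
  - exact: undup_uniq.
  apply: (uniq_min_size _ _ _).2; rewrite ?size_map //.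
    by rewrite map_inj_uniq ?undup_uniq //; exact: fmorph_inj.
  move=> _ /mapP[u + ->]; rewrite mem_undup => /mapP[c _ ->].
  exact: (gS (s * r c)%g).
apply: (lunion_step sk0); constructor 3; exists P; split.
- by apply: monic_neq0; exact: monic_prod_XsubC.
- move=> i; apply: lunion_base; apply: dgal_invariant => s.
  by rewrite -{2}(PS s) coef_map.
- rewrite root_prod_XsubC; exact: (gS 1%g).
Qed.

Lemma lunion_const c : W (e c).
Proof. by apply: lunion_base; exists (j c). Qed.

Lemma dgal_lin (s : G) q (c : 'I_q -> C0) (w : 'I_q -> K) :
  s (\sum_i e (c i) * w i) = \sum_i e (c i) * s (w i).
Proof. by rewrite rmorph_sum; apply: eq_bigr => i _; rewrite rmorphM /= dgal_phi. Qed.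

Lemma cspan_lunion q (w : 'I_q -> K) x : (forall i, W (w i)) -> cspan e w x -> W x.
Proof.
move=> Ww [c ->]; apply: (subring_sum rW) => i _; apply: (subringM rW) => //.
exact: lunion_const.
Qed.

Lemma stable_eigenvector q (w : 'I_q.+1 -> K) (H : G -> Prop) r : sgrp H -> solv r H -> cindep e w ->
  (forall s, H s -> forall i, cspan e w (s (w i))) ->
  exists J, [/\ sgrp J, forall s, J s -> H s, findex H J &
    exists2 v : 'I_q.+1 -> C0, (exists i, v i != 0) &
      forall s, J s -> exists2 a, a != 0 &
        s (\sum_i e (v i) * w i) = e a * \sum_i e (v i) * w i].
Proof.
move=> sH solH iw st.
have /choice[M MP] : forall s, exists M : 'M[C0]_q.+1, H s ->
    forall i, s (w i) = \sum_l e (M l i) * w l.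
  move=> s; have [Hs|nHs] := pselect (H s); last by exists 0.
  have /choice[c cP] := st s Hs.
  by exists (\matrix_(l, i) c i l) => _ i; rewrite cP; apply: eq_bigr => l _; rewrite mxE.
have uniqM (a b : 'I_q.+1 -> C0) : \sum_l e (a l) * w l = \sum_l e (b l) * w l -> a =1 b.
  move/eqP; rewrite -subr_eq0 -sumrB => /eqP h i; apply/eqP; rewrite -subr_eq0; apply/eqP.
  apply: (iw (fun l => a l - b l)); rewrite -[RHS]h.
  by apply: eq_bigr => l _; rewrite rmorphB mulrBl.
have [H1 HM HV] := sH.
have M1 : M 1%g = 1%:M.
  apply/matrixP => l i; move: l; apply: uniqM; rewrite -MP // dgal1E.
  rewrite (bigD1 i) //= mxE eqxx !rmorph1 mul1r big1 ?addr0 // => l /negPf nl.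
  by rewrite mxE nl !rmorph0 mul0r.
have MM s u : H s -> H u -> M (s * u)%g = M s *m M u.
  move=> Hs Hu; apply/matrixP => l i; move: l; apply: uniqM.
  rewrite -MP; last exact: HM.
  rewrite dgalE MP // dgal_lin.
  under eq_bigr do rewrite MP // mulr_sumr.
  rewrite exchange_big; apply: eq_bigr => l _ /=.
  rewrite mxE !rmorph_sum mulr_suml; apply: eq_bigr => l' _ /=.
  by rewrite !rmorphM /=; ring.
(* An eigenvector of columns is wanted, whereas [lie_kolchin] provides one of rows. Transposition
   reverses products, and inversion reverses them back. *)
have rep : mxrep H (fun s => (M s^-1%g)^T).
  split; first by rewrite invg1 M1 trmx1.
  by move=> s u Hs Hu; rewrite ginvM MM ?trmx_mul //; exact: HV.
have [J [sJ JH fJ [v v0 vP]]] := lie_kolchin acl sH solH rep (ltn0Sn q).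
exists J; split=> //; exists (v 0).
  apply: contrapT => n0; case/eqP: v0; apply/rowP => i; rewrite mxE.
  by apply/eqP; apply: contraT => h; case: n0; exists i.
move=> s Js; have [_ _ JV] := sJ; have [a] := vP _ (JV _ Js); rewrite ginvK => av.
have av' l : \sum_i M s l i * v 0 i = a * v 0 l.
  move/matrixP/(_ 0 l): av; rewrite !mxE => <-.
  by apply: eq_bigr => i _; rewrite mxE mulrC.
have se : s (\sum_i e (v 0 i) * w i) = e a * \sum_i e (v 0 i) * w i.
  rewrite dgal_lin.
  under eq_bigr do rewrite (MP _ (JH _ Js)) mulr_sumr.
  rewrite exchange_big mulr_sumr; apply: eq_bigr => l _ /=.
  rewrite [RHS]mulrA -!rmorphM -av' !rmorph_sum mulr_suml.
  by apply: eq_bigr => i _; rewrite !rmorphM /=; ring.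
exists a => //; apply: contraNneq v0 => a0.
have f0 : \sum_i e (v 0 i) * w i = 0.
  by apply: (fmorph_inj s); rewrite [LHS]se a0 !rmorph0 mul0r.
by apply/eqP/rowP => i; rewrite mxE; exact: (iw _ f0).
Qed.

(* Liouville's induction: with [f] an eigenvector, [d f / f] is invariant, and the
   derivatives of the quotients [w i / f] span a stable space of smaller dimension. *)
Lemma stable_lunion q (w : 'I_q -> K) (H : G -> Prop) r : sgrp H -> solv r H ->
  findex (fun _ => True) H -> cindep e w ->
  (forall s, H s -> forall i, cspan e w (s (w i))) -> forall i, W (w i).
Proof.
elim: q w H => [|q IH] w H sH solH fH iw st; first by case.
have [J [sJ JH fJ [v [i0 vi0] vP]]] := stable_eigenvector sH solH iw st.
have fGJ := findex_trans (sgrp_full phi) fH fJ.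
set f := \sum_i _ in vP.
have f0 : f != 0 by apply: contraNneq vi0 => h; apply/eqP; exact: (iw _ h).
have de c : d (e c) = 0 by exact: const0.
have Wf : W f.
  apply: (lunion_step sk0); constructor 2; split=> //.
  apply: (invariant_lunion fGJ) => s /vP[a a0 sf].
  have ea : e a != 0 by rewrite fmorph_eq0.
  rewrite fmorph_div /= dgal_der sf derM de mul0r add0r; field.
  by rewrite f0 ea.
(* Since [v i0 != 0], the vector [f] can replace [w i0] in the basis; putting it first lets
   [cindep_der] give independence of the family [u]. *)
pose w' i := if unlift ord0 i is Some l then w (lift i0 l) else f.
have w'0 : w' ord0 = f by rewrite /w' unlift_none.
have w'l l : w' (lift ord0 l) = w (lift i0 l) by rewrite /w' liftK.
have iw' : cindep e w'.
  move=> c; rewrite big_ord_recl w'0 => h.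
  pose b i := c ord0 * v i + (if unlift i0 i is Some l then c (lift ord0 l) else 0).
  have hb : \sum_i e (b i) * w i = 0.
    rewrite -[RHS]h /f mulr_sumr /b.
    under eq_bigr do rewrite rmorphD mulrDl rmorphM -mulrA.
    rewrite big_split /=; congr (_ + _).
    rewrite (bigD1_ord i0) //= unlift_none !rmorph0 mul0r add0r.
    by apply: eq_bigr => l _; rewrite liftK w'l.
  have c0 : c ord0 = 0.
    have := iw _ hb i0; rewrite /b unlift_none addr0 => /eqP.
    by rewrite mulf_eq0 (negPf vi0) orbF => /eqP.
  move=> i; case: (unliftP ord0 i) => [l ->|->] //.
  by have := iw _ hb (lift i0 l); rewrite /b liftK c0 mul0r add0r.
pose u l := d (w (lift i0 l) / f).
have iu : cindep e u.
  have h := cindep_der (const0 dphi j0) (constS dphi nnc jS) iw'.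
  by move=> c hc; apply: h; rewrite -[RHS]hc; apply: eq_bigr => i _; rewrite w'l w'0.
have wi0 : w i0 = e (v i0)^-1 * (f - \sum_l e (v (lift i0 l)) * w (lift i0 l)).
  by rewrite /f (bigD1_ord i0) //= addrK !fmorphV mulKf // !fmorph_eq0.
(* The quotient left out of [u] is recovered by differentiating the relation that the combination of
   the [w i / f] with coefficients [v] equals 1. *)
have ul i : cspan e u (d (w i / f)).
  case: (unliftP i0 i) => [l ->|->]; first exact: cspan_base.
  exists (fun l => - (v i0)^-1 * v (lift i0 l)).
  rewrite wi0 mulrBr mulrBl -mulrA divff // raddfB /= mulr1 de sub0r.
  rewrite -mulrA derM de mul0r add0r mulr_suml raddf_sum mulr_sumr -sumrN.
  apply: eq_bigr => l _ /=; rewrite -mulrA derM de mul0r add0r /u.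
  by rewrite rmorphM rmorphN; ring.
have Wu : forall l, W (u l).
  apply: IH sJ (solv_sub sJ JH solH) fGJ iu _ => s Js l.
  have [a a0 sf] := vP _ Js; have [c cP] := st _ (JH _ Js) (lift i0 l).
  have ea : e a != 0 by rewrite fmorph_eq0.
  have -> : s (u l) = \sum_i e (a^-1 * c i) * d (w i / f).
    rewrite /u dgal_der fmorph_div /= sf cP mulr_suml raddf_sum; apply: eq_bigr => i _ /=.
    have -> : e (c i) * w i / (e a * f) = e (a^-1 * c i) * (w i / f).
      by rewrite [e (_ * _)]rmorphM fmorphV /=; field; rewrite ea f0.
    by rewrite derM de mul0r add0r.
  by apply: cspan_sum => i; exact: cspan_scale.
have Wl l : W (w (lift i0 l)).
  rewrite -(divfK f0 (w _)); apply: (subringM rW) => //.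
  by apply: (lunion_step sk0); constructor 1; exact: Wu.
move=> i; case: (unliftP i0 i) => [l ->|->] //.
rewrite wi0; apply: (subringM rW); first exact: lunion_const.
apply: (subringB rW) => //; apply: (subring_sum rW) => l _.
by apply: (subringM rW) => //; exact: lunion_const.
Qed.

(** The span of the entries of [Z] over the constants is stable, because group elements act on [Z]
    by constant matrices; [stable_lunion] applies to a basis of it. *)
Lemma solvable_lunion (H : G -> Prop) r : sgrp H -> solv r H -> findex (fun _ : G => True) H ->
  forall a b, W (Z a b).
Proof.
move=> sH solH fH.
have [q [w [iw wl lw]]] := cbasis_ex e [seq Z ab.1 ab.2 | ab : 'I_n * 'I_n].
have Zw a b : cspan e w (Z a b).
  by apply: lw; apply/mapP; exists (a, b); rewrite ?mem_enum.
have Ww : forall i, W (w i).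
  apply: (stable_lunion sH solH fH iw) => s _ i.
  have /mapP[[a b] _ ->] /= := wl i.
  have [M eM M0] := dgal_matrix nnc uZ dZ s.
  move/matrixP/(_ a b): eM; rewrite !mxE => ->; apply: cspan_sum => c; rewrite mxE.
  have [x ex] := constS dphi nnc jS (M0 c b).
  by rewrite mulrC -ex; exact: cspan_scale.
by move=> a b; exact: cspan_lunion (Zw a b).
Qed.

(** A plain tower that captures [Z] is also a differential one: each step remains a step over the
    larger differential field, and the elements adjoined generate [K] because they generate [Z]. *)
Lemma solvable_liouvillian (H : G -> Prop) r : sgrp H -> solv r H -> findex (fun _ : G => True) H ->
  param_liouvillian phi.
Proof.
move=> sH solH fH; have WZ := solvable_lunion sH solH fH.
have [|ts tts tsP] := @lunion_common _ _ k0 [seq Z ab.1 ab.2 | ab : 'I_n * 'I_n].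
  by move=> x /mapP[[a b] _ ->]; exact: WZ.
have sub us x : adjs k0 us x -> dgen phi (fun y => y \in us) x.
  move=> ax P dP Pk Pus; have [[P0 P1] PB PM PV _] := dP.
  have sP : subfield P.
    split=> // y Py; have [->|y0] := eqVneq y 0; first by rewrite invr0.
    exact: PV.
  apply: (adjs_sub sP _ Pus) ax.
  by move=> _ [a <-].
split=> //; exists ts; split.
- move=> x P dP Pk Pts; apply: genZ => // _ [a [b ->]].
  apply: (sub ts) => //; apply: tsP.
  by apply/mapP; exists (a, b); rewrite ?mem_enum.
- move=> i lt; have := ltower_nth tts lt => -[/sub|[t0 /sub]|[p [p0 Ap rp]]].
  + by constructor 1.
  + by constructor 2.
  + by constructor 3; exists p; split=> // l; exact: sub.
Qed.
End SolvableTower.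

Theorem theorem3p12 (m n : nat) (k : DField m.+1) (A : 'M[k]_n)
    (K : DField m.+1) (phi : {rmorphism k -> K}) :
  [pchar k] =i pred0 ->
  constants_diff_closed k ->
  PPV_ext A phi ->
  [<-> (exists H : (K -> K) -> Prop,
          [/\ subgroup_of (PPV_group phi) H, solvable_grp H
            & finite_index (PPV_group phi) H]);
       param_liouvillian phi;
       exists (L : DField m.+1) (psi : {rmorphism k -> L}) (chi : {rmorphism K -> L}),
         [/\ param_liouvillian psi, dmorph chi & forall a, chi (phi a) = psi a]].
Proof.
move=> ch0 [C0 [j [j0 jS jD dcl]]] [dphi [Z [uZ dZ genZ nnc]]]; tfae.
- move=> [H [sub sol fi]]; have [sH fH [r solH]] := statement_solv sub sol fi.
  exact: (solvable_liouvillian dphi nnc uZ dZ genZ ch0 j0 jS jD dcl sH solH fH).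
- by move=> pl; exists K, phi, idfun.
- move=> [L [psi [chi [pl dchi chi_phi]]]]; apply: vsolv_statement.
  have chL : [pchar L] =i pred0.
    by move=> p; rewrite -(ch0 p) !inE -(rmorph_nat psi) fmorph_eq0.
  have [dpsi nncL _] := pl.
  exact: (liouvillian_vsolv nnc uZ dZ genZ dpsi dchi chi_phi nncL chL ch0 pl).
Qed.
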